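(* Let $n\ge 3$ and let $\mathcal{F}(\mathcal{X})$ be the germ at $0\in\mathbb{C}^n$ of the holomorphic foliation defined by a vector field $\mathcal{X}\in\mathrm{Gen}\left(\mathfrak{X}(\mathbb{C}^n,0)\right)$ satisfying condition $(\star)$. If $\mathcal{F}(\mathcal{X})$ possesses a formal first integral, then it also possesses a holomorphic first integral.
   Context: $\mathfrak{X}(\mathbb{C}^n,0)$ is the set of germs at $0$ of holomorphic vector fields on $\mathbb{C}^n$ vanishing at $0$; $\mathcal{F}(\mathcal{X})$ is the germ of one-dimensional singular holomorphic foliation whose leaves are the orbits of $\mathcal{X}$. $\mathcal{O}_n$ is the ring of germs of holomorphic functions at $0\in\mathbb{C}^n$, $\mathcal{M}_n$ its maximal ideal, and $\hat{\mathcal{O}}_n$ the ring of formal power series in $n$ variables. $\mathcal{X}\in\mathrm{Gen}(\mathfrak{X}(\mathbb{C}^n,0))$ (non-degenerate generic) means that $\mathrm{d}\mathcal{X}(0)$ is non-singular and diagonalizable and that, after a suitable holomorphic change of coordinates, $\mathcal{X}$ leaves the coordinate hyperplanes invariant; after such a change of coordinates it can be written as $\mathcal{X}(x)=\sum_{i=1}^n\lambda_i x_i(1+a_i(x))\frac{\partial}{\partial x_i}$ with $\lambda_i\in\mathbb{C}^*$ and $a_i\in\mathcal{M}_n$. Condition $(\star)$: there is a real line $L\subset\mathbb{C}$ through the origin separating a certain eigenvalue of $\mathrm{d}\mathcal{X}(0)$ from the others, i.e. one eigenvalue lies in one of the open half-planes bounded by $L$ and all the others lie in the other one. A formal first integral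 of $\mathcal{F}(\mathcal{X})$ is a formal map $\hat F=(\hat f_1,\dots,\hat f_{n-1})$ with $\hat f_i\in\hat{\mathcal{O}}_n$ such that the formal $(n-1)$-form $\mathrm{d}\hat f_1\wedge\dots\wedge\mathrm{d}\hat f_{n-1}$ is not identically zero and $\mathcal{X}(\hat f_i)\equiv 0$ for all $i=1,\dots,n-1$. A holomorphic first integral of $\mathcal{F}(\mathcal{X})$ is a germ of holomorphic map $F=(f_1,\dots,f_{n-1}):(\mathbb{C}^n,0)\to(\mathbb{C}^{n-1},0)$ such that $\mathrm{d}f_1\wedge\dots\wedge\mathrm{d}f_{n-1}$ is not identically zero and the leaves of $\mathcal{F}(\mathcal{X})$ are contained in level sets of $F$ (equivalently $\mathcal{X}(f_i)\equiv0$ for all $i$). *)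

(* Defs.v *)
From HB Require Import structures.
From mathcomp Require Import all_boot all_order all_algebra.
From mathcomp Require Import all_classical all_reals.
From mathcomp Require Import complex topology normedtype sequences derive.

Set Implicit Arguments.
Unset Strict Implicit.
Unset Printing Implicit Defensive.

Import Order.TTheory GRing.Theory Num.Theory.
Import numFieldNormedType.Exports.

Local Open Scope classical_set_scope.
Local Open Scope ring_scope.

Definition multiindex (n : nat) := {ffun 'I_n -> nat}.

Definition mdeg (n : nat) (k : multiindex n) : nat := (\sum_(i < n) k i)%N.

(* The multi-indices with all entries at most N, as a finite type. *)
Definition box (n N : nat) := {ffun 'I_n -> 'I_N.+1}.

Definition of_box (n N : nat) (k : box n N) : multiindex n :=
  [ffun i => k i : nat].

Definition fps (K : comNzRingType) (n : nat) := multiindex n -> K.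

Section FormalPowerSeries.
Variables (K : comNzRingType) (n : nat).
Implicit Types (f g h : fps K n) (m k l : multiindex n).

HB.instance Definition _ := GRing.Zmodule.copy (fps K n) (multiindex n -> K).

Definition fps_one : fps K n := fun m => (m == 0)%:R.

(* If k + l = m then all entries of k and l are at most mdeg m, so the sum
   below runs over all decompositions of m. *)
Definition fps_mul f g : fps K n := fun m =>
  \sum_(k : box n (mdeg m))
    \sum_(l : box n (mdeg m) | of_box k + of_box l == m)
      f (of_box k) * g (of_box l).

Lemma of_box_inj N : injective (@of_box n N).
Proof.
move=> k l /ffunP e; apply/ffunP => i; apply: val_inj.
by have := e i; rewrite !ffunE.
Qed.

Lemma of_box_le N (k : box n N) i : (of_box k i <= N)%N.
Proof. by rewrite ffunE -ltnS ltn_ord. Qed.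

Definition to_box N m : box n N := [ffun i => inord (m i)].

Lemma to_boxK N m : (forall i, (m i <= N)%N) -> of_box (to_box N m) = m.
Proof. by move=> mN; apply/ffunP => i; rewrite !ffunE inordK // ltnS. Qed.

Lemma of_boxK N : cancel (@of_box n N) (to_box N).
Proof. by move=> k; apply: of_box_inj; rewrite to_boxK //; exact: of_box_le. Qed.

Lemma le_mdeg m i : (m i <= mdeg m)%N.
Proof. by rewrite /mdeg (bigD1 i) //= leq_addr. Qed.

Lemma midxD k l i : (k + l) i = (k i + l i)%N.
Proof. by rewrite ffunE. Qed.

Lemma box_widen N M (G : multiindex n -> K) : (N <= M)%N ->
  (forall k i, (N < k i)%N -> G k = 0) ->
  \sum_(k : box n M) G (of_box k) = \sum_(k : box n N) G (of_box k).
Proof.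
move=> NM G0; rewrite (bigID (fun k : box n M => [forall i, k i <= N]%N)) /=.
rewrite [X in _ + X]big1 ?addr0; last first.
  move=> k; rewrite negb_forall => /existsP[c]; rewrite -ltnNge => Nk.
  apply: (G0 _ c).
  by rewrite ffunE.
rewrite (reindex_onto (fun k : box n N => to_box M (of_box k))
                      (fun k : box n M => to_box N (of_box k))) /=; last first.
  move=> k /forallP kN; rewrite to_boxK ?of_boxK// => i.
  by rewrite ffunE.
have eqB (k : box n N) : of_box (to_box M (of_box k)) = of_box k.
  by rewrite to_boxK // => i; apply: leq_trans NM; exact: of_box_le.
apply: eq_big => [k|k _]; last by rewrite eqB.
rewrite eqB of_boxK eqxx andbT; apply/forallP => i.
have := of_box_le k i; rewrite -{1}eqB.
by rewrite [X in (X <= _)%N -> _]ffunE.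
Qed.

Lemma fps_mulE N f g m : (forall i, (m i <= N)%N) ->
  fps_mul f g m = \sum_(k : box n N) \sum_(l : box n N | of_box k + of_box l == m)
                    f (of_box k) * g (of_box l).
Proof.
move=> mN.
pose S A B := \sum_(k : box n A) \sum_(l : box n B)
   (if of_box k + of_box l == m then f (of_box k) * g (of_box l) else 0).
have SE A : \sum_(k : box n A) \sum_(l : box n A | of_box k + of_box l == m)
                    f (of_box k) * g (of_box l) = S A A.
  by apply: eq_bigr => k _; rewrite big_mkcond.
rewrite /fps_mul !SE; set D := mdeg m.
suff H A B : (forall i, (m i <= A)%N) -> (A <= B)%N -> S A A = S B B.
  have mD i : (m i <= D)%N by exact: le_mdeg.
  rewrite (H D (maxn N D)) ?leq_maxr// -(H N (maxn N D)) ?leq_maxl//.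
move=> mA AB; symmetry.
transitivity (S B A); rewrite /S.
  apply: eq_bigr => k _.
  rewrite (box_widen (G := fun l => if of_box k + l == m then
    f (of_box k) * g l else 0) AB)// => l i Al.
  case: eqP => // /ffunP/(_ i); rewrite midxD => e.
  by have := mA i; rewrite -e leqNgt ltn_addl.
rewrite (box_widen (G := fun k => \sum_(l : box n A)
   (if k + of_box l == m then f k * g (of_box l) else 0)) AB)// => k i Ak.
apply: big1 => l _; case: eqP => // /ffunP/(_ i); rewrite midxD => e.
by have := mA i; rewrite -e leqNgt ltn_addr.
Qed.

Lemma fps_mulC : commutative fps_mul.
Proof.
move=> f g; apply/funext => m; rewrite /fps_mul.
rewrite (exchange_big_dep predT) //=; apply: eq_bigr => k _.
by apply: eq_big => l; rewrite addrC // mulrC.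
Qed.

Lemma fps_mul1 : left_id fps_one fps_mul.
Proof.
move=> f; apply/funext => m; rewrite /fps_mul.
rewrite (bigD1 (to_box _ 0)) //= [X in _ + X]big1 ?addr0; last first.
  move=> k k0; apply: big1 => l _; rewrite /fps_one.
  case: eqP => [e|]; last by rewrite mul0r.
  by rewrite -e of_boxK eqxx in k0.
rewrite to_boxK => [|i]; last by rewrite ffunE.
rewrite (big_pred1 (to_box _ m)) => [|l].
  by rewrite to_boxK ?/fps_one ?eqxx ?mul1r// => i; exact: le_mdeg.
rewrite add0r /= -(inj_eq (@of_box_inj _)) to_boxK// => i; exact: le_mdeg.
Qed.

Lemma fps_mulDl : left_distributive fps_mul +%R.
Proof.
move=> f g h; apply/funext => m.
rewrite /fps_mul [RHS]/GRing.add /= -big_split /=; apply: eq_bigr => k _.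
by rewrite -big_split /=; apply: eq_bigr => l _; rewrite -mulrDl.
Qed.

Lemma fps_mul3E f g h m : fps_mul (fps_mul f g) h m =
  \sum_(k : box n (mdeg m)) \sum_(l : box n (mdeg m)) \sum_(j : box n (mdeg m))
    if of_box k + of_box l + of_box j == m
    then f (of_box k) * g (of_box l) * h (of_box j) else 0.
Proof.
set D := mdeg m.
transitivity (\sum_(p : box n D) \sum_(j : box n D)
   \sum_(k : box n D) \sum_(l : box n D)
   if (of_box k + of_box l == of_box p) && (of_box p + of_box j == m)
   then f (of_box k) * g (of_box l) * h (of_box j) else 0).
  rewrite {1}/fps_mul -/D; apply: eq_bigr => p _.
  rewrite big_mkcond; apply: eq_bigr => j _.
  case: eqP => _; last first.
    by rewrite big1// => k _; rewrite big1// => l _; rewrite andbF.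
  rewrite (@fps_mulE D) => [|i]; last exact: of_box_le.
  rewrite mulr_suml; apply: eq_bigr => k _.
  rewrite big_mkcond mulr_suml; apply: eq_bigr => l _.
  by rewrite andbT; case: ifP; rewrite ?mul0r.
under eq_bigr do rewrite exchange_big /=.
rewrite exchange_big /=; apply: eq_bigr => k _.
under eq_bigr do rewrite exchange_big /=.
rewrite exchange_big /=; apply: eq_bigr => l _.
rewrite exchange_big /=; apply: eq_bigr => j _.
case: eqP => [e|ne].
  have klD i : ((of_box k + of_box l)%R i <= D)%N.
    by apply: leq_trans (le_mdeg m i); rewrite -e [leqRHS]midxD leq_addr.
  rewrite (bigD1 (to_box D (of_box k + of_box l))) //= to_boxK// eqxx e eqxx.
  rewrite big1 ?addr0// => p pk; case: eqP => // e'.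
  by rewrite e' of_boxK eqxx in pk.
by rewrite big1// => p _; case: eqP => // <-; case: eqP.
Qed.

Lemma fps_mulA : associative fps_mul.
Proof.
move=> f g h; apply/funext => m; rewrite fps_mul3E fps_mulC fps_mul3E.
under eq_bigr do rewrite exchange_big /=.
rewrite exchange_big /=; apply: eq_bigr => k _.
apply: eq_bigr => l _; apply: eq_bigr => j _.
by rewrite (addrC _ (of_box k)) addrA mulrC mulrA.
Qed.

Lemma fps_one_neq0 : fps_one != 0.
Proof.
apply/eqP => /(congr1 (@^~ 0)); rewrite /fps_one eqxx => /eqP.
by rewrite oner_eq0.
Qed.

HB.instance Definition _ := GRing.Zmodule_isComNzRing.Build (fps K n)
  fps_mulA fps_mulC fps_mul1 fps_mulDl fps_one_neq0.

Definition unit_index (i : 'I_n) : multiindex n := [ffun j => (j == i) : nat].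

Definition fps_deriv (i : 'I_n) f : fps K n :=
  fun m => f (m + unit_index i) *+ (m i).+1.

End FormalPowerSeries.

Section Germs.
Variable C : numClosedFieldType.

Section Analytic.
Variable n : nat.
Implicit Types (f : 'rV[C]_n -> C) (a : fps C n) (x : 'rV[C]_n).

Definition monomial x (k : multiindex n) : C := \prod_(i < n) x 0 i ^+ k i.

(* f is, on a polydisc around 0, the sum of the convergent power series a,
   which is then its Taylor series at 0.  The Cauchy estimate makes the series
   absolutely convergent for `|x| < r (sup norm), so the order of summation is
   immaterial. *)
Definition has_expansion f a : Prop := exists r M : C,
  [/\ 0 < r,
      (forall k, `|a k| * r ^+ mdeg k <= M) &
      forall x, `|x| < r ->
        (fun N => \sum_(k : box n N) a (of_box k) * monomial x (of_box k))
          @ \oo --> f x].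

Definition holomorphic_at0 f : Prop := exists a, has_expansion f a.

End Analytic.

(* Maps and vector fields are given by total functions; only their behaviour
   near 0 matters. *)
Definition holomorphic_map_at0 n p (F : 'rV[C]_n -> 'rV[C]_p) : Prop :=
  forall i, holomorphic_at0 (fun x => F x 0 i).

Definition vector_field_germ n (X : 'rV[C]_n -> 'rV[C]_n) : Prop :=
  holomorphic_map_at0 X /\ X 0 = 0.

Definition holomorphic_coordinate_change n (phi : 'rV[C]_n -> 'rV[C]_n) : Prop :=
  [/\ holomorphic_map_at0 phi, phi 0 = 0 &
      exists psi : 'rV[C]_n -> 'rV[C]_n,
        [/\ holomorphic_map_at0 psi, psi 0 = 0,
            (\forall x \near (0 : 'rV[C]_n), psi (phi x) = x) &
            (\forall y \near (0 : 'rV[C]_n), phi (psi y) = y)]].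

(* Y is the expression of X in the coordinates y = phi x. *)
Definition pushforward n (phi X Y : 'rV[C]_n -> 'rV[C]_n) : Prop :=
  \forall x \near (0 : 'rV[C]_n), 'd phi x (X x) = Y (phi x).

Definition leaves_hyperplanes_invariant n (Y : 'rV[C]_n -> 'rV[C]_n) : Prop :=
  forall i : 'I_n, \forall y \near (0 : 'rV[C]_n), (y : 'rV[C]_n) 0 i = 0 -> Y y 0 i = 0.

(* 'J X 0 is the transpose of the usual Jacobian matrix: it acts on rows. *)
Definition nondegenerate_generic n (X : 'rV[C]_n -> 'rV[C]_n) : Prop :=
  [/\ vector_field_germ X, 'J X 0 \in unitmx, diagonalizable ('J X 0) &
      exists phi Y : 'rV[C]_n -> 'rV[C]_n,
        [/\ holomorphic_coordinate_change phi, vector_field_germ Y,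
            pushforward phi X Y & leaves_hyperplanes_invariant Y]].

(* The eigenvalues lam are listed with multiplicity; L is the real line
   spanned by u, bounding the half-planes 'Im (z / u) > 0 and < 0. *)
Definition condition_star n (X : 'rV[C]_n -> 'rV[C]_n) : Prop :=
  exists lam : 'I_n -> C,
    char_poly ('J X 0) = \prod_(i < n) ('X - (lam i)%:P) /\
    exists u : C, exists j : 'I_n,
      [/\ u != 0, 0 < 'Im (lam j / u) &
          forall i, i != j -> 'Im (lam i / u) < 0].

(* The coefficients of the (n-1)-form df_1 /\ ... /\ df_(n-1) are the maximal
   minors of the matrix of partial derivatives, one for each omitted variable. *)
Definition formal_wedge n (F : 'I_n.-1 -> fps C n) (j : 'I_n) : fps C n :=
  \det (row' j (\matrix_(i < n, k < n.-1) fps_deriv i (F k))).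

Definition wedge n (F : 'rV[C]_n -> 'rV[C]_n.-1) (j : 'I_n) (x : 'rV[C]_n) : C :=
  \det (row' j ('J F x)).

Definition formal_first_integral n (X : 'rV[C]_n -> 'rV[C]_n)
    (F : 'I_n.-1 -> fps C n) : Prop :=
  (exists j, formal_wedge F j <> 0) /\
  exists Xhat : 'I_n -> fps C n,
    (forall i, has_expansion (fun x => X x 0 i) (Xhat i)) /\
    (forall k, \sum_(i < n) Xhat i * fps_deriv i (F k) = 0).

Definition holomorphic_first_integral n (X : 'rV[C]_n -> 'rV[C]_n)
    (F : 'rV[C]_n -> 'rV[C]_n.-1) : Prop :=
  [/\ holomorphic_map_at0 F, F 0 = 0,
      ~ (\forall x \near (0 : 'rV[C]_n), forall j, wedge F j x = 0) &
      forall k : 'I_n.-1, \forall x \near (0 : 'rV[C]_n),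
        'd (fun y => F y 0 k) x (X x) = 0].

End Germs.

(* Main.v *)
From HB Require Import structures.
Require Import Defs.
From mathcomp Require Import all_boot all_order all_algebra perm.
From mathcomp Require Import all_classical all_reals.
From mathcomp Require Import complex topology normedtype landau derive.
From mathcomp Require Import interval_inference zify ring lra.

(** Let S = \sum_i lam_i x_i d/dx_i be the linear part of X in a basis of
    eigenvectors, and let j0 be the index of the eigenvalue that condition star
    separates from the others.  The theorem holds because complete integrability
    removes both obstacles to an analytic linearization of the foliation: the
    resonant terms and the small divisors.

    Formally, there is a change of coordinates Phi tangent to the identity and a
    unit 1 + u such that Phi carries S + N to (1 + u) X, where N contains only
    monomials of the same weight as S.  Condition star implies that a resonant
    monomial of the equation of index j0 is divisible by x_j0; hence u can be
    chosen so that N has no component along j0.  Now pull the formal integrals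
    back by Phi.  They are killed by S + N, and since N preserves weights and
    raises degrees, they are killed by S and by N separately
    (integral_weight).  As n - 1 independent functions have a common kernel of
    rank one among vector fields (wedge_kernel), N is a multiple of S, so N = 0
    (rest_eq0).  The same argument applied to diagonal fields shows that the
    resonances satisfied by the lam_i determine them up to a factor
    (weights_rank1), whence the lam_i are integral multiples of one number
    (integral_weights): the nonzero divisors are bounded below.

    Once N = 0, the equation for Phi and u reads
    (S - lam_i) phi_i - lam_i x_i u = f_i(Phi) + u (lam_i phi_i + f_i(Phi)).
    Its right-hand side contains no derivative of the unknowns, so a ball of a
    weighted l^1 norm is stable under the corresponding operator
    (lin_op_bound), and Phi converges; so does its inverse Psi (inverse_map).
    Condition star gives the eigenvalue of index j0 the sign opposite to the
    others, so suitable monomials x_j0^a x_i^b have weight zero.  Composed with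
    Psi they are n - 1 independent convergent first integrals of X
    (diagonal_integrals).

    The unknowns are computed degree by degree, as fixed points of operators
    that gain one degree (causal_fixE); this gives existence, uniqueness and
    bounds at once, and uniqueness identifies the formal solution with the
    convergent one.  The last part relates series to germs: sums of convergent
    series are differentiable with the expected partial derivatives
    (expansion_taylor1), and vanish near 0 only if all the coefficients do
    (expansion_eq0). *)

Set Implicit Arguments.
Unset Strict Implicit.
Unset Printing Implicit Defensive.

Import Order.TTheory GRing.Theory Num.Theory.
Import numFieldNormedType.Exports.

Local Open Scope classical_set_scope.
Local Open Scope ring_scope.

(** * Formal power series: order, monomials, derivatives *)

Section FpsRing.
Variables (K : comNzRingType) (n : nat).
Implicit Types (f g h : fps K n) (k l m : multiindex n) (c : K).

Lemma mdegD k l : mdeg (k + l) = (mdeg k + mdeg l)%N.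
Proof. by rewrite /mdeg -big_split; apply: eq_bigr => i _; rewrite midxD. Qed.

Lemma mdeg0 : mdeg (0 : multiindex n) = 0%N.
Proof. by rewrite /mdeg big1 // => i _; rewrite ffunE. Qed.

Lemma mdeg_unit (i : 'I_n) : mdeg (unit_index i) = 1%N.
Proof.
rewrite /mdeg (bigD1 i) //= ffunE eqxx big1 // => j ji.
by rewrite ffunE (negPf ji).
Qed.

Lemma mdeg_eq0 k : mdeg k = 0%N -> k = 0.
Proof.
move=> k0; apply/ffunP => i; rewrite ffunE; apply/eqP.
by rewrite -leqn0 -k0 le_mdeg.
Qed.

Lemma midx_addI k : injective (+%R k).
Proof.
move=> l m /ffunP e; apply/ffunP => i; have := e i.
by rewrite !midxD => /addnI.
Qed.

Lemma fpsD f g m : (f + g) m = f m + g m. Proof. by []. Qed.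
Lemma fpsN f m : (- f) m = - f m. Proof. by []. Qed.
Lemma fps0 m : (0 : fps K n) m = 0. Proof. by []. Qed.
Lemma fpsB f g m : (f - g) m = f m - g m. Proof. by []. Qed.
Lemma fps1E m : (1 : fps K n) m = (m == 0)%:R. Proof. by []. Qed.

Lemma fps_sumE I (r : seq I) (P : pred I) (F : I -> fps K n) m :
  (\sum_(i <- r | P i) F i) m = \sum_(i <- r | P i) F i m.
Proof. by apply: (big_morph (fun f : fps K n => f m)). Qed.

Lemma fps_coefM f g m N : (forall i, (m i <= N)%N) ->
  (f * g) m = \sum_(k : box n N) \sum_(l : box n N | of_box k + of_box l == m)
                    f (of_box k) * g (of_box l).
Proof. exact: fps_mulE. Qed.

Lemma fps_coefM0 f g m :
  (forall k l, k + l = m -> f k * g l = 0) -> (f * g) m = 0.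
Proof.
move=> H; rewrite (fps_coefM _ _ (le_mdeg m)).
by rewrite big1 // => k _; rewrite big1 // => l /eqP /H.
Qed.

(** The form in which products are computed: when all other decompositions of
    the index contribute zero, only one product of coefficients survives. *)
Lemma fps_coefM1 f g k0 l0 :
  (forall k l, k + l = k0 + l0 -> k != k0 -> f k * g l = 0) ->
  (f * g) (k0 + l0) = f k0 * g l0.
Proof.
move=> H; set m := k0 + l0; rewrite (fps_coefM _ _ (le_mdeg m)).
have k0m i : (k0 i <= mdeg m)%N.
  by apply: leq_trans (le_mdeg m i); rewrite midxD leq_addr.
have l0m i : (l0 i <= mdeg m)%N.
  by apply: leq_trans (le_mdeg m i); rewrite midxD leq_addl.
rewrite (bigD1 (to_box _ k0)) //= [X in _ + X]big1 ?addr0; last first.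
  move=> k kk0; apply: big1 => l /eqP e; apply: (H _ _ e).
  by apply: contra_neq kk0 => <-; rewrite of_boxK.
rewrite to_boxK // (big_pred1 (to_box _ l0)) ?to_boxK // => l /=.
rewrite (inj_eq (@midx_addI _)) -{1}(to_boxK l0m).
by rewrite (inj_eq (@of_box_inj _ _)).
Qed.

Definition ordge d f := forall m, (mdeg m < d)%N -> f m = 0.

Lemma ordge_le d e f : (e <= d)%N -> ordge d f -> ordge e f.
Proof. by move=> ed df m me; apply: df; exact: leq_trans ed. Qed.
Lemma ordgeD d f g : ordge d f -> ordge d g -> ordge d (f + g).
Proof. by move=> df dg m md; rewrite fpsD df // dg // addr0. Qed.
Lemma ordgeN d f : ordge d f -> ordge d (- f).
Proof. by move=> df m md; rewrite fpsN df // oppr0. Qed.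
Lemma ordgeB d f g : ordge d f -> ordge d g -> ordge d (f - g).
Proof. by move=> df dg; apply: ordgeD => //; exact: ordgeN. Qed.
Lemma ordge_sum d I (r : seq I) (P : pred I) (F : I -> fps K n) :
  (forall i, P i -> ordge d (F i)) -> ordge d (\sum_(i <- r | P i) F i).
Proof.
by move=> H; apply: (big_ind (ordge d)) => //; exact: ordgeD.
Qed.
Lemma ordgeM d e f g : ordge d f -> ordge e g -> ordge (d + e) (f * g).
Proof.
move=> df eg m md; apply: fps_coefM0 => k l kl.
have [kd|dk] := ltnP (mdeg k) d; first by rewrite df // mul0r.
rewrite eg ?mulr0 //; move: md; rewrite -kl mdegD; lia.
Qed.
Lemma ordgeMl e f g : ordge e g -> ordge e (f * g).
Proof. by move=> eg; apply: (@ordgeM 0) => // m. Qed.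
Lemma ordgeX d f (k : nat) : ordge d f -> ordge (d * k) (f ^+ k).
Proof.
move=> df; elim: k => [|k IH]; first by rewrite muln0 => m.
by rewrite exprS mulnS; exact: ordgeM.
Qed.
Lemma ordge_prod (d : 'I_n -> nat) (F : 'I_n -> fps K n) :
  (forall i, ordge (d i) (F i)) -> ordge (\sum_i d i) (\prod_i F i).
Proof.
move=> H; apply: (big_rec2 (fun e p => ordge e p)) => [//|i e p _ ep].
exact: ordgeM.
Qed.
(** Differences of products: each factor being replaced loses only the order
    of the factor that multiplies the difference.  This is what makes the
    operators below gain one degree. *)
Lemma ordge_subM d f f' g g' p q :
  ordge p f -> ordge q g' ->
  ordge (d - q) (f - f') -> ordge (d - p) (g - g') ->
  ordge d (f * g - f' * g').
Proof.
move=> pf qg ff gg.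
have -> : f * g - f' * g' = f * (g - g') + (f - f') * g' by ring.
apply: ordgeD.
  by apply: (@ordge_le (p + (d - p))); [lia | exact: ordgeM].
by apply: (@ordge_le ((d - q) + q)); [lia | exact: ordgeM].
Qed.
Lemma ordge_eq f g : (forall d, ordge d (f - g)) -> f = g.
Proof.
move=> H; apply/funext => m; apply/eqP; rewrite -subr_eq0 -fpsB.
by rewrite (H (mdeg m).+1).
Qed.
Lemma ordge_eq0 f : (forall d, ordge d f) -> f = 0.
Proof. by move=> H; apply: ordge_eq => d; rewrite subr0. Qed.

Definition fmon c k : fps K n := fun m => if m == k then c else 0.

Lemma fmon_mul c k f m : (fmon c k * f) (k + m) = c * f m.
Proof.
by rewrite fps_coefM1 => [|k' l _ /negPf kk]; rewrite /fmon ?eqxx // kk mul0r.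
Qed.
Lemma fmon_mul0 c k f m : ~~ [forall i, k i <= m i]%N -> (fmon c k * f) m = 0.
Proof.
move=> /negP H; apply: fps_coefM0 => k' l kl; rewrite /fmon.
case: eqP => [e|]; last by rewrite mul0r.
by case: H; apply/forallP => i; rewrite -kl e midxD leq_addr.
Qed.
Lemma midx_subK k m : [forall i, k i <= m i]%N ->
  m = k + [ffun i => m i - k i]%N.
Proof.
by move=> /forallP H; apply/ffunP => i; rewrite midxD ffunE subnKC.
Qed.
Lemma fmonM c d k l : fmon c k * fmon d l = fmon (c * d) (k + l).
Proof.
apply/funext => m; case: (boolP [forall i, k i <= m i]%N) => [/midx_subK ->|H].
  rewrite fmon_mul /fmon (inj_eq (@midx_addI k)); by case: eqP; rewrite ?mulr0.
rewrite fmon_mul0 // /fmon; case: eqP => // e; case/negP: H; rewrite e.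
by apply/forallP => i; rewrite midxD leq_addr.
Qed.
Lemma fmonD c d k : fmon (c + d) k = fmon c k + fmon d k.
Proof. by apply/funext => m; rewrite fpsD /fmon; case: eqP; rewrite ?addr0. Qed.
Lemma fmon0 k : fmon 0 k = 0.
Proof. by apply/funext => m; rewrite /fmon; case: eqP. Qed.
Lemma fmonN c k : fmon (- c) k = - fmon c k.
Proof. by apply/funext => m; rewrite fpsN /fmon; case: eqP; rewrite ?oppr0. Qed.
Lemma fmon10 : fmon 1 0 = 1.
Proof. by apply/funext => m; rewrite fps1E /fmon; case: eqP. Qed.
Lemma fmonC_mul c f m : (fmon c 0 * f) m = c * f m.
Proof. by rewrite -{1}[m]add0r fmon_mul. Qed.
Lemma ordge_fmon c k : ordge (mdeg k) (fmon c k).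
Proof. by move=> m mk; rewrite /fmon; case: eqP mk => // ->; rewrite ltnn. Qed.
Definition fvar (i : 'I_n) := fmon 1 (unit_index i).
Lemma ordge_fvar i : ordge 1 (fvar i).
Proof. by rewrite -(mdeg_unit i); exact: ordge_fmon. Qed.
Lemma fmon_prod k : \prod_i fvar i ^+ k i = fmon 1 k.
Proof.
have fX i e : fvar i ^+ e = fmon 1 [ffun j => if j == i then e else 0%N].
  elim: e => [|e IH].
    rewrite expr0 -fmon10; congr fmon; apply/ffunP => j; rewrite !ffunE.
    by case: eqP.
  rewrite exprS IH fmonM mulr1; congr fmon; apply/ffunP => j.
  by rewrite midxD !ffunE; case: eqP.
under eq_bigr do rewrite fX.
transitivity (fmon 1 (\sum_(i < n) [ffun j => if j == i then k i else 0%N] : multiindex n)).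
  apply: (big_rec2 (fun a b => a = fmon 1 (b : multiindex n))); first by rewrite fmon10.
  by move=> i a b _ ->; rewrite fmonM mulr1.
congr fmon; apply/ffunP => j; rewrite sum_ffunE (bigD1 j) //= ffunE eqxx.
rewrite big1 ?addr0 // => i ij; by rewrite ffunE eq_sym (negPf ij).
Qed.

Definition trunc D f := \sum_(k : box n D) fmon (f (of_box k)) (of_box k).
Lemma truncP D f : ordge D.+1 (f - trunc D f).
Proof.
move=> m mD; rewrite fpsB /trunc fps_sumE.
have mi i : (m i <= D)%N by apply: leq_trans (le_mdeg m i) _; lia.
rewrite (bigD1 (to_box D m)) //= to_boxK // {1}/fmon eqxx big1 ?addr0 ?subrr //.
move=> k km; rewrite /fmon; case: eqP => // e; by rewrite e of_boxK eqxx in km.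
Qed.

Lemma fps_dense (P : fps K n -> Prop) :
  (forall c k, P (fmon c k)) -> (forall f g, P f -> P g -> P (f + g)) ->
  (forall f, (forall d, exists g, P g /\ ordge d (f - g)) -> P f) ->
  forall f, P f.
Proof.
move=> Pm PD Pl f; apply: Pl => d; exists (trunc d f); split; last first.
  by apply: (@ordge_le d.+1) => //; exact: truncP.
apply: (big_ind P) => //.
by rewrite -(fmon0 0).
Qed.

(** Polynomials are dense for the order topology, so two additive maps that
    are continuous for it, with a loss of at most one degree (as for a partial
    derivative), agree as soon as they agree on monomials. *)
Lemma fps_lin_eq (A B : fps K n -> fps K n) :
  (forall f g, A (f + g) = A f + A g) -> (forall f g, B (f + g) = B f + B g) ->
  (forall d f, ordge d.+1 f -> ordge d (A f)) ->
  (forall d f, ordge d.+1 f -> ordge d (B f)) ->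
  (forall c k, A (fmon c k) = B (fmon c k)) -> forall f, A f = B f.
Proof.
move=> AD BD Ao Bo AB; apply: fps_dense => // [f g|f H].
  by rewrite AD BD => -> ->.
apply: ordge_eq => d; have [g [eg fg]] := H d.+1.
rewrite -{1 2}(subrK g f) AD BD eg opprD addrACA subrr addr0.
by apply: ordgeB; [exact: Ao | exact: Bo].
Qed.

Lemma fderivD i f g : fps_deriv i (f + g) = fps_deriv i f + fps_deriv i g.
Proof. by apply/funext => m; rewrite /fps_deriv !fpsD mulrnDl. Qed.
Lemma fderiv0 i : fps_deriv i (0 : fps K n) = 0.
Proof. by apply/funext => m; rewrite /fps_deriv fps0 mul0rn. Qed.
Lemma ordge_deriv i d f : ordge d f -> ordge d.-1 (fps_deriv i f).
Proof.
move=> df m md; rewrite /fps_deriv df ?mul0rn // mdegD mdeg_unit; lia.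
Qed.
Lemma fderivX i c k l : fps_deriv i (fmon c (k + unit_index i)) =
   fmon (c *+ (k i).+1) k /\ (l i = 0%N -> fps_deriv i (fmon c l) = 0).
Proof.
split=> [|li]; apply/funext => m; rewrite /fps_deriv /fmon.
  rewrite !(addrC _ (unit_index i)) (inj_eq (@midx_addI _)).
  by case: eqP => [->//|]; rewrite mul0rn.
case: eqP => [e|]; last by rewrite mul0rn.
by move: li; rewrite -e midxD ffunE eqxx addn1.
Qed.
(** Multi-indices lack subtraction; this dichotomy replaces it. *)
Lemma midx_unitP k i : k i = 0%N \/ exists l, k = l + unit_index i.
Proof.
case: (posnP (k i)) => [|ki]; [by left | right].
exists [ffun j => k j - unit_index i j]%N; apply/ffunP => j.
rewrite midxD ffunE subnK // ffunE; case: eqP => // -> //.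
Qed.
Lemma fderivM i f g :
  fps_deriv i (f * g) = fps_deriv i f * g + f * fps_deriv i g.
Proof.
move: f; apply: fps_lin_eq.
- by move=> f h; rewrite mulrDl fderivD.
- by move=> f h; rewrite fderivD !mulrDl addrACA.
- move=> d f df; apply: (@ordge_deriv i d.+1); rewrite mulrC; exact: ordgeMl.
- move=> d f df; apply: ordgeD; rewrite mulrC; apply: ordgeMl.
    exact: ordge_deriv df.
  by apply: (ordge_le _ df).
move=> c k; move: g; apply: fps_lin_eq.
- by move=> f h; rewrite mulrDr fderivD.
- by move=> f h; rewrite fderivD !mulrDr addrACA.
- move=> d f df; apply: (@ordge_deriv i d.+1); exact: ordgeMl.
- move=> d f df; apply: ordgeD; apply: ordgeMl; last exact: ordge_deriv df.
  by apply: (ordge_le _ df).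
move=> d l; rewrite fmonM.
have dX (c' : K) k' := (fderivX i c' k' k').1.
have d0 (c' : K) k' := (fderivX i c' k' k').2.
case: (midx_unitP k i) => [k0|[k' ->]]; case: (midx_unitP l i) => [l0|[l' ->]].
- by rewrite !d0 ?midxD ?k0 ?l0 // mul0r mulr0 addr0.
- by rewrite addrA !dX (d0 c) // mul0r add0r fmonM midxD k0 mulrnAr.
- rewrite (addrAC k') !dX (d0 d) // mulr0 addr0 fmonM midxD l0 addn0 mulrnAl //.
rewrite !dX !fmonM.
have -> : k' + unit_index i + (l' + unit_index i) =
   (k' + l' + unit_index i) + unit_index i by rewrite addrACA !addrA.
rewrite dX (addrA k') (addrAC k') -fmonD; congr fmon.
rewrite mulrnAl mulrnAr -mulrnDr !midxD ffunE eqxx; congr (_ *+ _); lia.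
Qed.
Lemma fderiv_fmon0 i c : fps_deriv i (fmon c 0) = 0.
Proof. by apply: (fderivX i c 0 0).2; rewrite ffunE. Qed.
Lemma fderiv_var i j : fps_deriv i (fvar j) = (i == j)%:R.
Proof.
case: eqP => [->|ij]; last by apply: (fderivX i 1 0 _).2; rewrite ffunE; case: eqP.
rewrite /fvar -[unit_index j]add0r (fderivX j 1 0 0).1 ffunE mulr1n.
exact: fmon10.
Qed.
End FpsRing.

(** * Composition of formal power series *)

Section Composition.
Variables (K : comNzRingType) (n : nat).
Implicit Types (f g h : fps K n) (k l m : multiindex n) (c : K).
Implicit Types (Phi Psi : 'I_n -> fps K n).

Definition fmpow Phi k : fps K n := \prod_i Phi i ^+ k i.
(** If the entries of Phi have no constant term, Phi^k has order at least the
    degree of k, so the indices left out of the sum would contribute zero. *)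
Definition fcomp f Phi : fps K n := fun m =>
  \sum_(k : box n (mdeg m)) f (of_box k) * fmpow Phi (of_box k) m.
Definition vanish0 Phi := forall i, ordge 1 (Phi i).

Lemma fmpowD Phi k l : fmpow Phi (k + l) = fmpow Phi k * fmpow Phi l.
Proof.
by rewrite /fmpow -big_split; apply: eq_bigr => i _; rewrite midxD exprD.
Qed.
Lemma fmpow0 Phi : fmpow Phi 0 = 1.
Proof. by rewrite /fmpow big1 // => i _; rewrite ffunE expr0. Qed.
Lemma fmpow_unit Phi i : fmpow Phi (unit_index i) = Phi i.
Proof.
rewrite /fmpow (bigD1 i) //= ffunE eqxx expr1 big1 ?mulr1 // => j ji.
by rewrite ffunE (negPf ji) expr0.
Qed.
Lemma fmpow_var k : fmpow (@fvar K n) k = fmon 1 k.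
Proof. exact: fmon_prod. Qed.
Lemma ordge_fmpow Phi k : vanish0 Phi -> ordge (mdeg k) (fmpow Phi k).
Proof.
move=> P1; apply: ordge_prod => i.
by rewrite -[X in ordge X _]mul1n; exact: ordgeX.
Qed.

Lemma fcompE Phi f D m : vanish0 Phi -> (mdeg m <= D)%N ->
  fcomp f Phi m = \sum_(k : box n D) f (of_box k) * fmpow Phi (of_box k) m.
Proof.
move=> P1 mD; rewrite /fcomp.
rewrite (box_widen (G := fun k => f k * fmpow Phi k m) mD) // => k i ki.
rewrite (ordge_fmpow P1) ?mulr0 //; exact: leq_trans (le_mdeg k i).
Qed.

Lemma fcompD Phi f g : fcomp (f + g) Phi = fcomp f Phi + fcomp g Phi.
Proof.
apply/funext => m; rewrite fpsD /fcomp -big_split; apply: eq_bigr => k _.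
by rewrite fpsD mulrDl.
Qed.

Lemma fcomp_ord Phi d f : vanish0 Phi -> ordge d f -> ordge d (fcomp f Phi).
Proof.
move=> P1 df m md; rewrite /fcomp big1 // => k _.
have [kd|dk] := ltnP (mdeg (of_box k)) d; first by rewrite df // mul0r.
rewrite (ordge_fmpow P1) ?mulr0 //; exact: leq_trans dk.
Qed.

Lemma fcomp_fmon Phi c k : vanish0 Phi ->
  fcomp (fmon c k) Phi = fmon c 0 * fmpow Phi k.
Proof.
move=> P1; apply/funext => m; rewrite fmonC_mul.
rewrite (@fcompE _ _ (mdeg m + mdeg k)) ?leq_addr //.
have kD i : (k i <= mdeg m + mdeg k)%N by rewrite (leq_trans (le_mdeg k i)) ?leq_addl.
rewrite (bigD1 (to_box _ k)) //= to_boxK // {1}/fmon eqxx big1 ?addr0 //.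
move=> l lk; rewrite /fmon; case: eqP => [e|]; last by rewrite mul0r.
by case/eqP: lk; apply: of_box_inj; rewrite to_boxK.
Qed.

Lemma fcomp_const Phi c : vanish0 Phi -> fcomp (fmon c 0) Phi = fmon c 0.
Proof. by move=> P1; rewrite fcomp_fmon // fmpow0 mulr1. Qed.
Lemma fcomp1 Phi : vanish0 Phi -> fcomp 1 Phi = 1.
Proof. by move=> P1; rewrite -[in LHS]fmon10 fcomp_const // fmon10. Qed.
Lemma fcomp0 Phi : fcomp 0 Phi = 0.
Proof. by apply/funext => m; rewrite /fcomp big1 // => k _; rewrite fps0 mul0r. Qed.
Lemma fcomp_var Phi i : vanish0 Phi -> fcomp (fvar K i) Phi = Phi i.
Proof. by move=> P1; rewrite fcomp_fmon // fmpow_unit fmon10 mul1r. Qed.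

Lemma fcompM Phi f g : vanish0 Phi ->
  fcomp (f * g) Phi = fcomp f Phi * fcomp g Phi.
Proof.
move=> P1; move: f; apply: fps_lin_eq.
- by move=> f h; rewrite mulrDl fcompD.
- by move=> f h; rewrite fcompD mulrDl.
- move=> d f df; apply: fcomp_ord => //; rewrite mulrC; apply: ordgeMl.
  exact: (@ordge_le _ _ d.+1).
- move=> d f df; rewrite mulrC; apply: ordgeMl; apply: fcomp_ord => //.
  exact: (@ordge_le _ _ d.+1).
move=> c k; move: g; apply: fps_lin_eq.
- by move=> f h; rewrite mulrDr fcompD.
- by move=> f h; rewrite fcompD mulrDr.
- move=> d f df; apply: fcomp_ord => //; apply: ordgeMl.
  exact: (@ordge_le _ _ d.+1).
- move=> d f df; apply: ordgeMl; apply: fcomp_ord => //.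
  exact: (@ordge_le _ _ d.+1).
move=> d l; rewrite fmonM !fcomp_fmon // fmpowD mulrACA fmonM addr0 //.
Qed.

(** The same map, carrying the hypothesis under which it is a ring morphism, so
    that generic lemmas on morphisms and determinants apply to it. *)
Definition fcompr Phi (P1 : vanish0 Phi) f := fcomp f Phi.
Section Morphism.
Variables (Phi : 'I_n -> fps K n) (P1 : vanish0 Phi).
Lemma fcompr_zmod : zmod_morphism (fcompr P1).
Proof.
by move=> f g; apply/eqP; rewrite eq_sym subr_eq /fcompr -fcompD subrK.
Qed.
HB.instance Definition _ := GRing.isZmodMorphism.Build _ _ (fcompr P1) fcompr_zmod.
Lemma fcompr_mon : monoid_morphism (fcompr P1).
Proof. by split; [exact: fcomp1 | move=> f g; exact: fcompM]. Qed.
HB.instance Definition _ := GRing.isMonoidMorphism.Build _ _ (fcompr P1) fcompr_mon.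
End Morphism.

Lemma fcomprE Phi (P1 : vanish0 Phi) f : fcomp f Phi = fcompr P1 f.
Proof. by []. Qed.
Lemma fcomp_sum Phi I (r : seq I) (P : pred I) (F : I -> fps K n) :
  fcomp (\sum_(i <- r | P i) F i) Phi = \sum_(i <- r | P i) fcomp (F i) Phi.
Proof.
by apply: (big_morph (fun f => fcomp f Phi)); [exact: fcompD | exact: fcomp0].
Qed.
Lemma fcomp_fmpow Phi Psi k : vanish0 Psi ->
  fcomp (fmpow Phi k) Psi = fmpow (fun i => fcomp (Phi i) Psi) k.
Proof.
move=> P1; rewrite fcomprE rmorph_prod; apply: eq_bigr => i _.
by rewrite rmorphXn.
Qed.

Lemma vanish0_comp Phi Psi : vanish0 Phi -> vanish0 Psi -> vanish0 (fun i => fcomp (Phi i) Psi).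
Proof. by move=> P1 P2 i; apply: fcomp_ord. Qed.
Lemma vanish0_var : vanish0 (@fvar K n).
Proof. by move=> i; exact: ordge_fvar. Qed.

Lemma fcompA Phi Psi f : vanish0 Phi -> vanish0 Psi ->
  fcomp (fcomp f Phi) Psi = fcomp f (fun i => fcomp (Phi i) Psi).
Proof.
move=> P1 P2; have P3 := vanish0_comp P1 P2; move: f; apply: fps_lin_eq.
- by move=> f g; rewrite !fcompD.
- by move=> f g; rewrite !fcompD.
- move=> d f df; do 2 apply: fcomp_ord => //; exact: (@ordge_le _ _ d.+1).
- move=> d f df; apply: fcomp_ord => //; exact: (@ordge_le _ _ d.+1).
by move=> c k; rewrite !fcomp_fmon // fcompM // fcomp_const // fcomp_fmpow.
Qed.

Lemma fcomp_id f : fcomp f (@fvar K n) = f.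
Proof.
move: f; apply: fps_lin_eq => //.
- by move=> f g; rewrite fcompD.
- move=> d f df; apply: fcomp_ord; [exact: vanish0_var | exact: (@ordge_le _ _ d.+1)].
- by move=> d f df; apply: (@ordge_le _ _ d.+1).
by move=> c k; rewrite fcomp_fmon ?fmpow_var ?fmonM ?mulr1 ?add0r //; exact: vanish0_var.
Qed.

Lemma fderiv_sum i I (r : seq I) (P : pred I) (F : I -> fps K n) :
  fps_deriv i (\sum_(j <- r | P j) F j) = \sum_(j <- r | P j) fps_deriv i (F j).
Proof.
by apply: (big_morph (fps_deriv i)); [exact: fderivD | exact: fderiv0].
Qed.

(** Both sides are derivations along the morphism f |-> f o Phi, so it suffices
    to compare them on constants and on variables; density does the rest. *)
Theorem fcomp_chain Phi f i : vanish0 Phi ->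
  fps_deriv i (fcomp f Phi) =
  \sum_l fcomp (fps_deriv l f) Phi * fps_deriv i (Phi l).
Proof.
move=> P1; move: f; apply: fps_lin_eq.
- by move=> f g; rewrite fcompD fderivD.
- move=> f g; rewrite -big_split; apply: eq_bigr => l _.
  by rewrite fderivD fcompD mulrDl.
- by move=> d f df; apply: (@ordge_deriv _ _ i d.+1); apply: fcomp_ord.
- move=> d f df; apply: ordge_sum => l _; rewrite mulrC; apply: ordgeMl.
  by apply: fcomp_ord => //; apply: ordge_deriv df.
pose P f := fps_deriv i (fcomp f Phi) =
  \sum_l fcomp (fps_deriv l f) Phi * fps_deriv i (Phi l).
have P0 c : P (fmon c 0).
  rewrite /P fcomp_const // fderiv_fmon0 big1 // => l _.
  by rewrite fderiv_fmon0 fcomp0 mul0r.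
have PM f g : P f -> P g -> P (f * g).
  rewrite /P fcompM // fderivM => -> ->; rewrite mulr_suml mulr_sumr -big_split.
  by apply: eq_bigr => l _; rewrite fderivM fcompD !fcompM //=; ring.
have PX j : P (fvar K j).
  rewrite /P fcomp_var // (bigD1 j) //= fderiv_var eqxx fcomp1 // mul1r.
  rewrite big1 ?addr0 // => l lj.
  by rewrite fderiv_var (negPf lj) fcomp0 mul0r.
move=> c k; suff : P (fmon c k) by [].
have -> : fmon c k = fmon c 0 * fmon 1 k by rewrite fmonM mulr1 add0r.
apply: (PM) => //; rewrite -fmon_prod.
have P1' : P 1 by rewrite -(fmon10 K n).
apply: (big_ind P P1' PM) => j _; elim: (k j) => [//|e IH].
by rewrite exprS; exact: PM.
Qed.

Lemma fmpow_sub Phi Psi d k : (0 < d)%N -> vanish0 Phi -> vanish0 Psi ->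
  (forall i, ordge d (Phi i - Psi i)) ->
  ordge (d + mdeg k).-1 (fmpow Phi k - fmpow Psi k).
Proof.
move=> d0 P1 P2 PP.
pose Rel e (a b : fps K n) := [/\ ordge e a, ordge e b & ordge (d + e).-1 (a - b)].
have RM e1 e2 a1 b1 a2 b2 : Rel e1 a1 b1 -> Rel e2 a2 b2 ->
    Rel (e1 + e2)%N (a1 * a2) (b1 * b2).
  move=> [l1 p1 q1] [l2 p2 q2]; split; [exact: ordgeM | exact: ordgeM |].
  apply: (@ordge_subM _ _ _ _ _ _ _ e1 e2) => //.
    by apply: (ordge_le _ q1); lia.
  by apply: (ordge_le _ q2); lia.
have R1 : Rel 0%N 1 1 by split=> //; rewrite subrr.
suff [] : Rel (mdeg k) (fmpow Phi k) (fmpow Psi k) by [].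
apply: (big_rec3 (fun e a b => Rel e a b)) => // i e a b _ H.
apply: (RM) => //; elim: (k i) => [//|j IH].
by rewrite !exprS -add1n; apply: (RM) => //; split=> //; rewrite addn1.
Qed.

(** A series of order e vanishes at 0 together with its first e - 1
    derivatives, hence a perturbation of order d of its argument is damped to
    order d + e - 1. *)
Lemma fcomp_sub Phi Psi d e f : (0 < d)%N -> vanish0 Phi -> vanish0 Psi ->
  (forall i, ordge d (Phi i - Psi i)) -> ordge e f ->
  ordge (d + e).-1 (fcomp f Phi - fcomp f Psi).
Proof.
move=> d0 P1 P2 PP fe m md; rewrite fpsB /fcomp -sumrB big1 // => k _.
have [ke|ek] := ltnP (mdeg (of_box k)) e; first by rewrite fe // !mul0r subrr.
rewrite -mulrBr -fpsB (fmpow_sub _ _ _ PP) ?mulr0 //; lia.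
Qed.

(** A map tangent to the identity does not change the leading term. *)
Lemma fcomp_near_id_inj Phi f : vanish0 Phi ->
  (forall i, ordge 2 (Phi i - fvar K i)) -> fcomp f Phi = 0 -> f = 0.
Proof.
move=> P1 P2 f0; apply: ordge_eq0; elim=> [//|d IH].
have := fcomp_sub (isT : 0 < 2)%N P1 vanish0_var P2 IH.
by rewrite f0 fcomp_id add0r add2n => /ordgeN; rewrite opprK.
Qed.
End Composition.

(** * Maximal minors over a domain *)

Section Minors.
Variable D : comNzRingType.
Hypothesis Ddom : forall a b : D, a * b = 0 -> a = 0 \/ b = 0.

Lemma dom_cancel (c a b : D) : c <> 0 -> c * a = c * b -> a = b.
Proof.
move=> c0 /eqP; rewrite -subr_eq0 -mulrBr => /eqP /Ddom[//|/eqP].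
by rewrite subr_eq0 => /eqP.
Qed.

Lemma minor_kernel0 p (A : 'M[D]_(p.+1, p)) j (w : 'I_p.+1 -> D) :
  \det (row' j A) <> 0 -> w j = 0 ->
  (forall k, \sum_i w i * A i k = 0) -> forall i, w i = 0.
Proof.
move=> dA wj wA.
pose w' := \row_i w (lift j i).
have w'A : w' *m row' j A = 0.
  apply/rowP => k; rewrite !mxE -[RHS](wA k) (bigD1_ord j) //= wj mul0r add0r.
  by apply: eq_bigr => i _; rewrite !mxE.
have w0 : \det (row' j A) *: w' = 0.
  by rewrite -mul_mx_scalar -mul_mx_adj mulmxA w'A mul0mx.
move=> i; case: (unliftP j i) => [i' ->|->//].
by have /rowP/(_ i') := w0; rewrite !mxE => /Ddom[].
Qed.

(** A matrix with a nonzero maximal minor has a left kernel of rank one, so two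
    kernel vectors are proportional; over a domain this is said without
    fractions. *)
Lemma minor_kernel p (A : 'M[D]_(p.+1, p)) j (u v : 'I_p.+1 -> D) :
  \det (row' j A) <> 0 ->
  (forall k, \sum_i u i * A i k = 0) -> (forall k, \sum_i v i * A i k = 0) ->
  forall a b, u a * v b = u b * v a.
Proof.
move=> dA uA vA.
have e a : v j * u a = u j * v a.
  apply/eqP; rewrite -subr_eq0; apply/eqP; move: a.
  apply: (minor_kernel0 dA) => [|k]; first by rewrite mulrC subrr.
  under eq_bigr do rewrite mulrBl -!mulrA.
  by rewrite sumrB -!mulr_sumr uA vA !mulr0 subrr.
have [v0|/eqP vj] := eqVneq (v j) 0.
  have v0' := minor_kernel0 dA v0 vA.
  by move=> a b; rewrite !v0' !mulr0.
move=> a b; apply: (dom_cancel vj).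
by rewrite !mulrA !e mulrAC.
Qed.

(** Append to A a column that is a basis vector and whose cofactor is the given
    nonzero minor.  The enlarged square matrix has nonzero determinant, hence
    so has its product with B, and expanding the latter along the new column
    exhibits a nonzero maximal minor of B *m A. *)
Lemma minors_mulmx p (A : 'M[D]_(p.+1, p)) (B : 'M[D]_p.+1) :
  \det B <> 0 -> (exists j, \det (row' j A) <> 0) ->
  exists j, \det (row' j (B *m A)) <> 0.
Proof.
move=> dB [j dA].
pose A' := \matrix_(i < p.+1, k < p.+1)
  if unlift ord0 k is Some k' then A i k' else (i == j)%:R.
have cA : col' ord0 A' = A.
  by apply/matrixP => i k; rewrite !mxE liftK.
have dA' : \det A' <> 0.
  rewrite (expand_det_col _ ord0) (bigD1 j) //= big1 => [|i ij]; last first.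
    by rewrite !mxE unlift_none (negPf ij) mul0r.
  rewrite !mxE unlift_none eqxx mul1r addr0 /cofactor cA.
  by move=> h; apply: dA; rewrite -[LHS](signrMK (j + (ord0 : 'I_p.+1))%N) h mulr0.
apply: contrapT => /forallNP H.
have /Ddom[//|//] : \det B * \det A' = 0.
rewrite -det_mulmx (expand_det_col _ ord0) big1 // => i _.
have -> : cofactor (B *m A') i ord0 = 0; last by rewrite mulr0.
rewrite /cofactor.
have -> : col' ord0 (B *m A') = B *m A.
  by rewrite -cA; apply/matrixP => a b; rewrite !mxE; apply: eq_bigr => l _; rewrite !mxE.
by have /contrapT -> := H i; rewrite mulr0.
Qed.
End Minors.

(** * Formal power series form a domain *)

Section FpsDomain.
Variables (K : idomainType) (n : nat).
Implicit Types (f g h : fps K n) (k l m : multiindex n).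

(** The lexicographically least index of the support: coordinates are minimized
    one after the other. *)
Lemma fps_lexmin f : f <> 0 -> exists k0, f k0 <> 0 /\
  forall k, f k <> 0 -> k <> k0 ->
  exists i : 'I_n, (k0 i < k i)%N /\ forall j : 'I_n, (j < i)%N -> k j = k0 j.
Proof.
move=> f0.
have [k0 fk0] : exists k, f k <> 0.
  by apply: contrapT => /forallNP H; apply: f0; apply/funext => k; apply: contrapT; exact: H.
have step i : (i <= n)%N -> exists k0, f k0 <> 0 /\ forall k, f k <> 0 ->
    (forall j : 'I_n, (j < i)%N -> k j = k0 j) \/
    exists i' : 'I_n, [/\ (i' < i)%N, (k0 i' < k i')%N &
       forall j : 'I_n, (j < i')%N -> k j = k0 j]; last first.
  have [k1 [fk1 H]] := step n (leqnn n).
  exists k1; split=> // k fk kk1; case: (H k fk) => [e|[i [_ ? ?]]]; last by exists i.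
  by case: kk1; apply/ffunP => i; exact: e.
elim: i => [_|i IH ltin].
  by exists k0; split=> // k _; left.
have [k1 [fk1 H]] := IH (ltnW ltin); pose io := Ordinal ltin.
pose P a := `[< exists k, [/\ f k <> 0, forall j : 'I_n, (j < i)%N -> k j = k1 j & k io = a] >].
have exP : exists a, P a by exists (k1 io); apply/asboolP; exists k1.
case: (ex_minnP exP) => a /asboolP[k2 [fk2 e2 ea]] amin.
exists k2; split=> // k fk; case: (H k fk) => [e|[i' [i'i lt e]]]; last first.
  right; exists i'; split; first exact: ltnW.
    by rewrite e2.
  by move=> j ji'; rewrite e2 ?e //; exact: ltn_trans i'i.
have ak : (a <= k io)%N by apply: amin; apply/asboolP; exists k.
have ek (j : 'I_n) : (j < i)%N -> k j = k2 j by move=> ji; rewrite e ?e2.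
move: ak; rewrite leq_eqVlt => /orP[/eqP ak|ak]; last first.
  by right; exists io; split=> //=; rewrite ea.
left=> j; rewrite ltnS leq_eqVlt => /orP[/eqP ji|]; last exact: ek.
have -> : j = io by exact: val_inj.
by rewrite -ak ea.
Qed.

(** The coefficient of f * g at the sum of the two lexicographically least
    indices is the product of the corresponding coefficients. *)
Lemma fps_dom f g : f * g = 0 -> f = 0 \/ g = 0.
Proof.
move=> fg; have [->|/eqP f0] := eqVneq f 0; [by left|right].
apply: contrapT => g0.
have [k0 [fk0 Hk]] := fps_lexmin f0; have [l0 [gl0 Hl]] := fps_lexmin g0.
have : (f * g) (k0 + l0) = f k0 * g l0.
  apply: fps_coefM1 => k l kl /eqP kk0.
  have [->|/eqP fk] := eqVneq (f k) 0; first by rewrite mul0r.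
  have [->|/eqP gl] := eqVneq (g l) 0; first by rewrite mulr0.
  have e i : (k i + l i = k0 i + l0 i)%N by have /ffunP/(_ i) := kl; rewrite !midxD.
  have [i [lt eqi]] := Hk k fk kk0.
  have ll0 : l <> l0 by move=> ll; have := e i; rewrite ll; lia.
  have [i' [lt' eqi']] := Hl l gl ll0.
  case: (ltngtP i i') => ii.
  - by have := e i; have := eqi' i ii; lia.
  - by have := e i'; have := eqi i' ii; lia.
  - by have := e i; have ei : i = i' by [exact: val_inj]; rewrite -ei in lt'; lia.
rewrite fg fps0 => /esym/eqP; rewrite mulf_eq0 => /orP[] /eqP //.
Qed.

Definition const_coef f := f 0.
Lemma const_coef_zmod : zmod_morphism const_coef. Proof. by []. Qed.
HB.instance Definition _ := GRing.isZmodMorphism.Build _ _ const_coef const_coef_zmod.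
Lemma const_coef_mon : monoid_morphism const_coef.
Proof.
split; first by rewrite /const_coef fps1E eqxx.
move=> f g; rewrite /const_coef -{1}[0 : multiindex n]addr0 fps_coefM1 // => k l.
move=> kl /eqP k0; case: k0; apply: mdeg_eq0; have := congr1 (@mdeg n) kl.
by rewrite !mdegD mdeg0; lia.
Qed.
HB.instance Definition _ := GRing.isMonoidMorphism.Build _ _ const_coef const_coef_mon.

Lemma det_const_coef p (A : 'M[fps K n]_p) : (\det A) 0 = \det (\matrix_(i, j) A i j 0).
Proof.
rewrite -[LHS]/(const_coef _) -det_map_mx; congr (\det _).
by apply/matrixP => i j; rewrite !mxE.
Qed.
End FpsDomain.

(** * Wedge products of differentials *)

Section Wedge.
Variables (K : numClosedFieldType) (p : nat).
Local Notation n := p.+1.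
Implicit Types (F : 'I_n.-1 -> fps K n) (Phi : 'I_n -> fps K n).

Definition fjac m (F : 'I_m -> fps K n) := \matrix_(i < n, k < m) fps_deriv i (F k).

Lemma fjac_comp m (F : 'I_m -> fps K n) Phi : vanish0 Phi ->
  fjac (fun k => fcomp (F k) Phi) =
  fjac Phi *m \matrix_(i, k) fcomp (fps_deriv i (F k)) Phi.
Proof.
move=> P1; apply/matrixP => i k; rewrite !mxE fcomp_chain //.
by apply: eq_bigr => l _; rewrite !mxE mulrC.
Qed.

(** By the chain rule the Jacobian matrix of F o Phi is that of Phi times the
    transform of that of F. *)
Lemma wedge_comp F Phi : vanish0 Phi -> \det (fjac Phi) <> 0 ->
  (forall f, fcomp f Phi = 0 -> f = 0) ->
  (exists j, formal_wedge F j <> 0) ->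
  exists j, formal_wedge (fun k => fcomp (F k) Phi) j <> 0.
Proof.
move=> P1 dP inj [j wF].
rewrite /formal_wedge -[\matrix_(i, k) _]/(fjac _).
have -> : (fun j0 => \det (row' j0 (\matrix_(i, k) fps_deriv i (fcomp (F k) Phi))) <> 0)
  = fun j0 => \det (row' j0 (fjac Phi *m \matrix_(i, k) fcomp (fps_deriv i (F k)) Phi)) <> 0.
  by rewrite -fjac_comp.
apply: minors_mulmx => //; first exact: fps_dom.
exists j; have -> : row' j (\matrix_(i, k) fcomp (fps_deriv i (F k)) Phi) =
   map_mx (fcompr P1) (row' j (fjac F)).
  by apply/matrixP => a b; rewrite !mxE.
by rewrite det_map_mx => /inj.
Qed.

(** n - 1 independent functions have a common kernel of rank one among the
    vector fields: this is how complete integrability is used. *)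
Lemma wedge_kernel F (u v : 'I_n -> fps K n) :
  (exists j, formal_wedge F j <> 0) ->
  (forall k, \sum_i u i * fps_deriv i (F k) = 0) ->
  (forall k, \sum_i v i * fps_deriv i (F k) = 0) ->
  forall a b, u a * v b = u b * v a.
Proof.
move=> [j wF] uF vF; apply: (minor_kernel (@fps_dom K n) wF) => k.
  by under eq_bigr do rewrite mxE.
by under eq_bigr do rewrite mxE.
Qed.
End Wedge.

(** * Fixed points that are computed degree by degree *)

Section CausalFixpoint.
Variables (K : comNzRingType) (n : nat) (I : Type).
Implicit Types (W : I -> fps K n) (T : (I -> fps K n) -> I -> fps K n).

Definition agree d W W' := forall i, ordge d (W i - W' i).
(** T is a contraction for the order topology; hence it has exactly one fixed
    point. *)
Definition causal T := forall d W W', agree d W W' -> agree d.+1 (T W) (T W').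

Lemma agree_sym d W W' : agree d W W' -> agree d W' W.
Proof. by move=> H i; rewrite -opprB; apply: ordgeN. Qed.
Lemma agree_trans d W1 W2 W3 : agree d W1 W2 -> agree d W2 W3 -> agree d W1 W3.
Proof. by move=> H1 H2 i; rewrite -(subrKA (W2 i)); apply: ordgeD. Qed.
Lemma agree_eq W W' : (forall d, agree d W W') -> W = W'.
Proof. by move=> H; apply/funext => i; apply: ordge_eq => d; exact: H. Qed.

Lemma causal_unique T W W' : causal T -> T W = W -> T W' = W' -> W = W'.
Proof.
move=> cT e e'; apply: agree_eq; elim=> [i //|d IH].
by rewrite -e -e'; exact: cT.
Qed.

(** The coefficients of degree d of the iterates of T from 0 are stationary
    after d + 1 steps. *)
Definition causal_fix T : I -> fps K n :=
  fun i m => iter (mdeg m).+1 T (fun=> 0) i m.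

Lemma causal_iter T d e : causal T ->
  agree d (iter d T (fun=> 0)) (iter (d + e) T (fun=> 0)).
Proof. by move=> cT; elim: d => [i //|d IH]; exact: cT. Qed.

Lemma causal_fix_iter T d : causal T ->
  agree d (causal_fix T) (iter d T (fun=> 0)).
Proof.
move=> cT i m md; have := @causal_iter T (mdeg m).+1 (d - (mdeg m).+1) cT i m (ltnSn _).
by rewrite subnKC.
Qed.

Lemma causal_fixE T : causal T -> T (causal_fix T) = causal_fix T.
Proof.
move=> cT; apply: agree_eq => d.
have H := @causal_fix_iter T d cT.
apply: (@agree_trans _ _ (iter d.+1 T (fun=> 0))).
  by move=> i; apply: (@ordge_le _ _ d.+1) => //; apply: cT.
by apply: agree_sym => i; apply: (@ordge_le _ _ d.+1) => //; exact: (@causal_fix_iter T d.+1 cT).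
Qed.
End CausalFixpoint.

(** * Weighted norms of power series *)

Section ComplexModulus.
Variable R : realType.

(** Named as an object of the structure, so that its sort carries the topology
    and the norm that every numeric closed field has. *)
Definition cplx : numClosedFieldType := complex R.
Definition cabs (z : cplx) : R := ComplexField.Normc.normc z.

Lemma cabs_ge0 z : 0 <= cabs z.
Proof. by case: z => a b; exact: sqrtr_ge0. Qed.
Lemma cabsM a b : cabs (a * b) = cabs a * cabs b.
Proof. exact: ComplexField.Normc.normcM. Qed.
Lemma cabsV a : cabs a^-1 = (cabs a)^-1.
Proof. exact: ComplexField.Normc.normcV. Qed.
Lemma cabsN a : cabs (- a) = cabs a.
Proof. exact: normcN. Qed.
Lemma cabs0 : cabs 0 = 0. Proof. exact: ComplexField.Normc.normc0. Qed.
Lemma cabs1 : cabs 1 = 1. Proof. exact: ComplexField.Normc.normc1. Qed.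
Lemma cabs_eq0 z : cabs z = 0 -> z = 0.
Proof. exact: ComplexField.Normc.eq0_normc. Qed.
Lemma cabs_gt0 z : z != 0 -> 0 < cabs z.
Proof.
move=> z0; rewrite lt_neqAle cabs_ge0 andbT eq_sym.
by apply: contra z0 => /eqP /cabs_eq0 ->.
Qed.
Lemma cabsD a b : cabs (a + b) <= cabs a + cabs b.
Proof. exact: le_normcD. Qed.
Lemma cabs_sum I (s : seq I) (P : pred I) (F : I -> cplx) :
  cabs (\sum_(i <- s | P i) F i) <= \sum_(i <- s | P i) cabs (F i).
Proof.
apply: (big_ind2 (fun a b => cabs a <= b)) => [|x1 x2 y1 y2 h1 h2|//].
  by rewrite cabs0.
by apply: le_trans (cabsD _ _) _; exact: lerD.
Qed.
End ComplexModulus.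

Section WeightedNorm.
Variables (R : realType) (n : nat).
Local Notation C := (cplx R).
Implicit Types (f g h : fps C n) (k l m : multiindex n) (r s t : R).

Definition wsum r f N := \sum_(k : box n N) cabs (f (of_box k)) * r ^+ mdeg (of_box k).
(** The norm \sum_k |f_k| r^|k| is at most s.  Unlike the sup of the terms,
    this norm is submultiplicative without any loss of radius. *)
Definition wnorm_le r s f := forall N, wsum r f N <= s.

Lemma wterm_ge0 r f k : 0 <= r -> 0 <= cabs (f k) * r ^+ mdeg k.
Proof. by move=> r0; rewrite mulr_ge0 ?cabs_ge0 ?exprn_ge0. Qed.
Lemma wsum_ge0 r f N : 0 <= r -> 0 <= wsum r f N.
Proof. by move=> r0; apply: sumr_ge0 => k _; exact: wterm_ge0. Qed.
Lemma wnorm_le_ge0 r s f : 0 <= r -> wnorm_le r s f -> 0 <= s.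
Proof. by move=> r0 /(_ 0%N); apply: le_trans; exact: wsum_ge0. Qed.
Lemma wnorm_le_coef r s f k : 0 <= r -> wnorm_le r s f -> cabs (f k) * r ^+ mdeg k <= s.
Proof.
move=> r0 /(_ (mdeg k)); apply: le_trans; rewrite /wsum.
rewrite (bigD1 (to_box _ k)) //= to_boxK; last exact: le_mdeg.
by rewrite lerDl; apply: sumr_ge0 => l _; exact: wterm_ge0.
Qed.
Lemma wnorm_le_le r s t f : s <= t -> wnorm_le r s f -> wnorm_le r t f.
Proof. by move=> st H N; exact: le_trans st. Qed.
Lemma wnorm_le0 r s : 0 <= s -> wnorm_le r s 0.
Proof. by move=> s0 N; rewrite /wsum big1 // => k _; rewrite fps0 cabs0 mul0r. Qed.
Lemma wnorm_leD r s t f g : 0 <= r -> wnorm_le r s f -> wnorm_le r t g -> wnorm_le r (s + t) (f + g).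
Proof.
move=> r0 Hf Hg N; apply: (le_trans _ (lerD (Hf N) (Hg N))).
rewrite /wsum -big_split; apply: ler_sum => k _ /=.
by rewrite -mulrDl ler_wpM2r ?exprn_ge0 // fpsD cabsD.
Qed.
Lemma wnorm_le_dom r s f g c : 0 <= r -> 0 <= c ->
  (forall k, cabs (g k) <= c * cabs (f k)) -> wnorm_le r s f -> wnorm_le r (c * s) g.
Proof.
move=> r0 c0 gf Hf N; apply: (le_trans _ (ler_wpM2l c0 (Hf N))).
rewrite /wsum mulr_sumr; apply: ler_sum => k _.
by rewrite mulrA ler_wpM2r ?exprn_ge0.
Qed.
Lemma wnorm_le_dom1 r s f g : 0 <= r ->
  (forall k, cabs (g k) <= cabs (f k)) -> wnorm_le r s f -> wnorm_le r s g.
Proof.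
by move=> r0 gf; rewrite -{2}[s]mul1r; apply: wnorm_le_dom => // k; rewrite mul1r.
Qed.
Lemma wnorm_leN r s f : 0 <= r -> wnorm_le r s f -> wnorm_le r s (- f).
Proof. by move=> r0; apply: wnorm_le_dom1 => // k; rewrite fpsN cabsN. Qed.

Lemma box_pick N (v : multiindex n) (x : R) : 0 <= x ->
  \sum_(m : box n N) (if v == of_box m then x else 0) <= x.
Proof.
move=> x0; have [[m0 ->]|H] := pselect (exists m : box n N, v = of_box m).
  rewrite (bigD1 m0) //= eqxx big1 ?addr0 // => m mm0.
  by rewrite (inj_eq (@of_box_inj _ _)) eq_sym (negPf mm0).
by rewrite big1 // => m _; case: eqP => // e; case: H; exists m.
Qed.

Lemma wnorm_leM r s t f g : 0 <= r -> wnorm_le r s f -> wnorm_le r t g -> wnorm_le r (s * t) (f * g).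
Proof.
move=> r0 Hf Hg N.
apply: (le_trans _ (ler_pM (wsum_ge0 _ _ r0) (wsum_ge0 _ _ r0) (Hf N) (Hg N))).
rewrite /wsum.
pose X (k l : box n N) := cabs (f (of_box k)) * r ^+ mdeg (of_box k) *
   (cabs (g (of_box l)) * r ^+ mdeg (of_box l)).
apply: (@le_trans _ _ (\sum_(m : box n N) \sum_(k : box n N) \sum_(l : box n N)
   (if of_box k + of_box l == of_box m then X k l else 0))).
  apply: ler_sum => m _; rewrite (fps_coefM _ _ (of_box_le m)).
  apply: le_trans (ler_wpM2r (exprn_ge0 _ r0) (cabs_sum _ _ _)) _.
  rewrite mulr_suml; apply: ler_sum => k _.
  apply: le_trans (ler_wpM2r (exprn_ge0 _ r0) (cabs_sum _ _ _)) _.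
  rewrite mulr_suml [leLHS]big_mkcond; apply: ler_sum => l _.
  case: eqP => // <-; by rewrite cabsM mdegD exprD /X mulrACA.
rewrite mulr_suml exchange_big; apply: ler_sum => k _ /=.
rewrite mulr_sumr exchange_big; apply: ler_sum => l _ /=.
by apply: box_pick; rewrite mulr_ge0 ?wterm_ge0.
Qed.

Lemma wnorm_le_fmon r c k : 0 <= r -> wnorm_le r (cabs c * r ^+ mdeg k) (fmon c k).
Proof.
move=> r0 N; rewrite /wsum; under eq_bigr do rewrite /fmon eq_sym.
apply: (le_trans _ (@box_pick N k _ _)); last by rewrite mulr_ge0 ?cabs_ge0 ?exprn_ge0.
apply: ler_sum => m _; case: eqP => [->//|_]; by rewrite cabs0 mul0r.
Qed.
Lemma wnorm_le1 r : 0 <= r -> wnorm_le r 1 1.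
Proof.
by move=> r0; rewrite -fmon10; have := @wnorm_le_fmon r 1 0 r0; rewrite mdeg0 cabs1 mul1r.
Qed.
Lemma wnorm_leX r s f (e : nat) : 0 <= r -> wnorm_le r s f -> wnorm_le r (s ^+ e) (f ^+ e).
Proof.
move=> r0 H; elim: e => [|e IH]; first by rewrite !expr0; exact: wnorm_le1.
by rewrite !exprS; exact: wnorm_leM.
Qed.
Lemma wnorm_le_fmpow r s (Phi : 'I_n -> fps C n) k : 0 <= r ->
  (forall i, wnorm_le r s (Phi i)) -> wnorm_le r (s ^+ mdeg k) (fmpow Phi k).
Proof.
move=> r0 H; rewrite /fmpow /mdeg.
apply: (big_rec2 (fun e p => wnorm_le r (s ^+ e) p)); first by rewrite expr0; exact: wnorm_le1.
by move=> i e p _ IH; rewrite exprD; apply: wnorm_leM => //; exact: wnorm_leX.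
Qed.

(** Since ||Phi^k|| <= s^|k|, composing with Phi is no worse than evaluating
    the norm of f at the radius s. *)
Lemma wnorm_le_comp r s t (Phi : 'I_n -> fps C n) f : 0 <= r -> vanish0 Phi ->
  (forall i, wnorm_le r s (Phi i)) -> wnorm_le s t f -> wnorm_le r t (fcomp f Phi).
Proof.
move=> r0 P1 HP Hf N.
have mD (m : box n N) : (mdeg (of_box m) <= \sum_(i < n) N)%N.
  by apply: leq_sum => i _; exact: of_box_le.
set D := (\sum_(i < n) N)%N in mD.
apply: le_trans (Hf D); rewrite /wsum.
under eq_bigr do rewrite (fcompE _ P1 (mD _)).
apply: (@le_trans _ _ (\sum_(m : box n N) \sum_(k : box n D)
   cabs (f (of_box k)) * (cabs (fmpow Phi (of_box k) (of_box m)) * r ^+ mdeg (of_box m)))).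
  apply: ler_sum => m _; apply: le_trans (ler_wpM2r (exprn_ge0 _ r0) (cabs_sum _ _ _)) _.
  by rewrite mulr_suml; apply: ler_sum => k _; rewrite cabsM mulrA.
rewrite exchange_big; apply: ler_sum => k _ /=.
by rewrite -mulr_sumr ler_wpM2l ?cabs_ge0 //; exact: wnorm_le_fmpow.
Qed.

(** Reducing the radius by a factor t gains t for each unit of order.  Applied
    to terms of order 2, this is the source of smallness in the convergence
    proofs. *)
Lemma wnorm_le_shrink r s t f e : 0 <= r -> 0 <= t <= 1 -> ordge e f ->
  wnorm_le r s f -> wnorm_le (t * r) (t ^+ e * s) f.
Proof.
move=> r0 /andP[t0 t1] ef Hf N; apply: (le_trans _ (ler_wpM2l (exprn_ge0 _ t0) (Hf N))).
rewrite /wsum mulr_sumr; apply: ler_sum => k _.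
have [ke|ek] := ltnP (mdeg (of_box k)) e.
  by rewrite ef // cabs0 !mul0r mulr0.
rewrite exprMn mulrCA; apply: ler_wpM2r; first exact: wterm_ge0.
by rewrite -(subnKC ek) exprD ler_piMr ?exprn_ge0 // exprn_ile1.
Qed.

Lemma wnorm_le_seq r s f (q : seq (multiindex n)) : 0 <= r -> wnorm_le r s f -> uniq q ->
  \sum_(k <- q) cabs (f k) * r ^+ mdeg k <= s.
Proof.
move=> r0 Hf uq.
pose N := (\sum_(k <- q) mdeg k)%N.
have kN k : k \in q -> forall i, (k i <= N)%N.
  move=> kq i; apply: leq_trans (le_mdeg k i) _.
  by rewrite /N (big_rem _ kq) /= leq_addr.
apply: le_trans (Hf N).
have -> : q = map (@of_box n N) (map (to_box N) q).
  rewrite -map_comp -[LHS]map_id; apply/eq_in_map => k kq /=.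
  by rewrite to_boxK //; exact: kN.
rewrite big_map /wsum big_uniq /=; last first.
  by rewrite map_inj_in_uniq // => k l kq lq /(congr1 (@of_box n N)); rewrite !to_boxK //; exact: kN.
rewrite [leRHS](bigID (fun b : box n N => b \in map (to_box N) q)) /= lerDl.
by apply: sumr_ge0 => k _; exact: wterm_ge0.
Qed.

Lemma wnorm_le_shift r s f k : 0 < r -> wnorm_le r s f ->
  wnorm_le r (s / r ^+ mdeg k) (fun m => f (m + k)).
Proof.
move=> r0 Hf N; rewrite ler_pdivlMr ?exprn_gt0 // /wsum.
pose q := [seq of_box m + k | m : box n N].
have uq : uniq q.
  rewrite map_inj_uniq ?enum_uniq // => m m'; rewrite !(addrC _ k).
  by move=> /midx_addI /of_box_inj.
apply: le_trans (wnorm_le_seq (ltW r0) Hf uq).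
rewrite mulr_suml /q big_map big_enum /=; apply: ler_sum => m _.
by rewrite mdegD exprD mulrA.
Qed.

(** A ball stable under T contains the iterates of 0, hence the fixed point,
    because a partial sum sees only finitely many coefficients. *)
Lemma wnorm_le_causal_fix I (T : (I -> fps C n) -> I -> fps C n) r (s : I -> R) :
  0 <= r -> (forall i, 0 <= s i) -> causal T ->
  (forall W, (forall i, wnorm_le r (s i) (W i)) -> forall i, wnorm_le r (s i) (T W i)) ->
  forall i, wnorm_le r (s i) (causal_fix T i).
Proof.
move=> r0 s0 cT HT i N.
have H d : forall i, wnorm_le r (s i) (iter d T (fun=> 0) i).
  by elim: d => [j|d IH]; [exact: wnorm_le0 | exact: HT].
have mD (m : box n N) : (mdeg (of_box m) <= \sum_(i < n) N)%N.
  by apply: leq_sum => j _; exact: of_box_le.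
set D := (\sum_(i < n) N)%N in mD.
apply: le_trans (H D.+1 i N); rewrite /wsum; apply: ler_sum => m _.
have := @causal_fix_iter _ _ _ T D.+1 cT i (of_box m).
by rewrite ltnS fpsB => /(_ (mD m))/eqP; rewrite subr_eq0 => /eqP ->.
Qed.

End WeightedNorm.

(** * Formal linearization of a completely integrable foliation *)

Section NormalForm.
Variables (K : numClosedFieldType) (p : nat).
Local Notation n := p.+1.
Implicit Types (g h u : fps K n) (m q : multiindex n) (W : 'I_n -> fps K n).
Variables (lam : 'I_n -> K) (j0 : 'I_n) (f : 'I_n -> fps K n).
Hypothesis lam_neq0 : lam j0 != 0.
Hypothesis f2 : forall i, ordge 2 (f i).

(** The eigenvalue of the linear part S = \sum_i lam_i x_i d/dx_i on the
    monomial x^q. *)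
Definition weight q : K := \sum_i (q i)%:R * lam i.
Hypothesis star : forall q, weight q = lam j0 -> (0 < q j0)%N.

Lemma weightD k l : weight (k + l) = weight k + weight l.
Proof.
by rewrite /weight -big_split; apply: eq_bigr => i _; rewrite midxD natrD mulrDl.
Qed.
Lemma weight_unit i : weight (unit_index i) = lam i.
Proof.
rewrite /weight (bigD1 i) //= ffunE eqxx mul1r big1 ?addr0 // => j ji.
by rewrite ffunE (negPf ji) mul0r.
Qed.

Lemma fvarM_coefD c i g m : (fmon c (unit_index i) * g) (m + unit_index i) = c * g m.
Proof. by rewrite addrC fmon_mul. Qed.
Lemma fvarM_coef0 c i g m : m i = 0%N -> (fmon c (unit_index i) * g) m = 0.
Proof.
move=> mi; apply: fmon_mul0; apply/negP => /forallP /(_ i).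
by rewrite ffunE eqxx mi.
Qed.

(** Since monomials are eigenvectors of diagonal fields, the homological
    equation can be solved one coefficient at a time. *)
Lemma diag_deriv (w : 'I_n -> K) g q :
  (\sum_i fmon (w i) (unit_index i) * fps_deriv i g) q =
  (\sum_i (q i)%:R * w i) * g q.
Proof.
rewrite fps_sumE mulr_suml; apply: eq_bigr => i _.
case: (midx_unitP q i) => [qi|[l ->]]; first by rewrite fvarM_coef0 // qi !mul0r.
rewrite fvarM_coefD /fps_deriv midxD ffunE eqxx addn1 -mulr_natl; ring.
Qed.

(** One family W of series encodes all the unknowns of the normal form.  Its
    nonresonant part is the nonlinear part of the change of coordinates; its
    resonant part is the rest of the normal form minus lam_i x_i u, where u is
    fixed by requiring that the rest has no component along j0.  Condition
    star makes this possible: a monomial of weight lam_j0 is divisible by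
    x_j0. *)
Definition nonres_part W i : fps K n :=
  fun q => if (2 <= mdeg q)%N && (weight q != lam i) then W i q else 0.
Definition res_part W i : fps K n :=
  fun q => if (2 <= mdeg q)%N && (weight q == lam i) then W i q else 0.
Definition unit_part W : fps K n :=
  fun q => if (0 < mdeg q)%N && (weight q == 0)
           then - W j0 (q + unit_index j0) / lam j0 else 0.
Definition nf_rest W i := res_part W i + fmon (lam i) (unit_index i) * unit_part W.
Definition nf_map W i := fvar K i + nonres_part W i.
Definition nf_rhs W i := fcomp (f i) (nf_map W) +
  unit_part W * (fmon (lam i) 0 * nonres_part W i + fcomp (f i) (nf_map W)).
Definition divisor i q := if weight q == lam i then 1 else weight q - lam i.
(** For W = nf_op W and Phi = nf_map W, the field S + nf_rest W is carried by
    Phi to (1 + u) X.  The divisor 1 at resonant indices puts the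
    obstruction into the resonant part of W. *)
Definition nf_op W i : fps K n :=
  fun q => (nf_rhs W i - \sum_l nf_rest W l * fps_deriv l (nonres_part W i)) q
           / divisor i q.
(** The same operator for a vanishing rest.  It does not differentiate W, so it
    is bounded for the weighted norms, which nf_op is not. *)
Definition lin_op W i : fps K n := fun q => nf_rhs W i q / divisor i q.

Lemma ordge_nonres W i : ordge 2 (nonres_part W i).
Proof. by move=> q q2; rewrite /nonres_part leqNgt q2. Qed.
Lemma ordge_res W i : ordge 2 (res_part W i).
Proof. by move=> q q2; rewrite /res_part leqNgt q2. Qed.
Lemma ordge_unit W : ordge 1 (unit_part W).
Proof. by move=> q q1; rewrite /unit_part ltnNge -ltnS q1. Qed.
Lemma ordge_rest W i : ordge 2 (nf_rest W i).
Proof.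
apply: ordgeD; first exact: ordge_res.
apply: (@ordgeM _ _ 1 1); last exact: ordge_unit.
by rewrite -(mdeg_unit i); exact: ordge_fmon.
Qed.
Lemma vanish0_nf_map W : vanish0 (nf_map W).
Proof.
move=> i; apply: ordgeD; first exact: ordge_fvar.
by apply: (@ordge_le _ _ 2) => //; exact: ordge_nonres.
Qed.
Lemma nf_map_tangent W i : ordge 2 (nf_map W i - fvar K i).
Proof. by rewrite /nf_map addrC addKr; exact: ordge_nonres. Qed.
Lemma ordge_rhs W i : ordge 2 (nf_rhs W i).
Proof.
have fo : ordge 2 (fcomp (f i) (nf_map W)) by apply: fcomp_ord => //; exact: vanish0_nf_map.
apply: ordgeD => //; apply: ordgeMl; apply: ordgeD => //.
by apply: ordgeMl; exact: ordge_nonres.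
Qed.

Section Causality.
Variables (d : nat) (W W' : 'I_n -> fps K n).
Hypothesis WW : agree d W W'.
Lemma coef_agree i q : (mdeg q < d)%N -> W i q = W' i q.
Proof. by move=> qd; apply/eqP; rewrite -subr_eq0 -fpsB (WW i qd). Qed.
Lemma agree_nonres : agree d (nonres_part W) (nonres_part W').
Proof.
by move=> i q qd; rewrite fpsB /nonres_part coef_agree // subrr.
Qed.
Lemma agree_unit : ordge d.-1 (unit_part W - unit_part W').
Proof.
move=> q qd; rewrite fpsB /unit_part coef_agree ?subrr // mdegD mdeg_unit; lia.
Qed.
Lemma agree_rest : agree d (nf_rest W) (nf_rest W').
Proof.
move=> i; rewrite /nf_rest opprD addrACA -mulrBr; apply: ordgeD.
  by move=> q qd; rewrite fpsB /res_part coef_agree // subrr.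
apply: (@ordge_le _ _ (1 + d.-1)); first lia.
apply: ordgeM; last exact: agree_unit.
by rewrite -(mdeg_unit i); exact: ordge_fmon.
Qed.
Lemma agree_comp i :
  ordge d.+1 (fcomp (f i) (nf_map W) - fcomp (f i) (nf_map W')).
Proof.
(* for d = 0 the order 2 of both compositions is enough *)
have [d0|d0] := posnP d.
  rewrite d0; apply: (@ordge_le _ _ 2) => //.
  by apply: ordgeB; apply: fcomp_ord => //; exact: vanish0_nf_map.
have := @fcomp_sub _ _ (nf_map W) (nf_map W') d 2 (f i) d0.
rewrite addn2; apply => // [||j]; try exact: vanish0_nf_map.
rewrite /nf_map opprD addrACA subrr add0r; exact: agree_nonres.
Qed.
Lemma agree_rhs : agree d.+1 (nf_rhs W) (nf_rhs W').
Proof.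
move=> i; rewrite /nf_rhs opprD addrACA; apply: ordgeD; first exact: agree_comp.
apply: (@ordge_subM _ _ _ _ _ _ _ 1 2).
- exact: ordge_unit.
- apply: ordgeD; first by apply: ordgeMl; exact: ordge_nonres.
  by apply: fcomp_ord => //; exact: vanish0_nf_map.
- by apply: (ordge_le _ agree_unit); lia.
rewrite opprD addrACA -mulrBr subn1 /=; apply: ordgeD.
  by apply: ordgeMl; exact: agree_nonres.
by apply: (ordge_le _ (agree_comp i)).
Qed.
End Causality.

Lemma lin_op_causal : causal lin_op.
Proof.
move=> d W W' WW i q qd; rewrite fpsB /lin_op -mulrBl -fpsB.
by rewrite (agree_rhs WW) // mul0r.
Qed.
Lemma nf_op_causal : causal nf_op.
Proof.
move=> d W W' WW i q qd; rewrite fpsB /nf_op -mulrBl -fpsB.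
rewrite (_ : _ - _ - _ = (nf_rhs W i - nf_rhs W' i) - \sum_l (
   nf_rest W l * fps_deriv l (nonres_part W i) -
   nf_rest W' l * fps_deriv l (nonres_part W' i))); last first.
  by rewrite sumrB; ring.
set D := _ - _; suff oD : ordge d.+1 D by rewrite oD // mul0r.
apply: ordgeB; first exact: agree_rhs.
apply: ordge_sum => l _; apply: (@ordge_subM _ _ _ _ _ _ _ 2 1).
- exact: ordge_rest.
- by apply: (@ordge_deriv _ _ l 2); exact: ordge_nonres.
- by rewrite subn1; exact: agree_rest.
apply: (@ordge_le _ _ d.-1); first lia.
have -> : fps_deriv l (nonres_part W i) - fps_deriv l (nonres_part W' i) =
   fps_deriv l (nonres_part W i - nonres_part W' i).
  by apply/eqP; rewrite subr_eq -fderivD subrK.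
by apply: ordge_deriv; exact: agree_nonres.
Qed.

(** The monomials of weight lam_j0 being divisible by x_j0, the resonant part of
    W along j0 is exactly - lam_j0 x_j0 u. *)
Lemma nf_rest_j0 W : nf_rest W j0 = 0.
Proof.
apply/funext => q; rewrite /nf_rest fpsD fps0 /res_part.
case: (midx_unitP q j0) => [q0|[l ->]].
  rewrite fvarM_coef0 // addr0; case: eqP; rewrite ?andbF // andbT => /star.
  by rewrite q0.
rewrite fvarM_coefD mdegD mdeg_unit addn1 ltnS weightD weight_unit.
rewrite -{2}[lam j0]add0r (inj_eq (addIr _)) /unit_part.
by case: ifP => _; rewrite ?mulr0 ?addr0 // mulrC mulfVK // addrN.
Qed.

Lemma nf_rest_supp W i q : nf_rest W i q != 0 -> (2 <= mdeg q)%N /\ weight q = lam i.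
Proof.
rewrite /nf_rest fpsD /res_part; case: ifP => [/andP[? /eqP ?] //|_].
rewrite add0r; case: (midx_unitP q i) => [q0|[l ->]].
  by rewrite fvarM_coef0 // eqxx.
rewrite fvarM_coefD mdegD mdeg_unit weightD weight_unit /unit_part addn1.
by case: ifP => [/andP[? /eqP->]|_]; rewrite ?add0r // mulr0 eqxx.
Qed.

Definition linear_field i := fmon (lam i) (unit_index i).

(** Coefficientwise the fixed point equation is the homological equation
    (S - lam_i) phi_i + resonant part = right-hand side; the rest is algebra. *)
Lemma nf_equation W i : nf_op W = W ->
  \sum_l (linear_field l + nf_rest W l) * fps_deriv l (nf_map W i) =
  (1 + unit_part W) * (fmon (lam i) 0 * nf_map W i + fcomp (f i) (nf_map W)).
Proof.
move=> eW.
pose B := nf_rhs W i - \sum_l nf_rest W l * fps_deriv l (nonres_part W i).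
have B2 : ordge 2 B.
  apply: ordgeB; first exact: ordge_rhs.
  by apply: ordge_sum => l _; rewrite mulrC; apply: ordgeMl; exact: ordge_rest.
have homol : \sum_l linear_field l * fps_deriv l (nonres_part W i) =
    B + fmon (lam i) 0 * nonres_part W i - res_part W i.
  apply/funext => q; rewrite diag_deriv -/(weight q) fpsB fpsD fmonC_mul.
  rewrite /nonres_part /res_part.
  have [q2|q2] := ltnP (mdeg q) 2; first by rewrite /= B2 // !mulr0 addr0 subr0.
  rewrite -eW /nf_op -/B /divisor /=; case: eqP => [->|/eqP ne] /=.
    by rewrite divr1 !mulr0 addr0 subrr.
  have ne0 : weight q - lam i != 0 by rewrite subr_eq0.
  by rewrite subr0; field.
have dvar (Y : 'I_n -> fps K n) : \sum_l Y l * fps_deriv l (fvar K i) = Y i.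
  rewrite (bigD1 i) //= fderiv_var eqxx mulr1 big1 ?addr0 // => l li.
  by rewrite fderiv_var (negPf li) mulr0.
have -> : \sum_l (linear_field l + nf_rest W l) * fps_deriv l (nf_map W i) =
  linear_field i + nf_rest W i + (\sum_l linear_field l * fps_deriv l (nonres_part W i) +
     \sum_l nf_rest W l * fps_deriv l (nonres_part W i)).
  rewrite -(dvar (fun l : 'I_n => linear_field l + nf_rest W l)) -!big_split.
  by apply: eq_bigr => l _ /=; rewrite fderivD; ring.
rewrite homol /B /nf_rhs /nf_rest /nf_map /linear_field.
have -> : fmon (lam i) (unit_index i) = fmon (lam i) 0 * fvar K i.
  by rewrite fmonM mulr1 add0r.
set S := \sum_l _; ring.
Qed.

Definition field i := linear_field i + f i.

Lemma field_comp W i : fcomp (field i) (nf_map W) =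
  fmon (lam i) 0 * nf_map W i + fcomp (f i) (nf_map W).
Proof.
have P1 := vanish0_nf_map W; rewrite /field /linear_field fcompD.
by rewrite fcomp_fmon // fmpow_unit.
Qed.

Section FirstIntegral.
Variables (W : 'I_n -> fps K n) (g : fps K n).
Hypothesis eg : \sum_l (linear_field l + nf_rest W l) * fps_deriv l g = 0.

(** The rest of the normal form preserves weights and raises degrees, hence on
    the component of weight w <> 0 of an integral the operator S + N is w plus
    a nilpotent, thus injective. *)
Lemma integral_weight q : weight q != 0 -> g q = 0.
Proof.
have [e ltqe] := ubnP (mdeg q); elim: e q ltqe => // e IH q qe wq.
have /(congr1 (fun h : fps K n => h q)) := eg.
under eq_bigr do rewrite mulrDl.
rewrite big_split /= fpsD fps0 diag_deriv -/(weight q) => /eqP.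
rewrite fps_sumE big1 ?addr0 ?mulf_eq0 ?(negPf wq) => [/eqP //|i _].
apply: fps_coefM0 => k l kl.
have [->|/nf_rest_supp[k2 wk]] := eqVneq (nf_rest W i k) 0; first by rewrite mul0r.
rewrite /fps_deriv IH ?mul0rn ?mulr0 //.
  by move: qe; rewrite -kl !mdegD mdeg_unit; lia.
by move: wq; rewrite -kl !weightD weight_unit wk addrC.
Qed.

Lemma integral_diag (w : 'I_n -> K) :
  (forall q, weight q = 0 -> \sum_i (q i)%:R * w i = 0) ->
  \sum_i fmon (w i) (unit_index i) * fps_deriv i g = 0.
Proof.
move=> H; apply/funext => q; rewrite diag_deriv fps0.
have [/H ->|/integral_weight ->] := eqVneq (weight q) 0; by rewrite ?mul0r ?mulr0.
Qed.

Lemma integral_rest : \sum_i nf_rest W i * fps_deriv i g = 0.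
Proof.
have diag0 := integral_diag (w := lam) (fun q wq => wq).
by move: eg; under eq_bigr do rewrite mulrDl; rewrite big_split /= diag0 add0r.
Qed.
End FirstIntegral.

Lemma pullback_integral W F : nf_op W = W ->
  \sum_i field i * fps_deriv i F = 0 ->
  \sum_l (linear_field l + nf_rest W l) * fps_deriv l (fcomp F (nf_map W)) = 0.
Proof.
move=> eW eF; have P1 := vanish0_nf_map W.
under eq_bigr do rewrite fcomp_chain // mulr_sumr.
rewrite exchange_big /=.
transitivity (\sum_m (1 + unit_part W) * fcomp (field m * fps_deriv m F) (nf_map W)).
  apply: eq_bigr => m _; rewrite fcompM // field_comp mulrA -nf_equation //.
  rewrite mulr_suml; apply: eq_bigr => l _; by rewrite mulrA mulrAC.
by rewrite -mulr_sumr -fcomp_sum eF fcomp0 mulr0.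
Qed.

Lemma det_fjac_tangent (Phi : 'I_n -> fps K n) :
  (forall i, ordge 2 (Phi i - fvar K i)) -> \det (fjac Phi) <> 0.
Proof.
move=> P2 /(congr1 (fun g : fps K n => g 0)); rewrite fps0 det_const_coef.
have -> : \matrix_(i, j) fjac Phi i j 0 = 1%:M.
  apply/matrixP => i j; rewrite !mxE -[Phi j](subrK (fvar K j)) fderivD fpsD.
  rewrite fderiv_var (@ordge_deriv _ _ i 2 _ (P2 j)) ?mdeg0 // add0r.
  by case: eqP => _; rewrite ?mulr1n ?mulr0n ?fps1E ?eqxx.
by rewrite det1 => /eqP; rewrite oner_eq0.
Qed.

Variable F : 'I_n.-1 -> fps K n.
Hypothesis F_integral : forall k, \sum_i field i * fps_deriv i (F k) = 0.
Hypothesis F_wedge : exists j, formal_wedge F j <> 0.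

Lemma pullback_wedge W : exists j, formal_wedge (fun k => fcomp (F k) (nf_map W)) j <> 0.
Proof.
apply: wedge_comp => //; first exact: vanish0_nf_map.
  by apply: det_fjac_tangent; exact: nf_map_tangent.
by move=> g; apply: fcomp_near_id_inj; [exact: vanish0_nf_map | exact: nf_map_tangent].
Qed.

Lemma fmon_neq0 (c : K) (k : multiindex n) : c != 0 -> fmon c k <> 0.
Proof.
by move=> c0 /(congr1 (fun g : fps K n => g k)); rewrite /fmon eqxx fps0 => /eqP; apply/negP.
Qed.

(** S and N both kill the transformed integrals, so they are proportional;
    but N has no component along x_j0, where S has one. *)
Lemma rest_eq0 W : nf_op W = W -> forall i, nf_rest W i = 0.
Proof.
move=> eW i; have eG k := pullback_integral eW (F_integral k).
have := @wedge_kernel _ _ _ linear_field (nf_rest W) (pullback_wedge W)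
  (fun k => integral_diag (eG k) (fun q H => H)) (fun k => integral_rest (eG k)) j0 i.
rewrite nf_rest_j0 mulr0 => /fps_dom[|//].
by move=> /(fmon_neq0 lam_neq0).
Qed.

(** A diagonal field that kills all resonant monomials kills all the integrals
    of the normal form, so it is proportional to S. *)
Lemma weights_rank1 (w : 'I_n -> K) :
  (forall q, weight q = 0 -> \sum_i (q i)%:R * w i = 0) ->
  forall a b, w a * lam b = w b * lam a.
Proof.
move=> Hw a b; pose W := causal_fix nf_op.
have eW : nf_op W = W by apply: causal_fixE; exact: nf_op_causal.
have eG k := pullback_integral eW (F_integral k).
have := @wedge_kernel _ _ _ (fun i => fmon (w i) (unit_index i)) linear_field (pullback_wedge W)
  (fun k => integral_diag (eG k) Hw) (fun k => integral_diag (eG k) (fun q H => H)) a b.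
rewrite /linear_field !fmonM addrC.
by move=> /(congr1 (fun g : fps K n => g (unit_index b + unit_index a)));
  rewrite /fmon addrC eqxx.
Qed.

Theorem formal_linearization : exists W, lin_op W = W /\
  forall i, \sum_l linear_field l * fps_deriv l (nf_map W i) =
  (1 + unit_part W) * fcomp (field i) (nf_map W).
Proof.
pose W := causal_fix nf_op.
have eW : nf_op W = W by apply: causal_fixE; exact: nf_op_causal.
have N0 := rest_eq0 eW; exists W; split=> [|i].
  rewrite -[RHS]eW; apply/funext => i; apply/funext => q; rewrite /lin_op /nf_op.
  by rewrite big1 ?subr0 // => l _; rewrite N0 mul0r.
rewrite field_comp -nf_equation //.
by apply: eq_bigr => l _; rewrite N0 addr0.
Qed.
End NormalForm.

(** * Convergence of the linearization and of its inverse *)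

Section Convergence.
Variables (R : realType) (p : nat).
Local Notation n := p.+1.
Local Notation C := (cplx R).

Lemma wnorm_le_fvar r (i : 'I_n) : 0 <= r -> wnorm_le r r (fvar C i).
Proof. by move=> r0; have := @wnorm_le_fmon R n r 1 (unit_index i) r0; rewrite cabs1 mul1r mdeg_unit expr1. Qed.

Lemma wnorm_le_order2 rho M r (f : fps C n) : 0 < rho -> 0 <= r -> 2 * r <= rho ->
  ordge 2 f -> wnorm_le rho M f -> wnorm_le (2 * r) (4 * M / rho ^+ 2 * r ^+ 2) f.
Proof.
move=> rho0 r0 rr f2 Hf.
have := @wnorm_le_shrink R n rho M (2 * r / rho) f 2 (ltW rho0) _ f2 Hf.
rewrite divfK ?gt_eqF // => H; have {H} := H _.
rewrite (_ : (2 * r / rho) ^+ 2 * M = 4 * M / rho ^+ 2 * r ^+ 2); last first.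
  by field; rewrite gt_eqF.
apply; rewrite divr_ge0 ?mulr_ge0 ?(ltW rho0) //=.
by rewrite ler_pdivrMr // mul1r.
Qed.

Section Linearization.
Variables (lam : 'I_n -> C) (j0 : 'I_n) (f : 'I_n -> fps C n).
Hypothesis lam_neq0 : lam j0 != 0.
Hypothesis f2 : forall i, ordge 2 (f i).
Variables (rho M delta : R).
Hypothesis rho0 : 0 < rho.
Hypothesis fM : forall i, wnorm_le rho M (f i).
Hypothesis delta01 : 0 < delta <= 1.
Hypothesis small_div : forall i q, weight lam q != lam i -> delta <= cabs (weight lam q - lam i).

(** The terms without u are quadratically small by the order of f; the term
    u lam_i phi_i is small because u is of size eps and phi_i of size eps r. *)
Lemma lin_op_bound r eps A (W : 'I_n -> fps C n) : 0 < r -> 2 * r <= rho ->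
  0 <= eps <= 1 -> (forall i, cabs (lam i) <= A) ->
  (forall i, wnorm_le r (eps * r) (W i)) ->
  let c := 4 * M / rho ^+ 2 in let a : R := cabs (lam j0) in
  forall i, wnorm_le r (delta^-1 *
     (c * r ^+ 2 + (a^-1 * eps) * (A * (eps * r) + c * r ^+ 2))) (lin_op lam j0 f W i).
Proof.
move=> r0 rr /andP[e0 e1] HA HW c a i; have r0' := ltW r0.
have [d0 d1] := andP delta01.
have a0 : 0 < a by exact: cabs_gt0.
have er0 : 0 <= eps * r by rewrite mulr_ge0.
have phiB k : wnorm_le r (eps * r) (nonres_part lam W k).
  apply: wnorm_le_dom1 (HW k) => // q; rewrite /nonres_part; case: ifP => // _.
  by rewrite cabs0 cabs_ge0.
have uB : wnorm_le r (a^-1 * eps) (unit_part lam j0 W).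
  have := wnorm_le_shift (unit_index j0) r0 (HW j0); rewrite mdeg_unit expr1 mulfK ?gt_eqF //.
  apply: wnorm_le_dom => // [|q]; first by rewrite invr_ge0 ltW.
  rewrite /unit_part; case: ifP => _; last by rewrite cabs0 mulr_ge0 ?invr_ge0 ?cabs_ge0 // ltW.
  by rewrite cabsM cabsN cabsV mulrC.
have PhiB k : wnorm_le r (2 * r) (nf_map lam W k).
  apply: (@wnorm_le_le _ _ _ (r + eps * r)); last by apply: wnorm_leD => //; exact: wnorm_le_fvar.
  by rewrite mulr_natl mulr2n lerD2l ler_piMl.
have fB : wnorm_le r (c * r ^+ 2) (fcomp (f i) (nf_map lam W)).
  by apply: (wnorm_le_comp r0' (@vanish0_nf_map _ _ lam W) PhiB); exact: wnorm_le_order2.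
have lB : wnorm_le r (A * (eps * r)) (fmon (lam i) 0 * nonres_part lam W i).
  apply: wnorm_le_dom (phiB i) => // [|q]; first by apply: le_trans (HA i); exact: cabs_ge0.
  by rewrite fmonC_mul cabsM ler_wpM2r ?cabs_ge0.
have rhsB : wnorm_le r (c * r ^+ 2 + (a^-1 * eps) * (A * (eps * r) + c * r ^+ 2))
   (nf_rhs lam j0 f W i).
  by apply: wnorm_leD => //; apply: wnorm_leM => //; exact: wnorm_leD.
apply: wnorm_le_dom rhsB => // [|q]; first by rewrite invr_ge0 ltW.
rewrite /lin_op cabsM cabsV mulrC ler_wpM2r ?cabs_ge0 //.
rewrite /divisor; case: eqP => [_|/eqP H]; first by rewrite cabs1 invr1 invf_ge1.
have dd := small_div H.
by rewrite lef_pV2 // posrE //; exact: lt_le_trans dd.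
Qed.

(** For eps, then r, small enough the ball of radius eps r is stable under
    lin_op, and causality identifies W with the fixed point in that ball. *)
Lemma lin_op_convergent (W : 'I_n -> fps C n) : lin_op lam j0 f W = W ->
  exists r s, 0 < r /\ forall i, wnorm_le r s (nf_map lam W i).
Proof.
have [d0 d1] := andP delta01.
pose A : R := \sum_i cabs (lam i); pose a : R := cabs (lam j0).
have HA i : cabs (lam i) <= A.
  by rewrite /A (bigD1 i) //= lerDl; apply: sumr_ge0 => k _; exact: cabs_ge0.
have A0 : 0 <= A by apply: sumr_ge0 => k _; exact: cabs_ge0.
have a0 : 0 < a by exact: cabs_gt0.
have M0 : 0 <= M by exact: (wnorm_le_ge0 (ltW rho0) (fM j0)).
pose c := 4 * M / rho ^+ 2.
have c0 : 0 <= c by rewrite divr_ge0 ?mulr_ge0 ?exprn_ge0 // ltW.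
(* eps makes the term u lam_i phi_i at most half of what is allowed; r then
   makes the remaining terms at most the other half *)
pose eps : R := a * delta / (2 * (A + 1) + a).
have D0 : 0 < 2 * (A + 1) + a by lra.
have e0 : 0 < eps by rewrite divr_gt0 ?mulr_gt0.
have e1 : eps <= 1.
  by rewrite ler_pdivrMr // mul1r; nra.
have eA : a^-1 * eps * A <= delta / 2.
  rewrite (_ : _ * A = delta * A / (2 * (A + 1) + a)); last by rewrite /eps; field; lra.
  rewrite ler_pdivrMr //; nra.
pose B := 2 * (c + 1) * (1 + a^-1).
have ai0 : 0 < a^-1 by rewrite invr_gt0.
have B0 : 0 < B by rewrite /B; nra.
pose r := Num.min (rho / 2) (delta * eps / B).
have r0 : 0 < r by rewrite lt_min !divr_gt0 // mulr_gt0.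
have r1 : 2 * r <= rho.
  have : r <= rho / 2 by rewrite ge_min lexx.
  lra.
have r2 : r * B <= delta * eps.
  by rewrite -ler_pdivlMr // ge_min lexx orbT.
have HT V : (forall i, wnorm_le r (eps * r) (V i)) ->
   forall i, wnorm_le r (eps * r) (lin_op lam j0 f V i).
  move=> HV i.
  apply: wnorm_le_le (@lin_op_bound r eps A V r0 r1 _ HA HV i); last by rewrite (ltW e0).
  rewrite -/c -/a ler_pdivrMl //.
  have h1 : c * r + a^-1 * eps * (c * r) <= delta * eps / 2.
    have cr : c * r + a^-1 * eps * (c * r) <= c * r * (1 + a^-1).
      have : 0 <= c * r * a^-1
        by apply: mulr_ge0; [apply: mulr_ge0 => //; exact: ltW | exact: ltW].
      nra.
    have : 2 * (c * r * (1 + a^-1)) <= r * B.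
      have : 0 <= r * (1 + a^-1) by apply: mulr_ge0; lra.
      by rewrite /B; nra.
    lra.
  have h2 : a^-1 * eps * A * eps <= delta / 2 * eps by rewrite ler_wpM2r // ltW.
  have -> : c * r ^+ 2 + a^-1 * eps * (A * (eps * r) + c * r ^+ 2) =
     (c * r + a^-1 * eps * (c * r) + a^-1 * eps * A * eps) * r by ring.
  have -> : delta * (eps * r) = (delta * eps / 2 + delta / 2 * eps) * r by field.
  by rewrite ler_wpM2r ?lerD // ltW.
move=> eW.
have WB i : wnorm_le r (eps * r) (W i).
  have -> : W = causal_fix (lin_op lam j0 f).
    have cT : causal (lin_op lam j0 f) by exact: lin_op_causal.
    exact: (causal_unique cT eW (causal_fixE cT)).
  apply: (@wnorm_le_causal_fix R n _ _ r (fun=> eps * r)) => //; first exact: ltW.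
    by move=> _; rewrite mulr_ge0 // ltW.
  exact: lin_op_causal.
exists r, (r + eps * r); split=> // i; apply: wnorm_leD; first exact: ltW.
  by apply: wnorm_le_fvar; exact: ltW.
apply: wnorm_le_dom1 (WB i) => [|q]; first exact: ltW.
by rewrite /nonres_part; case: ifP => // _; rewrite cabs0 cabs_ge0.
Qed.
End Linearization.

Section Inverse.
Variables (phi : 'I_n -> fps C n) (rho M : R).
Hypothesis phi2 : forall i, ordge 2 (phi i).
Hypothesis rho0 : 0 < rho.
Hypothesis phiM : forall i, wnorm_le rho M (phi i).

Let high (W : 'I_n -> fps C n) i : fps C n := fun q => if (2 <= mdeg q)%N then W i q else 0.
Let near_id W i := fvar C i + high W i.
Let inv_op W i := - fcomp (phi i) (near_id W).

Lemma high_ord W i : ordge 2 (high W i).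
Proof. by move=> q q2; rewrite /high leqNgt q2. Qed.
Lemma near_id_vanish0 W : vanish0 (near_id W).
Proof.
move=> i; apply: ordgeD; first exact: ordge_fvar.
by apply: (@ordge_le _ _ 2) => //; exact: high_ord.
Qed.
Lemma inv_op_ord2 W i : ordge 2 (inv_op W i).
Proof. by apply: ordgeN; apply: fcomp_ord => //; exact: near_id_vanish0. Qed.
Lemma inv_op_causal : causal inv_op.
Proof.
move=> d W W' WW i; have [d0|d0] := posnP d.
  by rewrite d0; apply: (@ordge_le _ _ 2) => //; apply: ordgeB; exact: inv_op_ord2.
rewrite /inv_op -opprD; apply: ordgeN.
have := @fcomp_sub _ _ (near_id W) (near_id W') d 2 (phi i) d0.
rewrite addn2; apply => // [||j]; try exact: near_id_vanish0.
rewrite /near_id opprD addrACA subrr add0r => q qd; rewrite fpsB /high.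
by case: ifP; rewrite ?subrr // => _; rewrite -fpsB WW.
Qed.

(** The inverse of x + phi is the fixed point of psi |-> - phi o (x + psi). *)
Theorem inverse_map : exists (Psi : 'I_n -> fps C n) (r s : R),
  [/\ forall i, ordge 2 (Psi i - fvar C i),
      forall i, fcomp (fvar C i + phi i) Psi = fvar C i,
      0 < r & forall i, wnorm_le r s (Psi i)].
Proof.
pose W := causal_fix inv_op.
have eW : inv_op W = W by apply: causal_fixE; exact: inv_op_causal.
have hW i : high W i = W i.
  apply/funext => q; rewrite /high; case: ifP => // /negbT; rewrite -ltnNge => q2.
  by rewrite -eW inv_op_ord2.
have M0 : 0 <= M by exact: (wnorm_le_ge0 (ltW rho0) (phiM ord0)).
pose c := 4 * M / rho ^+ 2.
have c0 : 0 <= c by rewrite divr_ge0 ?mulr_ge0 ?exprn_ge0 // ltW.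
pose r := Num.min (rho / 2) (1 / (c + 1)).
have r0 : 0 < r by rewrite lt_min !divr_gt0 //; lra.
have r1 : 2 * r <= rho.
  have : r <= rho / 2 by rewrite ge_min lexx.
  lra.
have r2 : c * r <= 1.
  have : r * (c + 1) <= 1 by rewrite -ler_pdivlMr ?ge_min ?lexx ?orbT //; lra.
  lra.
have nearB V : (forall i, wnorm_le r r (V i)) -> forall i, wnorm_le r (2 * r) (near_id V i).
  move=> HV i; rewrite mulr_natl mulr2n; apply: wnorm_leD; rewrite ?(ltW r0) //.
    by apply: wnorm_le_fvar; exact: ltW.
  apply: wnorm_le_dom1 (HV i) => [|q]; first exact: ltW.
  by rewrite /high; case: ifP => // _; rewrite cabs0 cabs_ge0.
have WB : forall i, wnorm_le r r (W i).
  apply: (@wnorm_le_causal_fix R n _ _ r (fun=> r)) => //; try exact: ltW.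
  - by move=> _; exact: ltW.
  - exact: inv_op_causal.
  move=> V HV i; apply: wnorm_leN; first exact: ltW.
  apply: (wnorm_le_comp (ltW r0) (@near_id_vanish0 V) (nearB V HV)).
  apply: (wnorm_le_le _ (wnorm_le_order2 rho0 (ltW r0) r1 (phi2 i) (phiM i))).
  by rewrite -/c expr2 mulrA ler_piMl // ltW.
exists (near_id W), r, (2 * r); split=> // [i|i|]; last exact: nearB.
- by rewrite /near_id addrC addKr; exact: high_ord.
rewrite fcompD fcomp_var; last exact: near_id_vanish0.
by rewrite {1}/near_id hW -{1}eW /inv_op subrK.
Qed.
End Inverse.
End Convergence.

(** * Arithmetic of the eigenvalues *)

Section Integrality.
Variable K : numClosedFieldType.

(** The values w i of a Q-linear functional on the Q-span of the lam i that
    sends lam j0 to 1.  It is extended one generator at a time: the value at a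
    generator is forced if it lies in the span of the previous ones, and can be
    taken to be 0 otherwise. *)
Lemma rational_functional (I : finType) (lam : I -> K) (j0 : I) : lam j0 != 0 ->
  exists w : I -> rat, w j0 = 1 /\
  forall q : I -> rat, \sum_i ratr (q i) * lam i = 0 -> \sum_i q i * w i = 0.
Proof.
move=> l0.
suff H (t : seq I) : uniq (rcons t j0) -> exists w : I -> rat, w j0 = 1 /\
    forall q : I -> rat, \sum_(i <- rcons t j0) ratr (q i) * lam i = 0 ->
      \sum_(i <- rcons t j0) q i * w i = 0.
  have pe : perm_eq (index_enum I) (rcons (rem j0 (index_enum I)) j0).
    rewrite perm_sym perm_rcons perm_sym; apply: perm_to_rem; exact: mem_index_enum.
  have := perm_uniq pe; rewrite index_enum_uniq => /esym /H [w [w0 Hw]].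
  by exists w; split=> // q; rewrite !(perm_big _ pe) /= => /Hw.
elim: t => [_|x t IH].
  exists (fun=> 1); split=> // q; rewrite !big_seq1 mulr1 => /eqP.
  by rewrite mulf_eq0 (negPf l0) orbF fmorph_eq0 => /eqP.
rewrite rcons_cons /=; set s := rcons t j0 => /andP[xs us].
have [w [w0 Hw]] := IH us.
have xj : j0 != x by apply: contraNneq xs => <-; rewrite mem_rcons inE eqxx.
have off (a : rat) (q : I -> rat) : \sum_(i <- s) q i * (if i == x then a else w i) =
    \sum_(i <- s) q i * w i.
  rewrite big_seq [RHS]big_seq; apply: eq_bigr => i si.
  by case: eqP => // ix; rewrite -ix si in xs.
have [[c ec]|cabs] := pselect (exists c : I -> rat,
  lam x = \sum_(i <- s) ratr (c i) * lam i).
  exists (fun i => if i == x then \sum_(j <- s) c j * w j else w i).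
  rewrite (negPf xj); split=> // q; rewrite !big_cons eqxx off => e.
  have : \sum_(i <- s) ratr (q x * c i + q i) * lam i = 0.
    rewrite -[RHS]e ec mulr_sumr -big_split; apply: eq_bigr => i _ /=.
    by rewrite rmorphD rmorphM mulrDl mulrA.
  move=> /Hw; under eq_bigr do rewrite mulrDl -mulrA.
  by rewrite big_split /= -mulr_sumr.
exists (fun i => if i == x then 0 else w i).
rewrite (negPf xj); split=> // q; rewrite !big_cons eqxx off mulr0 add0r => e.
apply: Hw; suff qx : q x = 0 by rewrite -[RHS]e qx rmorph0 mul0r add0r.
apply/eqP/negPn/negP => qx; apply: cabs; exists (fun i => - q i / q x).
have rq0 : ratr (q x) != 0 :> K by rewrite fmorph_eq0.
apply: (mulfI rq0); move/eqP: e; rewrite addr_eq0 => /eqP ->.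
rewrite mulr_sumr -sumrN; apply: eq_bigr => i _.
by rewrite fmorph_div rmorphN; field.
Qed.

Lemma common_denominator (I : finType) (w : I -> rat) :
  exists (D : int) (m : I -> int), D != 0 /\ forall i, w i * D%:~R = (m i)%:~R.
Proof.
exists (\prod_i denq (w i)), (fun i => numq (w i) * \prod_(j | j != i) denq (w j)).
split=> [|i]; first by apply/prodf_neq0 => i _; exact: denq_neq0.
rewrite (bigD1 i) //= !rmorphM /= mulrA; congr (_ * _).
by rewrite -{1}(divq_num_den (w i)) mulfVK // intr_eq0 denq_neq0.
Qed.

Variables (p : nat) (lam : 'I_p.+1 -> K) (j0 : 'I_p.+1) (u : K).
Hypothesis im_pos : 0 < 'Im (lam j0 / u).
Hypothesis im_neg : forall i, i != j0 -> 'Im (lam i / u) < 0.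

Lemma star_neq0 i : lam i != 0.
Proof.
apply/eqP => li; have Im0 : 'Im (lam i / u) = 0 by rewrite li mul0r raddf0.
have [ij|/im_neg] := eqVneq i j0; last by rewrite Im0 ltxx.
by move: im_pos; rewrite -ij Im0 ltxx.
Qed.

Lemma star_weight q : weight lam q = lam j0 -> (0 < q j0)%N.
Proof.
move=> e; rewrite lt0n; apply/negP => /eqP q0.
have : 'Im (weight lam q / u) <= 0.
  rewrite /weight mulr_suml raddf_sum; apply: sumr_le0 => i _ /=.
  have [->|/im_neg/ltW ni] := eqVneq i j0; first by rewrite q0 !mul0r raddf0.
  by rewrite -mulrA mulr_natl raddfMn mulrn_wle0.
by rewrite e => /(lt_le_trans im_pos); rewrite ltxx.
Qed.

Hypothesis rank1 : forall w : 'I_p.+1 -> K,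
  (forall q, weight lam q = 0 -> \sum_i (q i)%:R * w i = 0) ->
  forall a b, w a * lam b = w b * lam a.

(** A rational functional of the weights satisfies all their resonances, so by
    the rank one property it is proportional to them. *)
Lemma integral_weights : exists (c : K) (m : 'I_p.+1 -> int),
  c != 0 /\ forall i, lam i = c * (m i)%:~R.
Proof.
have l0 := star_neq0 j0.
have [w [w0 Hw]] := rational_functional l0.
have [D [m [D0 Dm]]] := common_denominator w.
have Dr0 : D%:~R != 0 :> K by rewrite intr_eq0.
exists (lam j0 / D%:~R), m; split=> [|i]; first by rewrite mulf_neq0 ?invr_eq0.
have := @rank1 (fun i => ratr (w i)) _ j0 i; rewrite w0 rmorph1 mul1r => ->.
  have /(congr1 (fun x : rat => ratr x : K)) := Dm i.
  by rewrite rmorphM /= !ratr_int => <-; field.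
move=> q; rewrite /weight => e.
have e' : \sum_i ratr ((q i)%:R : rat) * lam i = 0.
  by rewrite -[RHS]e; apply: eq_bigr => j _; rewrite ratr_nat.
have h := Hw (fun i => (q i)%:R) e'.
transitivity (ratr (\sum_i (q i)%:R * w i) : K); last by rewrite h rmorph0.
by rewrite rmorph_sum; apply: eq_bigr => j _ /=; rewrite rmorphM /= ratr_nat.
Qed.

(** Condition star makes the integer attached to j0 and the others of opposite
    signs, so x_j0^|m_i| x_i^|m_j0| is a resonant monomial. *)
Lemma resonant_exponents : exists (E : nat) (e : 'I_p.+1 -> nat),
  (0 < E)%N /\ forall i, i != j0 -> (e i)%:R * lam j0 + E%:R * lam i = 0.
Proof.
have [c [m [c0 lm]]] := integral_weights.
exists `|m j0|%N, (fun i => `|m i|%N); split=> [|i ij].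
  rewrite absz_gt0; have := star_neq0 j0; rewrite lm mulf_eq0 negb_or intr_eq0.
  by case/andP.
have Imc k : 'Im (lam k / u) = 'Im (c / u) * (m k)%:~R.
  have mr : ((m k)%:~R : K) \is Num.real by exact: realz.
  by rewrite lm mulrAC (ImMr mr).
have := im_pos; have := im_neg ij; rewrite !Imc => hi hj.
(* both imaginary parts are real multiples of the same number *)
have : ((m i)%:~R * (m j0)%:~R : K) < 0.
  rewrite -(pmulr_rlt0 _ (exprn_gt0 2 (_ : 0 < `|'Im (c / u)|))); last first.
    by rewrite normr_gt0; apply: contraTneq hj => ->; rewrite mul0r ltxx.
  by rewrite real_normK ?Creal_Im // expr2 mulrACA (nmulr_rlt0 _ hi).
rewrite -intrM ltrz0 !lm => mm.
rewrite mulrCA [X in _ + X]mulrCA -mulrDr !pmulrn -!intrM -intrD.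
apply/eqP; rewrite mulf_eq0 (negPf c0) intr_eq0 /=; nia.
Qed.

(** The divisors are integral multiples of one number: they are either zero or
    bounded below, and there are no small divisors. *)
Lemma weight_gap : exists c : K, c != 0 /\
  forall i q, weight lam q != lam i -> `|c| <= `|weight lam q - lam i|.
Proof.
have [c [m [c0 lm]]] := integral_weights; exists c; split=> // i q.
pose z := \sum_j (q j)%:Z * m j - m i.
have e : weight lam q - lam i = c * z%:~R.
  rewrite rmorphB mulrBr /= -lm; congr (_ - _); rewrite rmorph_sum mulr_sumr.
  by apply: eq_bigr => j _ /=; rewrite lm intrM; ring.
rewrite -subr_eq0 e => H; rewrite normrM ler_peMr // -intr_norm ler1z.
by rewrite -gtz0_ge1 normr_gt0; apply: contraNneq H => ->; rewrite mulr0.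
Qed.
End Integrality.

(** * Functions with a power series expansion *)

Section Expansions.
Variable R : realType.
Local Notation C := (cplx R).
Local Notation cRe := (@complex.Re R).
Local Notation cIm := (@complex.Im R).

(** Real bounds are kept in R, where the order is total, and compared with
    complex-valued norms through this embedding. *)
Definition rC (t : R) : C := real_complex R t.
Lemma rC_le s t : (rC s <= rC t) = (s <= t). Proof. exact: lecR. Qed.
Lemma rC_lt s t : (rC s < rC t) = (s < t). Proof. exact: ltcR. Qed.
Lemma rCM s t : rC (s * t) = rC s * rC t. Proof. exact: rmorphM. Qed.
Lemma rCX s (e : nat) : rC (s ^+ e) = rC s ^+ e. Proof. exact: rmorphXn. Qed.
Lemma normCE (z : C) : `|z| = rC (cabs z). Proof. by []. Qed.
Lemma cabs_le (z : C) (t : R) : (`|z| <= rC t) = (cabs z <= t).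
Proof. by rewrite normCE rC_le. Qed.
Lemma cabs_lt (z : C) (t : R) : (`|z| < rC t) = (cabs z < t).
Proof. by rewrite normCE rC_lt. Qed.
Lemma ger0_rC (z : C) : 0 <= z -> z = rC (cRe z).
Proof. by case: z => a b; rewrite [0 <= _]lecE /= => /andP[/eqP -> _]. Qed.

Definition sup_norm n (x : 'rV[C]_n) : R := cRe `|x|.
Lemma sup_normE n (x : 'rV[C]_n) : `|x| = (rC (sup_norm x)).
Proof. by apply: ger0_rC; exact: normr_ge0. Qed.
Lemma sup_norm_ge0 n (x : 'rV[C]_n) : 0 <= sup_norm x.
Proof. by rewrite -rC_le -sup_normE; exact: normr_ge0. Qed.
Lemma sup_norm_coef n (x : 'rV[C]_n) i : cabs (x 0 i) <= sup_norm x.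
Proof.
rewrite -cabs_le -sup_normE [leRHS]/Num.norm /= mx_normE.
set b := \big[_/_]_j _.
have : (`|x 0 i|%:nng <= b)%R by exact: (le_bigmax _ _ (0, i)).
by [].
Qed.
Lemma sup_norm_le n (x : 'rV[C]_n) t : 0 <= t -> (forall i, cabs (x 0 i) <= t) -> sup_norm x <= t.
Proof.
move=> t0 H; rewrite -rC_le -sup_normE [leLHS]/Num.norm /=.
have [->|/mx_norm_neq0[[a i] ->]] := eqVneq (mx_norm x) 0; first by rewrite rC_le.
by rewrite (ord1 a) cabs_le.
Qed.

Lemma near0P n (P : 'rV[C]_n -> Prop) :
  (\forall x \near (0 : 'rV[C]_n), P x) <-> exists t : R, 0 < t /\ forall x, sup_norm x < t -> P x.
Proof.
split=> [/nbhs_norm0P [e /= e0 H]|[t [t0 H]]].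
  have eE := ger0_rC (ltW e0); exists (cRe e); split.
    by rewrite -rC_lt -eE.
  by move=> x xe; apply: H => /=; rewrite sup_normE eE rC_lt.
apply/nbhs_norm0P; exists (rC t) => /=; first by rewrite rC_lt.
by move=> x /=; rewrite sup_normE rC_lt; exact: H.
Qed.

Lemma half_pow_small (B e : R) : 0 < e -> exists m, B / 2 ^+ m < e.
Proof.
move=> e0; exists (Num.bound (B / e)).
by rewrite ltr_pdivrMr ?exprn_gt0 // mulrC -ltr_pdivrMr //; exact: upper_nthrootP.
Qed.

Lemma le_half_pow (x y B : R) : (forall m, x <= y + B / 2 ^+ m) -> x <= y.
Proof.
move=> H; apply/ler_addgt0Pr => e e0; have [m me] := half_pow_small B e0.
by apply: le_trans (H m) _; rewrite lerD2l ltW.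
Qed.

Lemma cabs_ReIm (z : C) : [/\ `|cRe z| <= cabs z, `|cIm z| <= cabs z &
  cabs z <= `|cRe z| + `|cIm z|].
Proof.
have h1 (w : C) : `|cRe w| <= cabs w by rewrite -rC_le; exact: normc_ge_Re.
case: z => a b; split; first exact: h1.
  have -> : cabs (Complex a b) = cabs (Complex b a) by rewrite /cabs /= addrC.
  exact: (h1 (Complex b a)).
have e : Complex a b = (Complex a 0 : C) + Complex 0 b.
  by rewrite [RHS]/GRing.add /= addr0 add0r.
apply: (@le_trans _ _ (cabs (Complex a 0) + cabs (Complex 0 b))).
  by rewrite e; exact: cabsD.
by rewrite /cabs /= !expr0n /= addr0 add0r !sqrtr_sqr.
Qed.

Lemma geom_cvg_real (v : nat -> R) A :
  (forall n m, (n <= m)%N -> `|v m - v n| <= A / 2 ^+ n) ->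
  exists l, forall n, `|l - v n| <= A / 2 ^+ n.
Proof.
move=> H; have A0 n : 0 <= A / 2 ^+ n by apply: le_trans (H n n (leqnn n)).
pose E := [set v n - A / 2 ^+ n | n in [set: nat]].
have ubE n : ubound E (v n + A / 2 ^+ n).
  move=> _ [m _ <-]; have [mn|nm] := leqP m n.
    by have := H _ _ mn; have := A0 n; rewrite ler_norml => ? /andP[? ?]; lra.
  by have := H _ _ (ltnW nm); have := A0 m; rewrite ler_norml => ? /andP[? ?]; lra.
have supE : has_sup E.
  split; first by exists (v 0%N - A / 2 ^+ 0), 0%N.
  by exists (v 0%N + A / 2 ^+ 0); exact: ubE.
exists (sup E) => n; rewrite ler_norml.
have h1 : sup E <= v n + A / 2 ^+ n by apply: ge_sup => //; exact: supE.1.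
have h2 : v n - A / 2 ^+ n <= sup E by apply: sup_upper_bound => //; exists n.
by apply/andP; split; lra.
Qed.

(** The limit is found on the real and imaginary parts, where it is a least
    upper bound; this costs the factor 2. *)
Lemma geom_cvg (v : nat -> C) A :
  (forall n m, (n <= m)%N -> cabs (v m - v n) <= A / 2 ^+ n) ->
  exists l, forall n, cabs (l - v n) <= 2 * A / 2 ^+ n.
Proof.
move=> H.
have [|a Ha] := @geom_cvg_real (fun n => cRe (v n)) A.
  move=> n m nm; apply: le_trans (H _ _ nm); have [h _ _] := cabs_ReIm (v m - v n).
  by apply: le_trans h; rewrite raddfB.
have [|b Hb] := @geom_cvg_real (fun n => cIm (v n)) A.
  move=> n m nm; apply: le_trans (H _ _ nm); have [_ h _] := cabs_ReIm (v m - v n).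
  by apply: le_trans h; rewrite raddfB.
exists (Complex a b) => n; have [_ _ h] := cabs_ReIm ((Complex a b : C) - v n).
apply: le_trans h _; rewrite !raddfB /= mulr_natl mulr2n mulrDl.
exact: lerD.
Qed.

Section PartialSums.
Variable n : nat.
Implicit Types (a b : fps C n) (k : multiindex n) (ell : multiindex n -> C).

Lemma cabs_monomial (x : 'rV[C]_n) k t : (forall i, cabs (x 0 i) <= t) ->
  cabs (monomial x k) <= t ^+ mdeg k.
Proof.
move=> xt; rewrite /monomial /mdeg.
apply: (big_rec2 (fun e p => cabs p <= t ^+ e)); first by rewrite cabs1.
move=> i e q _ IH; rewrite exprD cabsM; apply: ler_pM; rewrite ?cabs_ge0 //.
have [t0|t0] := leP 0 t; last first.
  by have := le_trans (cabs_ge0 _) (xt i); rewrite leNgt t0.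
elim: (k i) => [|j IHj]; first by rewrite !expr0 cabs1.
by rewrite !exprS cabsM; apply: ler_pM; rewrite ?cabs_ge0.
Qed.

Definition lsum a ell N := \sum_(k : box n N) a (of_box k) * ell (of_box k).

Lemma lsum_split (G : multiindex n -> C) M N : (N <= M)%N ->
  \sum_(k : box n M) G (of_box k) = \sum_(k : box n N) G (of_box k) +
  \sum_(k : box n M | ~~ [forall i, of_box k i <= N]%N) G (of_box k).
Proof.
move=> NM; rewrite (bigID (fun k : box n M => [forall i, of_box k i <= N]%N)) /=.
congr (_ + _); rewrite big_mkcond /=.
pose G' k := if [forall i, k i <= N]%N then G k else 0.
rewrite -[LHS]/(\sum_(k : box n M) G' (of_box k)) (box_widen (G := G') NM).
  apply: eq_bigr => k _; rewrite /G' ifT //; apply/forallP => i; exact: of_box_le.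
move=> k i Nk; rewrite /G' ifF //; apply/negP => /forallP /(_ i).
by rewrite leqNgt Nk.
Qed.

(** Half of the radius is given up in order to gain a factor 2^-N on the terms
    of degree at least N. *)
Lemma tail_bound a ell r s A (I : finType) (P : pred I) (h : I -> multiindex n) N :
  0 < r -> wnorm_le r s a -> 0 <= A -> (forall k, cabs (ell k) <= A * (r / 2) ^+ mdeg k) ->
  {in P &, injective h} ->
  (forall i, P i -> (N <= mdeg (h i))%N) ->
  \sum_(i | P i) cabs (a (h i)) * cabs (ell (h i)) <= A * s / 2 ^+ N.
Proof.
move=> r0 Ha A0 Hl inj HN.
apply: (@le_trans _ _ (A / 2 ^+ N * \sum_(i | P i) cabs (a (h i)) * r ^+ mdeg (h i))).
  rewrite mulr_sumr; apply: ler_sum => i Pi.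
  have -> : A / 2 ^+ N * (cabs (a (h i)) * r ^+ mdeg (h i)) =
    cabs (a (h i)) * (A * (r ^+ mdeg (h i) / 2 ^+ N)) by ring.
  apply: ler_wpM2l; first exact: cabs_ge0.
  apply: le_trans (Hl _) _; apply: ler_wpM2l => //.
  rewrite expr_div_n; apply: ler_wpM2l; first by rewrite exprn_ge0 // ltW.
  by rewrite lef_pV2 ?posrE ?exprn_gt0 // ler_weXn2l ?ler1n ?HN.
rewrite [leRHS]mulrAC ler_wpM2l ?divr_ge0 ?exprn_ge0 //.
rewrite -big_filter -(big_map h xpredT (fun k => cabs (a k) * r ^+ mdeg k)).
apply: (wnorm_le_seq (ltW r0) Ha); rewrite map_inj_in_uniq ?filter_uniq ?index_enum_uniq //.
by move=> i j; rewrite !mem_filter => /andP[Pi _] /andP[Pj _]; exact: inj.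
Qed.

Lemma lsum_tail a ell r s A N M : 0 < r -> wnorm_le r s a -> 0 <= A ->
  (forall k, cabs (ell k) <= A * (r / 2) ^+ mdeg k) -> (N <= M)%N ->
  cabs (lsum a ell M - lsum a ell N) <= A * s / 2 ^+ N.
Proof.
move=> r0 Ha A0 Hl NM; rewrite /lsum (lsum_split (fun k => a k * ell k) NM).
rewrite addrC addKr; apply: le_trans (cabs_sum _ _ _) _.
under eq_bigr do rewrite cabsM.
apply: (tail_bound (h := @of_box n M) r0 Ha A0 Hl) => [k l _ _|k]; first exact: of_box_inj.
move=> /forallPn[j]; rewrite -ltnNge => Nk; exact: leq_trans (ltnW Nk) (le_mdeg _ _).
Qed.

Lemma lsum_bound a ell r s A N : 0 < r -> wnorm_le r s a -> 0 <= A ->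
  (forall k, cabs (ell k) <= A * (r / 2) ^+ mdeg k) -> cabs (lsum a ell N) <= A * s.
Proof.
move=> r0 Ha A0 Hl; apply: le_trans (cabs_sum _ _ _) _.
under eq_bigr do rewrite cabsM.
rewrite -[leRHS]divr1 -[1](expr0 2).
apply: (tail_bound (h := @of_box n N) (P := xpredT) r0 Ha A0 Hl) => // k l _ _.
exact: of_box_inj.
Qed.

(** An expansion with an explicit rate of convergence on half of the radius;
    this is the form in which expansions are multiplied and differentiated. *)
Definition sums_to (f : 'rV[C]_n -> C) a (r s : R) :=
  [/\ 0 < r, wnorm_le r s a & forall x, sup_norm x <= r / 2 ->
    forall N, cabs (f x - lsum a (monomial x) N) <= s / 2 ^+ N].

Lemma monomial_bound (x : 'rV[C]_n) r : sup_norm x <= r / 2 ->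
  forall k, cabs (monomial x k) <= 1 * (r / 2) ^+ mdeg k.
Proof.
by move=> xr k; rewrite mul1r; apply: cabs_monomial => i; apply: le_trans xr; exact: sup_norm_coef.
Qed.

Lemma sums_to_expansion f a r s : sums_to f a r s -> has_expansion f a.
Proof.
move=> [r0 Ha Hf]; have r20 : 0 < r / 2 by rewrite divr_gt0.
exists (rC (r / 2)), (rC s); split; first by rewrite rC_lt.
  move=> k; rewrite normCE -rCX -rCM rC_le.
  apply: le_trans (wnorm_le_coef k (ltW r0) Ha); apply: ler_wpM2l; first exact: cabs_ge0.
  by apply: lerXn2r; rewrite ?nnegrE; lra.
move=> x; rewrite sup_normE rC_lt => /ltW xr.
apply/cvgrPdist_lt => e e0; have eE := ger0_rC (ltW e0).
have e0' : 0 < cRe e by rewrite -rC_lt -eE.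
have [m me] := half_pow_small s e0'.
exists m => // N /= mN; rewrite eE cabs_lt; apply: le_lt_trans me.
apply: le_trans (Hf x xr N) _; apply: ler_wpM2l; first exact: (wnorm_le_ge0 (ltW r0) Ha).
by rewrite lef_pV2 ?posrE ?exprn_gt0 // ler_weXn2l ?ler1n.
Qed.

Lemma sums_to_exists a r s : 0 < r -> wnorm_le r s a -> exists f, sums_to f a r (2 * s).
Proof.
move=> r0 Ha.
have s0 := wnorm_le_ge0 (ltW r0) Ha.
have H x : exists l, sup_norm x <= r / 2 ->
    forall N, cabs (l - lsum a (monomial x) N) <= 2 * s / 2 ^+ N.
  have [xr|xr] := leP (sup_norm x) (r / 2); last by exists 0.
  have [|l Hl] := @geom_cvg (lsum a (monomial x)) s; last by exists l.
  move=> N M NM; rewrite -[s]mul1r.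
  exact: (lsum_tail r0 Ha ler01 (monomial_bound xr) NM).
have [f Hf] := choice H; exists f; split=> //.
by apply: wnorm_le_le Ha; lra.
Qed.

Lemma geometric_box N : \sum_(k : box n N) 2^-1 ^+ mdeg (of_box k) <= 2 ^+ n :> R.
Proof.
have -> : \sum_(k : box n N) 2^-1 ^+ mdeg (of_box k) =
    \sum_(k : box n N) \prod_(i < n) (2^-1 : R) ^+ k i.
  apply: eq_bigr => k _; rewrite /mdeg;
  rewrite (big_morph (fun e => (2^-1 : R) ^+ e) (fun x y => exprD _ x y) (expr0 _)).
  by apply: eq_bigr => i _; rewrite ffunE.
rewrite -(bigA_distr_bigA (fun (i : 'I_n) (j : 'I_N.+1) => (2^-1 : R) ^+ j)).
rewrite -[n in leRHS]card_ord -prodr_const; apply: ler_prod => i _.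
apply/andP; split; first by apply: sumr_ge0 => j _; rewrite exprn_ge0 // invr_ge0.
suff -> : \sum_(j < N.+1) (2^-1 : R) ^+ j = 2 - 2^-1 ^+ N.
  by rewrite gerBl exprn_ge0 // invr_ge0.
elim: N => [|N IH]; first by rewrite big_ord_recr big_ord0 /= !expr0; ring.
by rewrite big_ord_recr /= IH exprS; field.
Qed.

Lemma expansion_sums_to f a : has_expansion f a -> exists r s, sums_to f a r s.
Proof.
move=> [r [M [r0 Ha Hf]]]; have rE := ger0_rC (ltW r0).
set q := cRe r in rE; have q0 : 0 < q by rewrite -rC_lt -rE.
have M0 : 0 <= M.
  by apply: le_trans (Ha 0); rewrite mulr_ge0 ?exprn_ge0 ?(ltW r0).
have ME := ger0_rC M0; set s := cRe M in ME.
have Hw : wnorm_le (q / 2) (s * 2 ^+ n) a.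
  move=> N; apply: (@le_trans _ _ (\sum_(k : box n N) s * 2^-1 ^+ mdeg (of_box k))).
    apply: ler_sum => k _; rewrite expr_div_n mulrA -exprVn ler_wpM2r ?exprn_ge0 ?invr_ge0 //.
    by have := Ha (of_box k); rewrite rE ME normCE -rCX -rCM rC_le.
  rewrite -mulr_sumr ler_wpM2l //; last exact: geometric_box.
  by rewrite -rC_le -ME.
have q20 : 0 < q / 2 by rewrite divr_gt0.
exists (q / 2), (s * 2 ^+ n); split=> // x xr N.
apply/ler_addgt0Pr => e e0.
have xr' : `|x| < r by rewrite sup_normE rE rC_lt; apply: le_lt_trans xr _; lra.
have /cvgrPdist_lt /(_ (rC e)) := Hf x xr'; rewrite rC_lt => /(_ e0) [m _ Hm].
have := Hm (maxn m N) (leq_maxl _ _); rewrite /= cabs_lt => h.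
rewrite -(subrKA (lsum a (monomial x) (maxn m N))).
apply: le_trans (cabsD _ _) _; rewrite [leRHS]addrC; apply: lerD; first exact: ltW.
rewrite -[_ * 2 ^+ n]mul1r.
exact: (lsum_tail q20 Hw ler01 (monomial_bound xr) (leq_maxr _ _)).
Qed.

Lemma sums_to_shrink f a r r' s s' : 0 < r' -> r' <= r -> s <= s' ->
  sums_to f a r s -> sums_to f a r' s'.
Proof.
move=> r0 rr ss [r1 Ha Hf]; split=> // [|x xr N].
  move=> N; apply: le_trans ss; apply: le_trans (Ha N); apply: ler_sum => k _.
  apply: ler_wpM2l; first exact: cabs_ge0.
  by apply: lerXn2r; rewrite ?nnegrE // ltW.
apply: (@le_trans _ _ (s / 2 ^+ N)); last by rewrite ler_wpM2r ?invr_ge0 ?exprn_ge0.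
by apply: Hf; apply: le_trans xr _; lra.
Qed.

Lemma expansions_common f g a b : has_expansion f a -> has_expansion g b ->
  exists r s, sums_to f a r s /\ sums_to g b r s.
Proof.
move=> /expansion_sums_to [r [s Hf]] /expansion_sums_to [r' [s' Hg]].
have [r0 _ _] := Hf; have [r0' _ _] := Hg.
exists (Num.min r r'), (Num.max s s'); split.
  apply: sums_to_shrink Hf; first by rewrite lt_min r0.
    by rewrite ge_min lexx.
  by rewrite le_max lexx.
apply: sums_to_shrink Hg; first by rewrite lt_min r0.
  by rewrite ge_min lexx orbT.
by rewrite le_max lexx orbT.
Qed.

Lemma lsumD a b ell N : lsum (a + b) ell N = lsum a ell N + lsum b ell N.
Proof. by rewrite /lsum -big_split; apply: eq_bigr => k _; rewrite fpsD mulrDl. Qed.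

Lemma expansionD f g a b : has_expansion f a -> has_expansion g b ->
  has_expansion (fun x => f x + g x) (a + b).
Proof.
move=> Hf Hg; have [r [s [[r0 Ha Hf'] [_ Hb Hg']]]] := expansions_common Hf Hg.
apply: (@sums_to_expansion _ _ r (s + s)); split=> // [|x xr N].
  by apply: wnorm_leD => //; exact: ltW.
rewrite lsumD opprD addrACA mulrDl; apply: le_trans (cabsD _ _) _.
by apply: lerD; [exact: Hf' | exact: Hg'].
Qed.

Lemma monomialD (x : 'rV[C]_n) k l : monomial x (k + l) = monomial x k * monomial x l.
Proof.
by rewrite /monomial -big_split; apply: eq_bigr => i _; rewrite midxD exprD.
Qed.

(** Truncation to a box does not commute with products: what is lost are the
    pairs of indices whose sum leaves the box. *)
Lemma lsumM a b (x : 'rV[C]_n) N :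
  lsum a (monomial x) N * lsum b (monomial x) N - lsum (a * b) (monomial x) N =
  \sum_(kl : box n N * box n N | ~~ [forall i, (of_box kl.1 + of_box kl.2)%R i <= N]%N)
     (a (of_box kl.1) * monomial x (of_box kl.1)) * (b (of_box kl.2) * monomial x (of_box kl.2)).
Proof.
pose G k l := a k * monomial x k * (b l * monomial x l).
have -> : lsum (a * b) (monomial x) N = \sum_(k : box n N) \sum_(l : box n N)
   if [forall i, (of_box k + of_box l)%R i <= N]%N then G (of_box k) (of_box l) else 0.
  rewrite /lsum.
  transitivity (\sum_(m : box n N) \sum_(k : box n N) \sum_(l : box n N)
     if of_box k + of_box l == of_box m then G (of_box k) (of_box l) else 0).
    apply: eq_bigr => m _; rewrite (fps_coefM _ _ (of_box_le m)) mulr_suml.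
    apply: eq_bigr => k _; rewrite mulr_suml big_mkcond; apply: eq_bigr => l _.
    by case: eqP => // <-; rewrite monomialD /G; ring.
  rewrite exchange_big; apply: eq_bigr => k _ /=; rewrite exchange_big; apply: eq_bigr => l _ /=.
  case: ifP => [/forallP H|/negP H].
    rewrite (bigD1 (to_box N (of_box k + of_box l))) //= to_boxK // eqxx big1 ?addr0 // => m mkl.
    by case: eqP => // e; case/eqP: mkl; apply: of_box_inj; rewrite to_boxK.
  rewrite big1 // => m _; case: eqP => // e; case: H; apply/forallP => i.
  by rewrite e; exact: of_box_le.
rewrite /lsum big_distrlr /= -sumrB.
rewrite [RHS]big_mkcond -(pair_bigA _ (fun k l : box n N =>
  if ~~ [forall i, (of_box k + of_box l)%R i <= N]%N then G (of_box k) (of_box l) else 0)).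
apply: eq_bigr => k _ /=; rewrite -sumrB; apply: eq_bigr => l _.
by case: ifP => _ /=; rewrite ?subrr ?subr0.
Qed.

Lemma sums_to_val f a r s (x : 'rV[C]_n) : sums_to f a r s -> sup_norm x <= r / 2 ->
  cabs (f x) <= 2 * s.
Proof.
move=> [r0 Ha Hf] xr; rewrite -(subrK (lsum a (monomial x) 0) (f x)).
apply: le_trans (cabsD _ _) _; rewrite mulr_natl mulr2n; apply: lerD.
  by have := Hf x xr 0%N; rewrite expr0 divr1.
by have := lsum_bound 0 r0 Ha ler01 (monomial_bound xr); rewrite mul1r.
Qed.

(** The error of the truncated Cauchy product splits into the errors of the two
    factors and the terms of lsumM, whose degree exceeds N. *)
Lemma expansionM f g a b : has_expansion f a -> has_expansion g b ->
  has_expansion (fun x => f x * g x) (a * b).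
Proof.
move=> Hf Hg; have [r [s [Hf' Hg']]] := expansions_common Hf Hg.
have [r0 Ha Hfx] := Hf'; have [_ Hb Hgx] := Hg'.
have s0 := wnorm_le_ge0 (ltW r0) Ha.
apply: (@sums_to_expansion _ _ r (4 * (s * s))); split=> // [|x xr N].
  apply: wnorm_le_le (wnorm_leM (ltW r0) Ha Hb).
  have : 0 <= s * s by rewrite mulr_ge0.
  lra.
have -> : f x * g x - lsum (a * b) (monomial x) N =
   f x * (g x - lsum b (monomial x) N) +
   (f x - lsum a (monomial x) N) * lsum b (monomial x) N +
   (lsum a (monomial x) N * lsum b (monomial x) N - lsum (a * b) (monomial x) N) by ring.
have -> : 4 * (s * s) / 2 ^+ N = 2 * s * (s / 2 ^+ N) + s / 2 ^+ N * s + s * s / 2 ^+ N by ring.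
apply: le_trans (cabsD _ _) _; apply: lerD; first (apply: le_trans (cabsD _ _) _; apply: lerD).
- rewrite cabsM; apply: ler_pM; rewrite ?cabs_ge0 //; first exact: (sums_to_val Hf' xr).
  exact: Hgx.
- rewrite cabsM; apply: ler_pM; rewrite ?cabs_ge0 //; first exact: Hfx.
  by have := lsum_bound N r0 Hb ler01 (monomial_bound xr); rewrite mul1r.
rewrite lsumM; apply: le_trans (cabs_sum _ _ _) _.
pose T c k : R := cabs (c k) * r ^+ mdeg k.
apply: (@le_trans _ _ (\sum_(kl : box n N * box n N)
   T a (of_box kl.1) * T b (of_box kl.2) / 2 ^+ N)).
  rewrite big_mkcond; apply: ler_sum => -[k l] _ /=; case: ifP => [/forallPn[j]|_]; last first.
    by rewrite divr_ge0 ?exprn_ge0 // mulr_ge0 // wterm_ge0 // ltW.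
  rewrite -ltnNge => Nj; rewrite !cabsM.
  have mb := monomial_bound xr.
  apply: (@le_trans _ _ (cabs (a (of_box k)) * (r / 2) ^+ mdeg (of_box k) *
     (cabs (b (of_box l)) * (r / 2) ^+ mdeg (of_box l)))).
    apply: ler_pM; rewrite ?mulr_ge0 ?cabs_ge0 //; apply: ler_wpM2l; rewrite ?cabs_ge0 //.
      by have := mb (of_box k); rewrite mul1r.
    by have := mb (of_box l); rewrite mul1r.
  rewrite /T !expr_div_n.
  have -> : cabs (a (of_box k)) * (r ^+ mdeg (of_box k) / 2 ^+ mdeg (of_box k)) *
      (cabs (b (of_box l)) * (r ^+ mdeg (of_box l) / 2 ^+ mdeg (of_box l))) =
      cabs (a (of_box k)) * r ^+ mdeg (of_box k) * (cabs (b (of_box l)) * r ^+ mdeg (of_box l)) /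
      2 ^+ mdeg (of_box k + of_box l).
    by rewrite mdegD exprD; field; rewrite !expf_neq0.
  rewrite ler_wpM2l ?mulr_ge0 ?cabs_ge0 ?exprn_ge0 ?(ltW r0) //.
  rewrite lef_pV2 ?posrE ?exprn_gt0 // ler_weXn2l ?ler1n //.
  exact: leq_trans (ltnW Nj) (le_mdeg _ _).
rewrite -mulr_suml ler_wpM2r ?invr_ge0 ?exprn_ge0 //.
rewrite -(pair_bigA _ (fun k l : box n N => T a (of_box k) * T b (of_box l))) -big_distrlr /=.
by apply: ler_pM; [exact: (wsum_ge0 a N (ltW r0)) | exact: (wsum_ge0 b N (ltW r0)) | exact: Ha | exact: Hb].
Qed.

Lemma expansion_const c : has_expansion (fun _ : 'rV[C]_n => c) (fmon c 0).
Proof.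
apply: (@sums_to_expansion _ _ 1 (cabs c)); split=> // [|x _ N].
  by have := @wnorm_le_fmon R n 1 c 0 ler01; rewrite mdeg0 mulr1.
rewrite /lsum (bigD1 (to_box N 0)) //= to_boxK => [|i]; last by rewrite ffunE.
rewrite {1}/fmon eqxx /monomial big1 => [|i _]; last by rewrite ffunE expr0.
rewrite mulr1 big1 ?addr0 ?subrr ?cabs0 ?divr_ge0 ?cabs_ge0 ?exprn_ge0 // => k k0.
rewrite /fmon; case: eqP => [e|]; last by rewrite mul0r.
by case/eqP: k0; apply: of_box_inj; rewrite to_boxK // => i; rewrite ffunE.
Qed.
Lemma expansion1 : has_expansion (fun _ : 'rV[C]_n => 1) 1.
Proof. by rewrite -(fmon10 C n); exact: expansion_const. Qed.
Lemma expansion0 : has_expansion (fun _ : 'rV[C]_n => 0) 0.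
Proof. by rewrite -(fmon0 _ 0); exact: expansion_const. Qed.
Lemma expansionN1 : has_expansion (fun _ : 'rV[C]_n => -1) (-1).
Proof. by rewrite -(fmon10 C n) -fmonN; exact: expansion_const. Qed.

Lemma expansion_sum I (q : seq I) (P : pred I) (F : I -> 'rV[C]_n -> C) (A : I -> fps C n) :
  (forall i, P i -> has_expansion (F i) (A i)) ->
  has_expansion (fun x => \sum_(i <- q | P i) F i x) (\sum_(i <- q | P i) A i).
Proof.
move=> H; elim: q => [|i q IH].
  rewrite big_nil (_ : (fun x => _) = fun=> 0); first exact: expansion0.
  by apply/funext => x; rewrite big_nil.
case Pi: (P i); rewrite big_cons Pi.
  rewrite (_ : (fun x => _) = fun x => F i x + \sum_(j <- q | P j) F j x).
    by apply: expansionD; [exact: H | exact: IH].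
  by apply/funext => x; rewrite big_cons Pi.
rewrite (_ : (fun x => _) = fun x => \sum_(j <- q | P j) F j x); first exact: IH.
by apply/funext => x; rewrite big_cons Pi.
Qed.
Lemma expansion_prod I (q : seq I) (F : I -> 'rV[C]_n -> C) (A : I -> fps C n) :
  (forall i, has_expansion (F i) (A i)) ->
  has_expansion (fun x => \prod_(i <- q) F i x) (\prod_(i <- q) A i).
Proof.
move=> H; elim: q => [|i q IH].
  rewrite big_nil (_ : (fun x => _) = fun=> 1); first exact: expansion1.
  by apply/funext => x; rewrite big_nil.
rewrite big_cons (_ : (fun x => _) = fun x => F i x * \prod_(j <- q) F j x).
  by apply: expansionM; [exact: H | exact: IH].
by apply/funext => x; rewrite big_cons.
Qed.
Lemma expansion_det m (F : 'I_m -> 'I_m -> 'rV[C]_n -> C) (A : 'M[fps C n]_m) :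
  (forall i j, has_expansion (F i j) (A i j)) ->
  has_expansion (fun x => \det (\matrix_(i, j) F i j x)) (\det A).
Proof.
move=> H; rewrite /determinant.
apply: (@expansion_sum _ _ _ (fun (s : 'S_m) x =>
  (-1) ^+ s * \prod_i (\matrix_(i, j) F i j x) i (s i))) => s _.
apply: expansionM.
  by case: (odd_perm s); [exact: expansionN1 | exact: expansion1].
rewrite (_ : (fun x => _) = fun x => \prod_i F i (s i) x).
  by apply: (@expansion_prod _ _ (fun i => F i (s i))).
by apply/funext => x; apply: eq_bigr => i _; rewrite mxE.
Qed.

Lemma expansion_near f g a : has_expansion f a ->
  (\forall x \near (0 : 'rV[C]_n), f x = g x) -> has_expansion g a.
Proof.
move=> /expansion_sums_to [r [s Hf]] /near0P [t [t0 fg]].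
have [r0 _ _] := Hf.
have m0 : 0 < Num.min r t by rewrite lt_min r0.
have mr : Num.min r t <= r by rewrite ge_min lexx.
have mt : Num.min r t <= t by rewrite ge_min lexx orbT.
have [_ Ha Hx] := sums_to_shrink m0 mr (lexx s) Hf.
apply: (@sums_to_expansion _ _ (Num.min r t) s); split=> // x xr N.
by rewrite -fg; [exact: Hx | lra].
Qed.

Lemma expansion0_near f : has_expansion f 0 -> \forall x \near (0 : 'rV[C]_n), f x = 0.
Proof.
move=> /expansion_sums_to [r [s [r0 _ Hf]]]; apply/near0P; exists (r / 2).
split=> [|x /ltW xr]; first by rewrite divr_gt0.
apply: cabs_eq0; apply/eqP; rewrite eq_le cabs_ge0 andbT.
apply: (@le_half_pow _ _ s) => N; rewrite add0r; have := Hf x xr N.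
by rewrite /lsum big1 ?subr0 // => k _; rewrite fps0 mul0r.
Qed.

Lemma expansion_at0 f a : has_expansion f a -> f 0 = a 0.
Proof.
move=> /expansion_sums_to [r [s [r0 _ Hf]]].
have x0 : sup_norm (0 : 'rV[C]_n) <= r / 2.
  by apply: sup_norm_le => [|i]; rewrite ?mxE ?cabs0; lra.
have := Hf 0 x0 => {}Hf; apply/eqP; rewrite -subr_eq0; apply/eqP; apply: cabs_eq0.
apply/eqP; rewrite eq_le cabs_ge0 andbT; apply: (@le_half_pow _ _ s) => N; rewrite add0r.
apply: le_trans (Hf N); rewrite /lsum (bigD1 (to_box N 0)) //= to_boxK => [|i]; last by rewrite ffunE.
rewrite /monomial [X in _ * X]big1 => [|i _]; last by rewrite ffunE expr0.
rewrite mulr1 big1 ?addr0 // => k k0.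
have [i ki] : exists i, of_box k i != 0%N.
  apply: contrapT => /forallNP H; case/eqP: k0; apply: of_box_inj.
  rewrite to_boxK => [|i]; last by rewrite ffunE.
  by apply/ffunP => i; rewrite [RHS]ffunE; apply/eqP/negPn/negP; exact: H.
by rewrite (bigD1 i) //= mxE expr0n (negPf ki) mul0r mulr0.
Qed.
End PartialSums.
End Expansions.

(** * Differentiation of expansions *)

Section Derivatives.
Variables (R : realType) (n : nat).
Local Notation C := (cplx R).
Implicit Types (a : fps C n) (k l : multiindex n) (x h : 'rV[C]_n).

(** The partial derivative of a monomial.  The truncated subtraction is
    harmless because of the factor k i. *)
Definition dmono (i : 'I_n) x k : C :=
  (k i)%:R * monomial x [ffun j => k j - unit_index i j]%N.

Lemma monomial_unit x i : monomial x (unit_index i) = x 0 i.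
Proof.
rewrite /monomial (bigD1 i) //= ffunE eqxx expr1 big1 ?mulr1 // => j ji.
by rewrite ffunE (negPf ji) expr0.
Qed.
Lemma dmonoD i x k : dmono i x (k + unit_index i) = (k i).+1%:R * monomial x k.
Proof.
rewrite /dmono midxD ffunE eqxx addn1; congr (_ * monomial x _).
by apply/ffunP => j; rewrite ffunE midxD addnK.
Qed.
Lemma dmono0 i x k : k i = 0%N -> dmono i x k = 0.
Proof. by move=> ki; rewrite /dmono ki mul0r. Qed.

Lemma dmono_mulX i j x k : dmono j x (k + unit_index i) =
  x 0 i * dmono j x k + (j == i)%:R * monomial x k.
Proof.
have [->|ji] := eqVneq j i.
  rewrite dmonoD; case: (midx_unitP k i) => [ki|[l ->]].
    by rewrite dmono0 // ki !mul1r mulr0 add0r.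
  rewrite dmonoD monomialD monomial_unit midxD ffunE eqxx addn1.
  by rewrite -!natr1 /=; ring.
rewrite mul0r addr0; case: (midx_unitP k j) => [kj|[l ->]].
  by rewrite !dmono0 ?mulr0 // midxD kj ffunE (negPf ji).
rewrite addrAC !dmonoD monomialD monomial_unit midxD [unit_index i j]ffunE (negPf ji) addn0.
ring.
Qed.

Lemma natr_pow2 (e : nat) : (e%:R : R) <= 2 ^+ e.
Proof. by rewrite -natrX ler_nat ltnW // ltn_expl. Qed.

Lemma cabs_nat (e : nat) : cabs (e%:R : C) = e%:R.
Proof.
elim: e => [|e IH]; first by rewrite cabs0.
have h : cabs (e.+1%:R : C) = complex.Re `|(e.+1%:R : C)| by [].
by rewrite h normr_nat -[e.+1%:R]/(e.+1%:R : complex R) -(rmorph_nat (real_complex R)).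
Qed.

Lemma dmono_bound i x k eta : 0 < eta -> sup_norm x <= eta ->
  cabs (dmono i x k) <= (k i)%:R * (eta ^+ mdeg k / eta).
Proof.
move=> e0 xe; case: (midx_unitP k i) => [ki|[l ->]].
  by rewrite dmono0 // cabs0 ki mul0r.
rewrite dmonoD cabsM cabs_nat midxD ffunE eqxx addn1 mdegD mdeg_unit addn1.
rewrite exprSr mulfK ?gt_eqF // ler_wpM2l //.
by apply: cabs_monomial => j; apply: le_trans xe; exact: sup_norm_coef.
Qed.

Definition mono_rem x h k : C :=
  monomial (x + h) k - monomial x k - \sum_i h 0 i * dmono i x k.

(** Taylor's formula of order one for monomials, by induction on the degree:
    the remainder of x_i x^l is (x_i + h_i) times that of x^l plus h_i times
    the differential of x^l. *)
Lemma mono_rem_bound x h k eta : 0 < eta -> sup_norm x <= eta -> sup_norm h <= eta ->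
  cabs (mono_rem x h k) <= sup_norm h ^+ 2 * ((mdeg k)%:R * (2 * eta) ^+ mdeg k / eta ^+ 2).
Proof.
move=> e0 xe he; have [e] := ubnP (mdeg k); elim: e k => // e IH k ke.
have [/eqP k0|] := boolP (mdeg k == 0%N).
  rewrite k0 mul0r mul0r mulr0 (mdeg_eq0 k0) /mono_rem /monomial.
  rewrite !big1 ?subrr ?sub0r ?oppr0 ?cabs0 // => i _; rewrite ?ffunE ?expr0 //.
  by rewrite dmono0 ?mulr0 // ffunE.
rewrite -lt0n => kp.
have [i [l kl]] : exists i l, k = l + unit_index i.
  apply: contrapT => H; move: kp; rewrite lt0n => /eqP; case.
  rewrite /mdeg big1 // => i _; case: (midx_unitP k i) => // -[l kl].
  by case: H; exists i, l.
rewrite kl mdegD mdeg_unit addn1; set L := mdeg l.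
have le : (mdeg l < e)%N by move: ke; rewrite kl mdegD mdeg_unit; lia.
have hR : mono_rem x h (l + unit_index i) = (x 0 i + h 0 i) * mono_rem x h l +
   h 0 i * (\sum_j h 0 j * dmono j x l).
  have -> : \sum_j h 0 j * dmono j x l = monomial (x + h) l - monomial x l - mono_rem x h l.
    by rewrite /mono_rem opprB addrC subrK.
  rewrite {1}/mono_rem !monomialD !monomial_unit mxE.
  under eq_bigr do rewrite dmono_mulX mulrDr.
  rewrite big_split /= [X in _ - (_ + X)](bigD1 i) //= eqxx mul1r.
  rewrite [X in _ - (_ + (_ + X))]big1 => [|j ji]; last by rewrite (negPf ji) mul0r mulr0.
  have -> : \sum_j h 0 j * (x 0 i * dmono j x l) =
     x 0 i * (monomial (x + h) l - monomial x l - mono_rem x h l).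
    rewrite /mono_rem opprB addrC subrK mulr_sumr; apply: eq_bigr => j _; ring.
  by ring.
set d := sup_norm h; have d0 : 0 <= d by exact: sup_norm_ge0.
have hD : cabs (\sum_j h 0 j * dmono j x l) <= d * (L%:R * (eta ^+ L / eta)).
  apply: le_trans (cabs_sum _ _ _) _.
  have -> : L%:R = \sum_j (l j)%:R :> R by rewrite /L /mdeg natr_sum.
  rewrite mulr_suml mulr_sumr; apply: ler_sum => j _; rewrite cabsM.
  by apply: ler_pM; rewrite ?cabs_ge0 ?sup_norm_coef // dmono_bound.
rewrite hR; apply: le_trans (cabsD _ _) _; rewrite !cabsM.
have hxh : cabs (x 0 i + h 0 i) <= 2 * eta.
  apply: le_trans (cabsD _ _) _; rewrite mulr_natl mulr2n.
  by apply: lerD; [apply: le_trans xe | apply: le_trans he]; exact: sup_norm_coef.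
apply: (@le_trans _ _ (2 * eta * (d ^+ 2 * (L%:R * (2 * eta) ^+ L / eta ^+ 2)) +
   d * (d * (L%:R * (eta ^+ L / eta))))).
  apply: lerD; apply: ler_pM; rewrite ?cabs_ge0 ?sup_norm_coef //.
  exact: IH.
have -> : 2 * eta * (d ^+ 2 * (L%:R * (2 * eta) ^+ L / eta ^+ 2)) +
   d * (d * (L%:R * (eta ^+ L / eta))) =
   d ^+ 2 * (L%:R * (2 * eta) ^+ L.+1 / eta ^+ 2 + L%:R * eta ^+ L.+1 / eta ^+ 2).
  by rewrite !exprS; field; rewrite gt_eqF.
rewrite ler_wpM2l ?exprn_ge0 // -mulrDl ler_wpM2r ?invr_ge0 ?exprn_ge0 // ?(ltW e0) //.
have -> : L.+1%:R * (2 * eta) ^+ L.+1 = L%:R * (2 * eta) ^+ L.+1 + (2 * eta) ^+ L.+1.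
  by rewrite -natr1; ring.
rewrite lerD2l exprMn ler_wpM2r ?exprn_ge0 ?(ltW e0) //.
apply: le_trans (natr_pow2 L) _; rewrite exprS.
have : (0 : R) <= 2 ^+ L by rewrite exprn_ge0.
lra.
Qed.

Lemma wnorm_le_deriv a r s i : 0 < r -> wnorm_le r s a -> wnorm_le (r / 2) (2 / r * s) (fps_deriv i a).
Proof.
move=> r0 Ha N.
have Hs := wnorm_le_shift (unit_index i) r0 Ha; rewrite mdeg_unit expr1 in Hs.
have s0 := wnorm_le_ge0 (ltW r0) Ha.
have -> : 2 / r * s = 2 * (s / r) by ring.
apply: (le_trans _ (ler_wpM2l _ (Hs N))) => //.
rewrite /wsum mulr_sumr; apply: ler_sum => m _.
rewrite /fps_deriv -[_ *+ (_ i).+1]mulr_natl cabsM cabs_nat expr_div_n.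
set M := mdeg _; set c := cabs _.
have c0 : 0 <= c * r ^+ M by rewrite mulr_ge0 ?cabs_ge0 // exprn_ge0 // ltW.
have -> : ((of_box m i).+1)%:R * c * (r ^+ M / 2 ^+ M) =
   (c * r ^+ M) * ((of_box m i).+1%:R / 2 ^+ M) by ring.
rewrite mulrC; apply: ler_wpM2r => //.
rewrite ler_pdivrMr ?exprn_gt0 // -exprS.
apply: le_trans (natr_pow2 _) _.
by rewrite ler_weXn2l ?ler1n // ltnS; exact: le_mdeg.
Qed.

(** The termwise derivative of a box of monomials is not a box of the derived
    series; the two differ by terms of degree at least N. *)
Lemma deriv_lsum a r s i x N : 0 < r -> wnorm_le r s a -> sup_norm x <= r / 4 ->
  cabs (lsum a (dmono i x) N.+1 - lsum (fps_deriv i a) (monomial x) N) <=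
    4 / r * s / 2 ^+ N.
Proof.
move=> r0 Ha xr; pose P0 (k : box n N.+1) := [exists m : box n N, of_box k == of_box m + unit_index i].
have r40 : 0 < r / 4 by rewrite divr_gt0.
have le1 (m : box n N) (j : 'I_n) : ((of_box m + unit_index i)%R j <= N.+1)%N.
  by rewrite midxD -addn1 leq_add ?of_box_le // ffunE leq_b1.
have key m := to_boxK (le1 m).
pose minus_unit (k : multiindex n) : multiindex n := [ffun j => k j - unit_index i j]%N.
have minusK (m : box n N) : minus_unit (of_box m + unit_index i) = of_box m.
  by apply/ffunP => j; rewrite ffunE midxD addnK.
rewrite /lsum (bigID P0) /=.
have -> : \sum_(k : box n N.+1 | P0 k) a (of_box k) * dmono i x (of_box k) =
   \sum_(m : box n N) fps_deriv i a (of_box m) * monomial x (of_box m).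
  rewrite (reindex_onto (fun m : box n N => to_box N.+1 (of_box m + unit_index i))
    (fun k : box n N.+1 => to_box N (minus_unit (of_box k)))) /=; last first.
    move=> k /existsP[m /eqP e]; rewrite e minusK of_boxK.
    by apply: of_box_inj; rewrite key.
  apply: eq_big => [m|m _]; last first.
    by rewrite key dmonoD /fps_deriv -mulr_natr; ring.
  rewrite key minusK of_boxK eqxx andbT.
  by apply/existsP; exists m; rewrite key.
rewrite addrAC subrr add0r; apply: le_trans (cabs_sum _ _ _) _.
rewrite (bigID (fun k : box n N.+1 => of_box k i == 0%N)) /= big1 ?add0r; last first.
  by move=> k /andP[_ /eqP ki]; rewrite dmono0 // mulr0 cabs0.
under eq_bigr do rewrite cabsM.
have r41 : 0 <= 4 / r by rewrite divr_ge0 // ltW.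
apply: (tail_bound (h := @of_box n N.+1) r0 Ha r41) => [k|k l _ _|k].
- apply: le_trans (dmono_bound i k r40 xr) _.
  have -> : (k i)%:R * ((r / 4) ^+ mdeg k / (r / 4)) = 4 / r * ((k i)%:R * (r / 4) ^+ mdeg k).
    by field; rewrite gt_eqF.
  rewrite ler_wpM2l //.
  have -> : r / 2 = 2 * (r / 4) by field.
  rewrite [leRHS]exprMn ler_wpM2r ?exprn_ge0 ?(ltW r40) //.
  apply: le_trans (natr_pow2 _) _.
  by rewrite ler_weXn2l ?ler1n //; exact: le_mdeg.
- exact: of_box_inj.
move=> /andP[nP ki]; apply: ltnW; apply: contraNT nP; rewrite -leqNgt => kN.
case: (midx_unitP (of_box k) i) => [e|[l e]]; first by rewrite e in ki.
apply/existsP; exists (to_box N l); rewrite to_boxK ?e // => j.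
by apply: leq_trans (le_mdeg l j) _; move: kN; rewrite e mdegD mdeg_unit; lia.
Qed.

(** The bound on the remainder is summed over the monomials with the weighted
    norm of a, then the truncation is removed. *)
Lemma expansion_taylor1 (f : 'rV[C]_n -> C) a : has_expansion f a ->
  exists g : 'I_n -> 'rV[C]_n -> C, (forall i, has_expansion (g i) (fps_deriv i a)) /\
  exists eta A : R, 0 < eta /\ forall x h, sup_norm x <= eta -> sup_norm h <= eta ->
    cabs (f (x + h) - f x - \sum_i h 0 i * g i x) <= A * sup_norm h ^+ 2.
Proof.
move=> /expansion_sums_to [r [s [r0 Ha Hf]]].
have r20 : 0 < r / 2 by rewrite divr_gt0.
have s0 := wnorm_le_ge0 (ltW r0) Ha.
have Hg i := sums_to_exists r20 (wnorm_le_deriv i r0 Ha).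
have [g {}Hg] := choice Hg.
exists g; split=> [i|]; first exact: sums_to_expansion (Hg i).
(* x + h stays where f is controlled, and 4 eta = r absorbs the factor |k| of
   the bound on the remainder of x^k *)
pose eta := r / 4; have e0 : 0 < eta by rewrite divr_gt0.
exists eta, (s / eta ^+ 2); split=> // x h xe he.
have xr : sup_norm x <= r / 2 by move: xe; rewrite /eta; lra.
have xhr : sup_norm (x + h) <= r / 2.
  rewrite -rC_le -sup_normE; apply: le_trans (ler_normD _ _) _; rewrite !sup_normE.
  have -> : rC (sup_norm x) + rC (sup_norm h) = rC (sup_norm x + sup_norm h) :> C by rewrite /rC rmorphD.
  by rewrite rC_le; move: xe he; rewrite /eta; lra.
pose B : R := \sum_(i < n) (cabs (h 0 i) * (4 / r * s + 2 * (2 / r * s))).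
apply: (@le_half_pow _ _ _ (s + s + B)) => N.
pose Q i := lsum a (dmono i x) N.+1.
have -> : f (x + h) - f x - \sum_i h 0 i * g i x =
   (f (x + h) - lsum a (monomial (x + h)) N.+1) - (f x - lsum a (monomial x) N.+1)
   - \sum_i h 0 i * (g i x - Q i) + lsum a (mono_rem x h) N.+1.
  have -> : lsum a (mono_rem x h) N.+1 = lsum a (monomial (x + h)) N.+1 -
     lsum a (monomial x) N.+1 - \sum_i h 0 i * Q i.
    rewrite /Q /lsum.
    under [X in _ - _ - X]eq_bigr do rewrite mulr_sumr.
    rewrite exchange_big /= -!sumrB; apply: eq_bigr => k _.
    rewrite /mono_rem !mulrBr mulr_sumr; congr (_ - _); apply: eq_bigr => i _; ring.
  under [X in _ = _ - X + _]eq_bigr do rewrite mulrBr.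
  rewrite sumrB; ring.
have half : 2^-1 * (2 ^+ N)^-1 <= (2 ^+ N)^-1 :> R.
  have : 0 <= (2 ^+ N)^-1 :> R by rewrite invr_ge0 exprn_ge0.
  lra.
have sN : s / 2 ^+ N.+1 <= s / 2 ^+ N.
  by rewrite ler_wpM2l // exprS invfM.
rewrite [leRHS]addrC; apply: le_trans (cabsD _ _) _; apply: lerD; last first.
  apply: le_trans (cabs_sum _ _ _) _; under eq_bigr do rewrite cabsM.
  have -> : s / eta ^+ 2 * sup_norm h ^+ 2 = sup_norm h ^+ 2 / eta ^+ 2 * s by ring.
  apply: (le_trans _ (ler_wpM2l _ (Ha N.+1))); last first.
    by rewrite divr_ge0 ?exprn_ge0 ?sup_norm_ge0 // ltW.
  rewrite /wsum mulr_sumr; apply: ler_sum => k _.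
  rewrite mulrCA ler_wpM2l ?cabs_ge0 //.
  apply: le_trans (mono_rem_bound (of_box k) e0 xe he) _.
  rewrite -[leRHS]mulrA ler_wpM2l ?exprn_ge0 ?sup_norm_ge0 //.
  rewrite [leRHS]mulrC ler_wpM2r ?invr_ge0 ?exprn_ge0 ?(ltW e0) //.
  have -> : r = 2 * (2 * eta) by rewrite /eta; field.
  rewrite [leRHS]exprMn; apply: ler_wpM2r; last exact: natr_pow2.
  by apply: exprn_ge0; lra.
apply: le_trans (cabsD _ _) _; rewrite cabsN mulrDl; apply: lerD.
  apply: le_trans (cabsD _ _) _; rewrite cabsN mulrDl; apply: lerD; apply: le_trans sN.
    exact: Hf.
  exact: Hf.
apply: le_trans (cabs_sum _ _ _) _; rewrite /B mulr_suml; apply: ler_sum => i _.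
rewrite cabsM -mulrA ler_wpM2l ?cabs_ge0 //.
rewrite -(subrKA (lsum (fps_deriv i a) (monomial x) N)) mulrDl [leRHS]addrC.
apply: le_trans (cabsD _ _) _; apply: lerD.
  have [_ _ Hgx] := Hg i; apply: Hgx; move: xe; rewrite /eta; lra.
by rewrite -cabsN opprB; exact: deriv_lsum.
Qed.
End Derivatives.

(** * Differentials, Jacobian matrices and the identity theorem *)

Lemma diff_quadratic (K : numFieldType) (V W : normedModType K) (f df : V -> W)
    (x : V) (eta A B : K) :
  linear df -> 0 < eta -> 0 <= A -> 0 <= B ->
  (forall h, `|df h| <= B * `|h|) ->
  (forall h, `|h| < eta -> `|f (x + h) - f x - df h| <= A * `|h| ^+ 2) ->
  'd f x = df :> (V -> W).
Proof.
move=> lin e0 A0 B0 HB HA.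
pose dfM := GRing.isLinear.Build _ _ _ _ _ lin.
pose dfL : {linear V -> W} := HB.pack df dfM.
have -> : df = dfL by [].
apply: diff_unique.
  move=> h; apply/cvgrPdist_lt => e ee.
  have B1 : 0 < B + 1 by rewrite ltr_wpDl.
  have : \forall t \near h, `|h - t| < e / (B + 1).
    by apply: cvgr_dist_lt; [exact: cvg_id | rewrite divr_gt0].
  apply: filterS => t ht; rewrite -linearB; apply: le_lt_trans (HB _) _.
  move: ht; rewrite ltr_pdivlMr // mulrC; apply: le_lt_trans.
  by rewrite ler_wpM2r // lerDl.
apply/eqaddoP => e e0'.
have A1 : 0 < A + 1 by rewrite ltr_wpDl.
have h1 : \forall h \near (0 : V), `|h| < eta by exact: nbhs0_lt.
have h2 : \forall h \near (0 : V), `|h| < e / (A + 1).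
  by apply: nbhs0_lt; rewrite divr_gt0.
near=> h; rewrite /= !fctE /=.
have hh1 : `|h| < eta by near: h.
have hh2 : `|h| < e / (A + 1) by near: h.
rewrite opprD addrA [h + x]addrC; apply: le_trans (HA h hh1) _.
rewrite expr2 mulrA ler_wpM2r //.
apply: (@le_trans _ _ ((A + 1) * `|h|)); first by rewrite ler_wpM2r // lerDl.
by rewrite mulrC -ler_pdivlMr // ltW.
Unshelve. all: by end_near.
Qed.

Section ExpansionDifferential.
Variables (R : realType) (n : nat).
Local Notation C := (cplx R).
Implicit Types (a : fps C n) (x h : 'rV[C]_n).

Lemma rC_ge0 (t : R) : 0 <= t -> 0 <= rC t. Proof. by move=> t0; rewrite -[0]/(rC 0) rC_le. Qed.
Lemma rC_gt0 (t : R) : 0 < t -> 0 < rC t. Proof. by move=> t0; rewrite -[0]/(rC 0) rC_lt. Qed.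

(** The same constants serve all the components, as Jacobian matrices of maps
    require. *)
Lemma expansion_jet m (F : 'I_m -> 'rV[C]_n -> C) (A : 'I_m -> fps C n) :
  (forall k, has_expansion (F k) (A k)) ->
  exists g : 'I_n -> 'I_m -> 'rV[C]_n -> C,
    (forall i k, has_expansion (g i k) (fps_deriv i (A k))) /\
    exists eta : R, 0 < eta /\ forall x, sup_norm x <= eta ->
      exists B : R, 0 <= B /\
      (forall h k, cabs (\sum_i h 0 i * g i k x) <= B * sup_norm h) /\
      exists A : R, 0 <= A /\ forall h k, sup_norm h <= eta ->
        cabs (F k (x + h) - F k x - \sum_i h 0 i * g i k x) <= A * sup_norm h ^+ 2.
Proof.
move=> H; have [g Hg] := choice (fun k => expansion_taylor1 (H k)).
exists (fun i k => g k i); split=> [i k|]; first exact: (Hg k).1.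
have [eta He] := choice (fun k => (Hg k).2).
have [D HD] := choice He.
pose e := (1 + \sum_k (eta k)^-1)^-1.
have ek k : 0 < eta k := (HD k).1.
have s0 : 0 <= \sum_k (eta k)^-1 by apply: sumr_ge0 => k _; rewrite invr_ge0 ltW.
have e0 : 0 < e by rewrite invr_gt0; lra.
have ee k : e <= eta k.
  rewrite -[eta k]invrK lef_pV2 ?posrE ?invr_gt0 //; last by lra.
  rewrite (bigD1 k) //= addrCA lerDl addr_ge0 //; apply: sumr_ge0 => k' _.
  by rewrite invr_ge0 ltW.
exists e; split=> // x xe.
exists (\sum_k \sum_i cabs (g k i x)); split.
  by apply: sumr_ge0 => k _; apply: sumr_ge0 => i _; exact: cabs_ge0.
split.
  move=> h k; apply: le_trans (cabs_sum _ _ _) _.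
  apply: (@le_trans _ _ ((\sum_i cabs (g k i x)) * sup_norm h)).
    rewrite mulr_suml; apply: ler_sum => i _; rewrite cabsM mulrC.
    by rewrite ler_wpM2l ?cabs_ge0 // sup_norm_coef.
  rewrite ler_wpM2r ?sup_norm_ge0 // (bigD1 k) //= lerDl; apply: sumr_ge0 => k' _.
  by apply: sumr_ge0 => i _; exact: cabs_ge0.
exists (\sum_k `|D k|); split; first by apply: sumr_ge0.
move=> h k he; apply: le_trans ((HD k).2 x h _ _) _.
- exact: le_trans (ee k).
- exact: le_trans (ee k).
rewrite ler_wpM2r ?exprn_ge0 ?sup_norm_ge0 // (bigD1 k) //=.
by apply: le_trans (ler_norm _) _; rewrite lerDl; apply: sumr_ge0.
Qed.

Lemma expansion_diff (f : 'rV[C]_n -> C) a : has_expansion f a ->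
  exists g : 'I_n -> 'rV[C]_n -> C, (forall i, has_expansion (g i) (fps_deriv i a)) /\
  \forall x \near (0 : 'rV[C]_n), forall h, 'd f x h = \sum_i h 0 i * g i x.
Proof.
move=> Hf; have [|g [Hg [eta [e0 He]]]] := @expansion_jet 1 (fun=> f) (fun=> a).
  by [].
exists (fun i => g i 0); split=> [i|]; first exact: Hg.
apply/near0P; exists eta; split=> // x /ltW xe h.
have [B [B0 [HB [A [A0 HA]]]]] := He x xe.
rewrite (@diff_quadratic C 'rV[C]_n C f (fun h => \sum_i h 0 i * g i 0 x) x (rC eta) (rC A) (rC B)) //.
- move=> c u v; rewrite /= scaler_sumr -big_split; apply: eq_bigr => i _ /=.
  by rewrite !mxE mulrDl -mulrA.
- exact: rC_gt0.
- exact: rC_ge0.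
- exact: rC_ge0.
- by move=> k; rewrite sup_normE -rCM cabs_le; exact: HB.
move=> k; rewrite sup_normE rC_lt => /ltW ke; rewrite -rCX -rCM cabs_le; exact: HA.
Qed.

Lemma expansion_jacobian m (F : 'rV[C]_n -> 'rV[C]_m) (A : 'I_m -> fps C n) :
  (forall k, has_expansion (fun x => F x 0 k) (A k)) ->
  exists g : 'I_n -> 'I_m -> 'rV[C]_n -> C,
    (forall i k, has_expansion (g i k) (fps_deriv i (A k))) /\
    \forall x \near (0 : 'rV[C]_n), 'J F x = \matrix_(i, k) g i k x.
Proof.
move=> HF; have [g [Hg [eta [e0 He]]]] := expansion_jet HF.
exists g; split=> //; apply/near0P; exists eta; split=> // x /ltW xe.
have [B [B0 [HB [A' [A0 HA]]]]] := He x xe.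
pose df (h : 'rV[C]_n) : 'rV[C]_m := \row_k \sum_i h 0 i * g i k x.
rewrite /jacobian (_ : ('d F x : _ -> _) = df).
  apply/matrixP => i k; rewrite !mxE (bigD1 i) //= mxE !eqxx mul1r big1 ?addr0 //.
  by move=> j ji; rewrite mxE (negPf ji) andbF mul0r.
apply: (@diff_quadratic C 'rV[C]_n 'rV[C]_m F df x (rC eta) (rC A') (rC B)) => //.
- move=> c u v; apply/rowP => k; rewrite !mxE mulr_sumr -big_split.
  by apply: eq_bigr => i _ /=; rewrite !mxE mulrDl -mulrA.
- exact: rC_gt0.
- exact: rC_ge0.
- exact: rC_ge0.
- move=> h; rewrite !sup_normE -rCM rC_le; apply: sup_norm_le => [|k].
    by rewrite mulr_ge0 ?sup_norm_ge0.
  by rewrite mxE.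
move=> h; rewrite !sup_normE rC_lt => /ltW he; rewrite -rCX -rCM rC_le.
apply: sup_norm_le => [|k]; first by rewrite mulr_ge0 ?exprn_ge0 ?sup_norm_ge0.
by rewrite !mxE; exact: HA.
Qed.

(** If f vanishes near 0, so do the sums of its derived series, by comparing
    the first-order term of the Taylor formula with the quadratic remainder;
    the coefficients are then reached by induction on the degree. *)
Lemma expansion_eq0 (f : 'rV[C]_n -> C) a : has_expansion f a ->
  (\forall x \near (0 : 'rV[C]_n), f x = 0) -> a = 0.
Proof.
move=> Hf f0; apply/funext => k; rewrite fps0.
have [e] := ubnP (mdeg k); elim: e k f a Hf f0 => // e IH k f a Hf f0 ke.
have {f0}Hf : has_expansion (fun _ : 'rV[C]_n => 0) a := expansion_near Hf f0.
have [/eqP k0|kp] := boolP (mdeg k == 0%N).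
  by rewrite (mdeg_eq0 k0) -(expansion_at0 Hf).
have [i [l kl]] : exists i l, k = l + unit_index i.
  apply: contrapT => H; case/eqP: kp.
  rewrite /mdeg big1 // => i _; case: (midx_unitP k i) => // -[l kl].
  by case: H; exists i, l.
have [g [Hg [eta [A [e0 HA]]]]] := expansion_taylor1 Hf.
have g0 : \forall x \near (0 : 'rV[C]_n), g i x = 0.
  apply/near0P; exists eta; split=> // x /ltW xe.
  apply: cabs_eq0; apply/eqP; rewrite eq_le cabs_ge0 andbT.
  apply: (@le_half_pow _ _ _ (`|A| * eta)) => N; rewrite add0r.
  pose t := eta / 2 ^+ N; have t0 : 0 < t by rewrite divr_gt0 ?exprn_gt0.
  have te : t <= eta.
    by rewrite ler_pdivrMr ?exprn_gt0 // ler_peMr ?(ltW e0) // exprn_ege1 // ler1n.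
  pose h : 'rV[C]_n := rC t *: delta_mx 0 i.
  have nct : cabs (rC t) = t by rewrite /cabs /= expr0n addr0 sqrtr_sqr ger0_norm // ltW.
  have hi j : h 0 j = (j == i)%:R * rC t by rewrite !mxE eqxx /= mulrC.
  have ht : sup_norm h <= t.
    apply: sup_norm_le => [|j]; first exact: ltW.
    by rewrite hi cabsM nct; case: eqP => _; rewrite ?cabs1 ?cabs0 ?mul1r ?mul0r // ltW.
  have := HA x h xe (le_trans ht te); rewrite subrr sub0r cabsN.
  rewrite (bigD1 i) //= big1 => [|j ji]; last by rewrite hi (negPf ji) !mul0r.
  rewrite addr0 hi eqxx mul1r cabsM nct => hh.
  rewrite -mulrA -/t -(ler_pM2l t0); apply: le_trans hh _.
  rewrite [leRHS]mulrCA -expr2.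
  apply: (@le_trans _ _ (`|A| * sup_norm h ^+ 2)).
    by rewrite ler_wpM2r ?exprn_ge0 ?sup_norm_ge0 // ler_norm.
  by rewrite ler_wpM2l // lerXn2r ?nnegrE ?sup_norm_ge0 // ltW.
have := IH l _ _ (Hg i) g0; rewrite /fps_deriv -kl => H.
have le : (mdeg l < e)%N by move: ke; rewrite kl mdegD mdeg_unit; lia.
by move: (H le) => /eqP; rewrite mulrn_eq0 /= => /eqP.
Qed.
End ExpansionDifferential.

(** * The ring of convergent series *)

Section ConvergentSeries.
Variables (R : realType) (n : nat).
Local Notation C := (cplx R).
Implicit Types (f g : fps C n).

Definition convergent f := exists r s, 0 < r /\ wnorm_le r s f.

Lemma wnorm_le_radius r r' s f : 0 <= r' <= r -> wnorm_le r s f -> wnorm_le r' s f.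
Proof.
move=> /andP[r0 rr] Hf N; apply: le_trans (Hf N); apply: ler_sum => k _.
apply: ler_wpM2l; first exact: cabs_ge0.
by apply: lerXn2r; rewrite ?nnegrE // (le_trans r0).
Qed.

Lemma convergent_common m (F : 'I_m -> fps C n) : (forall i, convergent (F i)) ->
  exists r s, 0 < r /\ forall i, wnorm_le r s (F i).
Proof.
move=> H; have [r Hr] := choice H; have [s Hs] := choice Hr.
have r0 i := (Hs i).1.
have S0 : 0 <= \sum_i (r i)^-1 by apply: sumr_ge0 => i _; rewrite invr_ge0 ltW.
exists (1 + \sum_i (r i)^-1)^-1, (\sum_i s i); split=> [|i]; first by rewrite invr_gt0; lra.
apply: (@wnorm_le_le _ _ _ (s i)).
  rewrite (bigD1 i) //= lerDl; apply: sumr_ge0 => j _.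
  exact: (wnorm_le_ge0 (ltW (r0 j)) (Hs j).2).
apply: wnorm_le_radius (Hs i).2; apply/andP; split; first by rewrite invr_ge0; lra.
rewrite -[r i]invrK lef_pV2 ?posrE ?invr_gt0 //; last by lra.
rewrite (bigD1 i) //= addrCA lerDl addr_ge0 //; apply: sumr_ge0 => j _.
by rewrite invr_ge0 ltW.
Qed.

Lemma convergentD f g : convergent f -> convergent g -> convergent (f + g).
Proof.
move=> [r [s [r0 Hf]]] [r' [s' [r0' Hg]]].
have m0 : 0 < Num.min r r' by rewrite lt_min r0.
exists (Num.min r r'), (s + s'); split=> //; apply: wnorm_leD; rewrite ?ltW //.
  by apply: wnorm_le_radius Hf; rewrite ltW //= ge_min lexx.
by apply: wnorm_le_radius Hg; rewrite ltW //= ge_min lexx orbT.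
Qed.
Lemma convergentN f : convergent f -> convergent (- f).
Proof. by move=> [r [s [r0 Hf]]]; exists r, s; split=> //; apply: wnorm_leN => //; exact: ltW. Qed.
Lemma convergentB f g : convergent f -> convergent g -> convergent (f - g).
Proof. by move=> Hf Hg; apply: convergentD => //; exact: convergentN. Qed.
Lemma convergentM f g : convergent f -> convergent g -> convergent (f * g).
Proof.
move=> [r [s [r0 Hf]]] [r' [s' [r0' Hg]]].
have m0 : 0 < Num.min r r' by rewrite lt_min r0.
exists (Num.min r r'), (s * s'); split=> //; apply: wnorm_leM; rewrite ?ltW //.
  by apply: wnorm_le_radius Hf; rewrite ltW //= ge_min lexx.
by apply: wnorm_le_radius Hg; rewrite ltW //= ge_min lexx orbT.
Qed.
Lemma convergent_fmon c k : convergent (fmon c k).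
Proof. by exists 1, (cabs c * 1 ^+ mdeg k); split=> //; exact: wnorm_le_fmon. Qed.
Lemma convergent_sum I (q : seq I) (P : pred I) (F : I -> fps C n) :
  (forall i, P i -> convergent (F i)) -> convergent (\sum_(i <- q | P i) F i).
Proof.
move=> H; apply: (big_ind convergent) => //; last exact: convergentD.
by rewrite -(fmon0 _ 0); exact: convergent_fmon.
Qed.
(** Phi vanishes at 0, so its norm at a small radius is below the radius of
    convergence of f. *)
Lemma convergent_comp f (Phi : 'I_n -> fps C n) : vanish0 Phi ->
  convergent f -> (forall i, convergent (Phi i)) -> convergent (fcomp f Phi).
Proof.
move=> P1 [rho [M [rho0 Hf]]] /convergent_common [r [s [r0 HP]]].
pose s1 := Num.max s 1; have s10 : 0 < s1 by rewrite lt_max ltr01 orbT.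
have {}HP i : wnorm_le r s1 (Phi i) by apply: wnorm_le_le (HP i); rewrite le_max lexx.
pose t := Num.min 1 (rho / s1).
have t0 : 0 < t by rewrite lt_min ltr01 divr_gt0.
have t1 : t <= 1 by rewrite ge_min lexx.
exists (t * r), M; split; first by rewrite mulr_gt0.
apply: (@wnorm_le_comp R n (t * r) rho) => // [|i]; first by rewrite mulr_ge0 // ltW.
apply: (@wnorm_le_le _ _ _ (t ^+ 1 * s1)).
  by rewrite expr1 -ler_pdivlMr // ge_min lexx orbT.
by apply: wnorm_le_shrink => //; rewrite ?(ltW r0) // (ltW t0) t1.
Qed.

Lemma expansion_convergent (h : 'rV[C]_n -> C) f : has_expansion h f -> convergent f.
Proof. by move=> /expansion_sums_to [r [s [r0 Hf _]]]; exists r, s. Qed.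
Lemma convergent_expansion f : convergent f -> exists h : 'rV[C]_n -> C, has_expansion h f.
Proof.
move=> [r [s [r0 Hf]]]; have [h Hh] := sums_to_exists r0 Hf.
by exists h; exact: sums_to_expansion Hh.
Qed.
End ConvergentSeries.

(** * Transport of vector fields *)

Section Transport.
Variables (K : comNzRingType) (n : nat).
Implicit Types (X Z Phi : 'I_n -> fps K n) (F : fps K n).

(** By the chain rule a field acts on F o Phi as the field related to it acts
    on F; in particular first integrals are transported. *)
Lemma related_derivation X Z Phi F : vanish0 Phi ->
  (forall l, \sum_i Z i * fps_deriv i (Phi l) = fcomp (X l) Phi) ->
  \sum_i Z i * fps_deriv i (fcomp F Phi) = fcomp (\sum_l X l * fps_deriv l F) Phi.
Proof.
move=> P1 H; under eq_bigr do rewrite fcomp_chain // mulr_sumr.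
rewrite exchange_big fcomp_sum; apply: eq_bigr => l _ /=.
rewrite fcompM // -H mulr_suml; apply: eq_bigr => i _; ring.
Qed.

Lemma fcomp_at0 Phi F : vanish0 Phi -> fcomp F Phi 0 = F 0.
Proof.
move=> P1; rewrite -[F in LHS](subrK (fmon (F 0) 0)) fcompD fcomp_const // fpsD.
rewrite {2}/fmon eqxx (@fcomp_ord _ _ Phi 1) ?add0r ?mdeg0 // => m.
by rewrite ltnS leqn0 => /eqP /mdeg_eq0 ->; rewrite fpsB /fmon eqxx subrr.
Qed.

Definition linear_map (P : 'M[K]_n) k : fps K n := \sum_i fmon (P i k) (unit_index i).

Lemma linear_map_vanish0 P : vanish0 (linear_map P).
Proof.
by move=> k; apply: ordge_sum => i _; rewrite -(mdeg_unit i); exact: ordge_fmon.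
Qed.
Lemma fmonE c (k : multiindex n) : fmon c k = fmon c 0 * fmon 1 k :> fps K n.
Proof. by rewrite fmonM mulr1 add0r. Qed.
Lemma fderiv_linear_map P i k : fps_deriv i (linear_map P k) = fmon (P i k) 0.
Proof.
rewrite fderiv_sum (bigD1 i) //= fmonE fderivM fderiv_fmon0 mul0r add0r.
rewrite -/(fvar K i) fderiv_var eqxx mulr1 big1 ?addr0 // => j ji.
by rewrite fmonE fderivM fderiv_fmon0 -/(fvar K j) fderiv_var eq_sym (negPf ji) mul0r mulr0 addr0.
Qed.
Lemma fcomp_linear_map P Phi k : vanish0 Phi ->
  fcomp (linear_map P k) Phi = \sum_i fmon (P i k) 0 * Phi i.
Proof.
move=> P1; rewrite fcomp_sum; apply: eq_bigr => i _.
by rewrite fcomp_fmon // fmpow_unit.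
Qed.
Lemma linear_mapM P Q k : fcomp (linear_map P k) (linear_map Q) = linear_map (Q *m P) k.
Proof.
rewrite fcomp_linear_map; last exact: linear_map_vanish0.
rewrite /linear_map; under eq_bigr do rewrite mulr_sumr.
rewrite exchange_big; apply: eq_bigr => i _ /=; rewrite mxE.
rewrite (big_morph (fun c => fmon c (unit_index i)) (fun c d => fmonD c d _) (fmon0 _ _)).
by apply: eq_bigr => j _; rewrite fmonM add0r mulrC.
Qed.
Lemma linear_map1 k : linear_map 1%:M k = fvar K k.
Proof.
rewrite /linear_map (bigD1 k) //= mxE eqxx big1 ?addr0 // => i ik.
by rewrite mxE (negPf ik) fmon0.
Qed.
Lemma fcomp_linear_inv P Q F : Q *m P = 1%:M ->
  fcomp (fcomp F (linear_map P)) (linear_map Q) = F.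
Proof.
move=> QP; rewrite fcompA; try exact: linear_map_vanish0.
rewrite -[RHS]fcomp_id; congr fcomp; apply/funext => k.
by rewrite linear_mapM QP linear_map1.
Qed.
End Transport.

(** * First integrals of a field with diagonal linear part *)

Section DiagonalCase.
Variables (R : realType) (p : nat).
Local Notation n := p.+1.
Local Notation C := (cplx R).
Variables (lam : 'I_n -> C) (j0 : 'I_n) (f : 'I_n -> fps C n) (u : C).
Hypothesis f2 : forall i, ordge 2 (f i).
Hypothesis fconv : forall i, convergent (f i).
Hypothesis im_pos : 0 < 'Im (lam j0 / u).
Hypothesis im_neg : forall i, i != j0 -> 'Im (lam i / u) < 0.
Let X i := fmon (lam i) (unit_index i) + f i.
Variable F : 'I_n.-1 -> fps C n.
Hypothesis F_integral : forall k, \sum_i X i * fps_deriv i (F k) = 0.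
Hypothesis F_wedge : exists j, formal_wedge F j <> 0.

Let lam0 : lam j0 != 0 := star_neq0 im_pos im_neg j0.
Let star q : weight lam q = lam j0 -> (0 < q j0)%N := @star_weight _ _ _ _ _ im_pos im_neg q.
Let rank1 := @weights_rank1 _ _ lam j0 f lam0 f2 F F_integral F_wedge.

(** Complete integrability enters twice: it kills the obstruction to formal
    linearization, and through the rank of the resonances it excludes small
    divisors. *)
Lemma convergent_linearization : exists (Phi Psi : 'I_n -> fps C n) (v : fps C n),
  [/\ vanish0 Phi, (forall i, ordge 2 (Psi i - fvar C i)), ordge 1 v,
      (forall i, convergent (Psi i)) &
      (forall i, fcomp (Phi i) Psi = fvar C i) /\
      forall i, \sum_l fmon (lam l) (unit_index l) * fps_deriv l (Phi i) =
         (1 + v) * fcomp (X i) Phi].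
Proof.
have [W [linW eqW]] := formal_linearization lam0 f2 star F_integral F_wedge.
have [c [c0 gap]] := weight_gap im_pos im_neg rank1.
have [rho [M [rho0 fM]]] := convergent_common fconv.
pose delta := Num.min (cabs c) 1.
have delta01 : 0 < delta <= 1.
  by rewrite lt_min ltr01 cabs_gt0 //= ge_min lexx orbT.
have gap' i q : weight lam q != lam i -> delta <= cabs (weight lam q - lam i).
  by move=> /gap; rewrite !normCE rC_le; apply: le_trans; rewrite ge_min lexx.
have [r [s [r0 HPhi]]] := lin_op_convergent lam0 f2 rho0 fM delta01 gap' linW.
have phiC i : convergent (nonres_part lam W i).
  have -> : nonres_part lam W i = nf_map lam W i - fvar C i by rewrite /nf_map addrC addKr.
  by apply: convergentB; [exists r, s | exact: convergent_fmon].
have [rho' [M' [rho0' phiM]]] := convergent_common phiC.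
have [Psi [r' [s' [P2 PhiPsi r0' HPsi]]]] :=
  inverse_map (fun i => @ordge_nonres _ _ lam W i) rho0' phiM.
exists (nf_map lam W), Psi, (unit_part lam j0 W); split=> //.
- exact: vanish0_nf_map.
- exact: ordge_unit.
by move=> i; exists r', s'.
Qed.

Lemma tangent_vanish0 (Psi : 'I_n -> fps C n) :
  (forall i, ordge 2 (Psi i - fvar C i)) -> vanish0 Psi.
Proof.
move=> P2 i; rewrite -(subrK (fvar C i) (Psi i)); apply: ordgeD; last exact: ordge_fvar.
by apply: (@ordge_le _ _ 2).
Qed.

(** The equation satisfied by Phi says that Phi carries S to (1 + v) X.  The
    Jacobian matrix of Psi inverts that of Phi, so Psi carries a unit multiple
    of X to S, and the unit can be cancelled. *)
Lemma linear_integral Phi Psi v (M : fps C n) : vanish0 Phi ->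
  (forall i, ordge 2 (Psi i - fvar C i)) -> ordge 1 v ->
  (forall i, fcomp (Phi i) Psi = fvar C i) ->
  (forall i, \sum_l fmon (lam l) (unit_index l) * fps_deriv l (Phi i) =
         (1 + v) * fcomp (X i) Phi) ->
  \sum_l fmon (lam l) (unit_index l) * fps_deriv l M = 0 ->
  \sum_i X i * fps_deriv i (fcomp M Psi) = 0.
Proof.
move=> Phi0 Psi2 v1 PhiPsi eqPhi eqM.
have Psi0 := tangent_vanish0 Psi2.
pose S l := fmon (lam l) (unit_index l).
pose w := 1 + fcomp v Psi.
have XPhiPsi i : fcomp (fcomp (X i) Phi) Psi = X i.
  rewrite fcompA // -[RHS]fcomp_id; congr fcomp; apply/funext => k; exact: PhiPsi.
pose A : 'M[fps C n]_n := \matrix_(m, i) fcomp (fps_deriv m (Phi i)) Psi.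
pose B : 'M[fps C n]_n := \matrix_(i, l) fps_deriv i (Psi l).
have BA : B *m A = 1%:M.
  apply/matrixP => l i; rewrite !mxE -fderiv_var -PhiPsi fcomp_chain //.
  by apply: eq_bigr => m _; rewrite !mxE mulrC.
have AB := mulmx1C BA.
have wX i : w * X i = \sum_m fcomp (S m) Psi * A m i.
  rewrite -{1}XPhiPsi /w -(fcomp1 Psi0) -fcompD -fcompM // -eqPhi fcomp_sum.
  by apply: eq_bigr => m _; rewrite fcompM // mxE.
have rel l : \sum_i (w * X i) * fps_deriv i (Psi l) = fcomp (S l) Psi.
  under eq_bigr do rewrite wX mulr_suml.
  rewrite exchange_big /= (bigD1 l) //= [X in _ + X]big1 ?addr0 => [|m ml].
    transitivity (fcomp (S l) Psi * (A *m B) l l); last by rewrite AB mxE eqxx mulr1.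
    by rewrite mxE mulr_sumr; apply: eq_bigr => i _; rewrite [B _ _]mxE mulrA.
  transitivity (fcomp (S m) Psi * (A *m B) m l); last by rewrite AB mxE (negPf ml) mulr0.
  by rewrite mxE mulr_sumr; apply: eq_bigr => i _; rewrite [B _ _]mxE mulrA.
have := related_derivation M Psi0 rel; rewrite eqM fcomp0.
under eq_bigr do rewrite -mulrA.
rewrite -mulr_sumr => /fps_dom[|//] w0.
have := congr1 (fun g : fps C n => g 0) w0.
(* the unit 1 + v o Psi has constant term 1 *)
rewrite /w fpsD fcomp_at0 // v1 ?mdeg0 // fps1E eqxx addr0 fps0 => /eqP.
by rewrite oner_eq0.
Qed.

(** The integrals are the resonant monomials x_j0^(e_i) x_i^E read in the
    linearizing coordinates.  They are independent: the minor of their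
    Jacobian matrix omitting x_j0 is diagonal. *)
Theorem diagonal_integrals : exists H : 'I_n.-1 -> fps C n,
  [/\ forall k, convergent (H k), forall k, H k 0 = 0,
      forall k, \sum_i X i * fps_deriv i (H k) = 0 &
      exists j, formal_wedge H j <> 0].
Proof.
have [Phi [Psi [v [Phi0 Psi2 v1 PsiC [PhiPsi eqPhi]]]]] := convergent_linearization.
have Psi0 := tangent_vanish0 Psi2.
have [E [e [E0 He]]] := resonant_exponents im_pos im_neg rank1.
(* the exponents of the resonant monomials *)
pose q (k : 'I_p) : multiindex n := [ffun i => if i == j0 then e (lift j0 k)
   else if i == lift j0 k then E else 0%N].
have qj0 k : q k j0 = e (lift j0 k) by rewrite ffunE eqxx.
have lj (k : 'I_p) : (lift j0 k == j0) = false by rewrite eq_sym (negPf (neq_lift j0 k)).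
have ql k l : q k (lift j0 l) = if l == k then E else 0%N.
  by rewrite ffunE lj (inj_eq (@lift_inj _ j0)).
pose M k : fps C n := fmon 1 (q k).
have wq k : weight lam (q k) = 0.
  rewrite /weight (bigD1_ord j0) //= qj0 (bigD1 k) //= ql eqxx big1 => [|l lk]; last first.
    by rewrite ql (negPf lk) mul0r.
  by rewrite addr0 He // lj.
exists (fun k => fcomp (M k) Psi); split.
- by move=> k; apply: convergent_comp => //; exact: convergent_fmon.
- move=> k; rewrite fcomp_at0 // /M /fmon; case: eqP => // /ffunP /(_ (lift j0 k)).
  by rewrite ql eqxx ffunE => e0; rewrite -e0 in E0.
- move=> k; apply: (linear_integral Phi0 Psi2 v1 PhiPsi eqPhi).
  apply/funext => m; rewrite diag_deriv -/(weight lam m) fps0 /M /fmon.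
  by case: eqP => [->|]; rewrite ?wq ?mul0r ?mulr0.
apply: (@wedge_comp C p M Psi Psi0 (det_fjac_tangent Psi2)).
  by move=> g; exact: (fcomp_near_id_inj Psi0 Psi2).
exists j0; rewrite /formal_wedge.
have -> : row' j0 (\matrix_(i < n, k < n.-1) fps_deriv i (M k)) =
   diag_mx (\row_k fps_deriv (lift j0 k) (M k)).
  apply/matrixP => l k; rewrite !mxE; case: eqP => [->|/eqP lk]; first by rewrite mulr1n.
  by rewrite mulr0n; apply: (fderivX (lift j0 l) 1 0 (q k)).2; rewrite ql (negPf lk).
rewrite det_diag; apply: (big_ind (fun g : fps C n => g <> 0)).
- by move=> /eqP; rewrite oner_eq0.
- by move=> g h g0 h0 /fps_dom[].
move=> k _; rewrite mxE; case: (midx_unitP (q k) (lift j0 k)) => [|[l ql']].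
  by rewrite ql eqxx => e0; rewrite e0 in E0.
rewrite /M ql' (fderivX (lift j0 k) 1 l 0).1; apply: fmon_neq0.
by rewrite pnatr_eq0.
Qed.
End DiagonalCase.

(** * Linear changes of coordinates *)

Section LinearAction.
Variables (K : comNzRingType) (n : nat).
Implicit Types (Y Phi : 'I_n -> fps K n) (P Q : 'M[K]_n).

Lemma fmon_sum I (r : seq I) (A : pred I) (c : I -> K) (k : multiindex n) :
  \sum_(i <- r | A i) fmon (c i) k = fmon (\sum_(i <- r | A i) c i) k.
Proof.
symmetry; apply: (big_morph (fun c => fmon c k) (fun c d => fmonD c d k) (fmon0 _ _)).
Qed.

(** The product of the row vector Y by a constant matrix. *)
Definition mx_act Q Y k : fps K n := \sum_l fmon (Q l k) 0 * Y l.

Lemma mx_actM P Q Y : mx_act P (mx_act Q Y) = mx_act (Q *m P) Y.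
Proof.
apply/funext => k; rewrite /mx_act; under eq_bigr do rewrite mulr_sumr.
rewrite exchange_big; apply: eq_bigr => l _ /=; rewrite mxE -fmon_sum mulr_suml.
by apply: eq_bigr => i _; rewrite mulrA fmonM addr0 mulrC [P _ _ * _]mulrC mulrC.
Qed.
Lemma mx_act1 Y : mx_act 1%:M Y = Y.
Proof.
apply/funext => k; rewrite /mx_act (bigD1 k) //= mxE eqxx fmon10 mul1r.
by rewrite big1 ?addr0 // => l lk; rewrite mxE (negPf lk) fmon0 mul0r.
Qed.
Lemma fcomp_mx_act Q Y Phi k : vanish0 Phi ->
  fcomp (mx_act Q Y k) Phi = mx_act Q (fun l => fcomp (Y l) Phi) k.
Proof.
move=> P1; rewrite fcomp_sum; apply: eq_bigr => l _.
by rewrite fcompM // fcomp_const.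
Qed.
Lemma derivation_linear_map P Y l :
  \sum_i Y i * fps_deriv i (linear_map P l) = mx_act P Y l.
Proof. by apply: eq_bigr => i _; rewrite fderiv_linear_map mulrC. Qed.

Lemma ordge2P (f : fps K n) : f 0 = 0 -> (forall j, fps_deriv j f 0 = 0) -> ordge 2 f.
Proof.
move=> f0 f1 m m2; have [/eqP/mdeg_eq0->//|mp] := boolP (mdeg m == 0%N).
have [j [l ml]] : exists j l, m = l + unit_index j.
  apply: contrapT => H; case/eqP: mp.
  rewrite /mdeg big1 // => i _; case: (midx_unitP m i) => // -[l kl].
  by case: H; exists i, l.
have l0 : l = 0 by apply: mdeg_eq0; move: m2; rewrite ml mdegD mdeg_unit; lia.
by have := f1 j; rewrite /fps_deriv ffunE mulr1n ml l0.
Qed.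
End LinearAction.

(** * The general case *)

Section MainTheorem.
Variables (R : realType) (p : nat).
Local Notation n := p.+1.
Local Notation C := (cplx R).

Lemma det_linear_map (P : 'M[C]_n) : P \in unitmx -> \det (fjac (linear_map P)) <> 0.
Proof.
move=> Pu /(congr1 (fun g : fps C n => g 0)); rewrite fps0 det_const_coef.
have -> : \matrix_(i, j) fjac (linear_map P) i j 0 = P.
  by apply/matrixP => i j; rewrite !mxE fderiv_linear_map /fmon eqxx.
by move: Pu; rewrite unitmxE unitfE => /eqP.
Qed.

(** Similar matrices have the same characteristic polynomial, so the diagonal
    entries are a permutation of the given list of eigenvalues. *)
Lemma diagonal_spectrum (J : 'M[C]_n) (lam : 'I_n -> C) (u : C) (j : 'I_n) :
  diagonalizable J -> char_poly J = \prod_(i < n) ('X - (lam i)%:P) ->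
  0 < 'Im (lam j / u) -> (forall i, i != j -> 'Im (lam i / u) < 0) ->
  exists (P : 'M[C]_n) (d : 'rV[C]_n) (j0 : 'I_n),
    [/\ P \in unitmx, P *m J = diag_mx d *m P, 0 < 'Im (d 0 j0 / u) &
        forall i, i != j0 -> 'Im (d 0 i / u) < 0].
Proof.
move=> [P Pu /diagonalizable_forPex[d /(simmxP Pu) PJ]] cJ imj imn.
have Jd : J = invmx P *m diag_mx d *m P by rewrite -mulmxA -PJ mulKmx.
have cd : char_poly J = \prod_(i < n) ('X - (d 0 i)%:P).
  have -> : char_poly J = char_poly (diag_mx d).
    rewrite /char_poly /char_poly_mx.
    pose Q := map_mx (@polyC C) P; pose Q' := map_mx (@polyC C) (invmx P).
    have Q'Q : Q' *m Q = 1%:M by rewrite -map_mxM mulVmx // map_mx1.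
    have -> : 'X%:M - map_mx (@polyC C) J = Q' *m ('X%:M - map_mx (@polyC C) (diag_mx d)) *m Q.
      rewrite mulmxBr mulmxBl -!map_mxM -Jd; congr (_ - _).
      by rewrite scalar_mxC -mulmxA Q'Q mulmx1.
    by rewrite !det_mulmx mulrAC -det_mulmx Q'Q det1 mul1r.
  rewrite char_poly_trig ?diag_mx_is_trig //.
  by apply: eq_bigr => i _; rewrite mxE eqxx.
have : perm_eq [tuple lam i | i < n] [tuple d 0 i | i < n].
  apply: prod_XsubC_eq; rewrite !big_tuple.
  under eq_bigr do rewrite tnth_mktuple.
  under [RHS]eq_bigr do rewrite tnth_mktuple.
  by rewrite -cJ -cd.
move=> /tuple_permP[s es].
have ls i : lam i = d 0 (s i).
  have : [tuple lam i | i < n] = [tuple tnth [tuple d 0 i | i < n] (s i) | i < n].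
    exact: val_inj.
  by move=> /(congr1 (fun t => tnth t i)); rewrite !tnth_mktuple.
exists P, d, (s j); split=> // [|i ij]; first by rewrite -ls.
rewrite -(permKV s i) -ls; apply: imn.
by apply: contraNneq ij => <-; rewrite permKV.
Qed.

(** With L the linear map of a diagonalizing basis, X is conjugated to
    Y = L^-1 (X o L), whose linear part is diagonal. *)
Theorem convergent_integrals (X : 'I_n -> fps C n) (Fhat : 'I_n.-1 -> fps C n)
    (J := \matrix_(i, k) fps_deriv i (X k) 0) (lam : 'I_n -> C) (u : C) (j : 'I_n) :
  (forall k, convergent (X k)) -> (forall k, X k 0 = 0) ->
  diagonalizable J -> char_poly J = \prod_(i < n) ('X - (lam i)%:P) ->
  0 < 'Im (lam j / u) -> (forall i, i != j -> 'Im (lam i / u) < 0) ->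
  (forall k, \sum_i X i * fps_deriv i (Fhat k) = 0) ->
  (exists j, formal_wedge Fhat j <> 0) ->
  exists H : 'I_n.-1 -> fps C n,
  [/\ forall k, convergent (H k), forall k, H k 0 = 0,
      forall k, \sum_i X i * fps_deriv i (H k) = 0 &
      exists j, formal_wedge H j <> 0].
Proof.
move=> Xc X0 Jdiag Jchar imj imn intF wF.
have [P [d [j0 [Pu PJ imp imneg]]]] := diagonal_spectrum Jdiag Jchar imj imn.
have PV := mulmxV Pu; have VP := mulVmx Pu.
pose L := linear_map P; pose Li := linear_map (invmx P).
have L0 : vanish0 L by exact: linear_map_vanish0.
have Li0 : vanish0 Li by exact: linear_map_vanish0.
pose Y := mx_act (invmx P) (fun l => fcomp (X l) L).
have relL l : \sum_i Y i * fps_deriv i (L l) = fcomp (X l) L.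
  by rewrite derivation_linear_map mx_actM VP mx_act1.
have relLi l : \sum_i X i * fps_deriv i (Li l) = fcomp (Y l) Li.
  rewrite derivation_linear_map fcomp_mx_act //; congr mx_act.
  by apply/funext => k; rewrite fcomp_linear_inv.
pose f i := Y i - fmon (d 0 i) (unit_index i).
have YE i : fmon (d 0 i) (unit_index i) + f i = Y i by rewrite addrC subrK.
have f2 i : ordge 2 (f i).
  apply: ordge2P => [|l].
    rewrite /f fpsB /Y /mx_act fps_sumE big1 => [|l _]; last first.
      by rewrite fmonC_mul fcomp_at0 // X0 mulr0.
    by rewrite (@ordge_fmon _ _ _ (unit_index i)) ?subr0 // mdeg0 mdeg_unit.
  have -> : fps_deriv l (f i) = fps_deriv l (Y i) - fps_deriv l (fmon (d 0 i) (unit_index i)).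
    by apply/eqP; rewrite eq_sym subr_eq -fderivD addrC YE.
  have dY : fps_deriv l (Y i) 0 = (P *m J *m invmx P) l i.
    rewrite /Y fderiv_sum fps_sumE mxE; apply: eq_bigr => m _.
    rewrite fderivM fderiv_fmon0 mul0r add0r fmonC_mul mulrC; congr (_ * _).
    rewrite fcomp_chain // fps_sumE mxE; apply: eq_bigr => a _.
    by rewrite fderiv_linear_map mulrC fmonC_mul fcomp_at0 // mxE.
  rewrite fpsB dY PJ mulmxK // !mxE.
  rewrite fmonE fderivM fderiv_fmon0 mul0r add0r fmonC_mul -/(fvar C i) fderiv_var.
  case: (eqVneq l i) => [->|_]; first by rewrite !mulr1n fps1E eqxx mulr1 subrr.
  by rewrite !mulr0n fps0 mulr0 subrr.
have Lc k : convergent (L k) by apply: convergent_sum => i _; exact: convergent_fmon.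
have Lic k : convergent (Li k) by apply: convergent_sum => i _; exact: convergent_fmon.
have fc i : convergent (f i).
  apply: convergentB; last exact: convergent_fmon.
  apply: convergent_sum => l _; apply: convergentM; first exact: convergent_fmon.
  exact: convergent_comp.
have invL g : fcomp (fcomp g L) Li = g by exact: fcomp_linear_inv.
have invLi g : fcomp (fcomp g Li) L = g by exact: fcomp_linear_inv.
have [||H [Hc H0 HY wH]] := @diagonal_integrals R p (fun i => d 0 i) j0 f u f2 fc imp imneg
   (fun k => fcomp (Fhat k) L).
- move=> k; under eq_bigr do rewrite YE.
  by rewrite (related_derivation _ L0 relL) intF fcomp0.
- apply: (@wedge_comp C p Fhat L L0 (det_linear_map Pu)) => // g g0.
  by rewrite -(invL g) g0 fcomp0.
exists (fun k => fcomp (H k) Li); split.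
- by move=> k; apply: convergent_comp.
- by move=> k; rewrite fcomp_at0.
- move=> k; rewrite (related_derivation _ Li0 relLi).
  have := HY k; under eq_bigr do rewrite YE.
  by move=> ->; rewrite fcomp0.
apply: (@wedge_comp C p H Li Li0 _) => // [|g g0].
  by apply: det_linear_map; rewrite unitmx_inv.
by rewrite -(invLi g) g0 fcomp0.
Qed.

(** Everything is carried over to germs by expansions: X(f) and the wedge are
    polynomial in the partial derivatives, so their expansions are the
    corresponding formal expressions. *)
Theorem holomorphic_integrals (X : 'rV[C]_n -> 'rV[C]_n) :
  nondegenerate_generic X -> condition_star X ->
  (exists Fhat : 'I_n.-1 -> fps C n, formal_first_integral X Fhat) ->
  exists F : 'rV[C]_n -> 'rV[C]_n.-1, holomorphic_first_integral X F.
Proof.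
move=> [[_ X0] _ Jdiag _] [lam [Jchar [u [j [_ imj imn]]]]] [Fhat [wF [Xhat [HX intF]]]].
have [g [Hg nearJ]] := expansion_jacobian HX.
have JE : 'J X 0 = \matrix_(i, k) fps_deriv i (Xhat k) 0.
  rewrite (nbhs_singleton nearJ); apply/matrixP => i k; rewrite !mxE.
  exact: expansion_at0.
rewrite JE in Jdiag Jchar.
have Xc k := expansion_convergent (HX k).
have Xhat0 k : Xhat k 0 = 0 by rewrite -(expansion_at0 (HX k)) X0 mxE.
have [H [Hc H0 intH wH]] := convergent_integrals Xc Xhat0 Jdiag Jchar imj imn intF wF.
have [h Hh] := choice (fun k => convergent_expansion (Hc k)).
pose F (x : 'rV[C]_n) : 'rV[C]_n.-1 := \row_k h k x.
have HF k : has_expansion (fun x => F x 0 k) (H k).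
  by rewrite (_ : (fun x => _) = h k) //; apply/funext => x; rewrite mxE.
exists F; split.
- by move=> k; exists (H k).
- by apply/rowP => k; rewrite (expansion_at0 (HF k)) H0 mxE.
- move=> w0; have [j1 wj] := wH; apply: wj.
  have [G [HG nearG]] := expansion_jacobian HF.
  apply: (@expansion_eq0 _ _ (fun x => \det (\matrix_(a, b) G (lift j1 a) b x))).
    by apply: expansion_det => a b; rewrite !mxE; exact: HG.
  near=> x.
  have : wedge F j1 x = 0 by move: j1; near: x.
  rewrite /wedge (near nearG x _) // => <-.
  by congr (\det _); apply/matrixP => a b; rewrite !mxE.
move=> k; have [G [HG nearG]] := expansion_diff (HF k).
have sum0 : \forall x \near (0 : 'rV[C]_n), \sum_i X x 0 i * G i x = 0.
  apply: expansion0_near; rewrite -(intH k).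
  by apply: expansion_sum => i _; exact: expansionM.
by near=> x; rewrite (near nearG x _) //; near: x.
Unshelve. all: by end_near.
Qed.
End MainTheorem.

Local Open Scope complex_scope.

Theorem theorem3p3p2 (R : realType) (n : nat)
    (X : 'rV[R[i]]_n -> 'rV[R[i]]_n) :
  (3 <= n)%N ->
  nondegenerate_generic X ->
  condition_star X ->
  (exists Fhat : 'I_n.-1 -> fps R[i] n, formal_first_integral X Fhat) ->
  exists F : 'rV[R[i]]_n -> 'rV[R[i]]_n.-1, holomorphic_first_integral X F.
Proof.
case: n X => [//|p] X _; exact: holomorphic_integrals.
Qed.
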